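(* Let $\alpha:S\curvearrowright A$ be an action of an inverse semigroup $S$ on a Banach algebra $A$. The Banach algebra crossed product $A\rtimes_\alpha S$ has the following properties: (1) there is a covariant representation $(\iota,u)$ of $\alpha$ in $A\rtimes_\alpha S$ (which we may assume to be normalized) such that $A\rtimes_\alpha S=B(\iota,u)$; (2) for any covariant representation $(\pi,v)$ of $\alpha$ in a Banach algebra $B$ there is a unique representation $\pi\rtimes v:A\rtimes_\alpha S\to B$ such that $(\pi\rtimes v)(\iota(a)u_t)=\pi(a)v_t$ for all $a\in I_t$, $t\in S$. Every Banach algebra satisfying (1) and (2) (i.e. every Banach algebra $C$ for which there is a covariant representation $(\tilde\iota,\tilde u)$ of $\alpha$ in $C$ with $C=B(\tilde\iota,\tilde u)$ and such that the analogue of (2) holds with $(C,\tilde\iota,\tilde u)$ in place of $(A\rtimes_\alpha S,\iota,u)$) is canonically isometrically isomorphic to $A\rtimes_\alpha S$ (via $\tilde\iota(a)\tilde u_t\mapsto\iota(a)u_t$, $a\in I_t$, $t\in S$). In addition: (a) For every Banach algebra $B$ there is a one-to-one correspondence between representations $\Psi:A\rtimes_\alpha S\to B$ and normalized covariant representations $(\pi,v)$ of $\alpha$ in $B$, where $$\Psi(\iota(a)u_t)=\pi(a)v_t\qquad\text{for all } a\in I_t,\ t\in S.\qquad ( * )$$ If $(B,B_* )$ is a dual Banach algebra, the description of normalized covariant representations of $\alpha$ in $B$ simplifies as follows: a pair $(\pi,v)$ is a normalized covariant representation of $\alpha$ in $B$ if and only if $\pi:A\to B$ is a representation and $v:S\to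 B_1$ is a semigroup homomorphism such that $v_t\pi(a)v_{t^*}=\pi(\alpha_t(a))$ for all $a\in I_{t^*}$, $t\in S$, and $v_e=\overline{\pi}_e(1_e)$ for all $e\in E(S)$. (b) If $E$ is a reflexive Banach space, then $( * )$ establishes a one-to-one correspondence between representations $\Psi:A\rtimes_\alpha S\to B(E)$ and covariant representations $(\pi,v)$ of $\alpha$ on the Banach space $E$.
   Context: **Basic conventions.** A representation of a Banach algebra in another Banach algebra is a contractive algebra homomorphism. An ideal is a closed two-sided ideal. An approximate unit is a contractive two-sided approximate unit. $B_1$ denotes the closed unit ball of $B$. $B(E)$ is the Banach algebra of bounded operators on a Banach space $E$. **Inverse semigroups.** An inverse semigroup is a semigroup $S$ in which every $t$ has a unique $t^*$ with $t=tt^*t$, $t^*=t^*tt^*$; $E(S)$ is the set of idempotents. **Actions.** A partial automorphism of $A$ is an isometric algebra isomorphism between two ideals of $A$; partial automorphisms are composed on the largest domain on which the composition makes sense. An action $\alpha:S\curvearrowright A$ is a family of partial automorphisms $\alpha_t:I_{t^*}\to I_t$, $t\in S$, such that $\alpha_s\circ\alpha_t=\alpha_{st}$ (as partial maps) for all $s,t\in S$; each ideal $I_t$ has an approximate unit; and $\bigcup_{e\in E(S)}I_e$ is linearly dense in $A$. If $S$ has a zero, also $I_0=\{0\}$. **Biduals.** $B'$ is the dual and $B''$ the bidual of $B$; the $B'$-topology on $B''$ is the weak$^*$ topology. $B''$ is a Banach algebra containing $B$ with the second Arens product $a\cdot b=B'\text{-}\lim_\beta B'\text{-}\lim_\alpha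 a_\alpha b_\beta$ for nets $(a_\alpha),(b_\beta)$ in $B$ that $B'$-converge to $a,b$. For a Banach algebra $I$ with an approximate unit, the multiplier algebra is $\mathcal M(I)=\{b\in I'':ba,ab\in I\text{ for all }a\in I\}\subseteq I''$; any approximate unit of $I$ converges $I'$-weakly to a left identity of $I''$, which is the unit of $\mathcal M(I)$. The unit of $\mathcal M(I_t)\subseteq I_t''\subseteq A''$ is denoted $1_t$. **Covariant representations in a Banach algebra.** A covariant representation of $\alpha$ in a Banach algebra $B$ is a pair $(\pi,v)$ where $\pi:A\to B$ is a representation and $v:S\to(B'')_1$ is a map such that - (CR1) $v_t\pi(a)=\pi(\alpha_t(a))v_t\in B$ for all $a\in I_{t^*}$, $t\in S$; - (CR2) $\pi(a)v_sv_t=\pi(a)v_{st}$ for all $a\in I_{st}$, $s,t\in S$; - (CR3) $\pi(a)v_e=\pi(a)$ for all $a\in I_e$, $e\in E(S)$. Its range is $B(\pi,v):=\overline{\mathrm{span}}\{\pi(a)v_t:a\in I_t,t\in S\}\subseteq B$. It is normalized if for every $t\in S$, $v_t=B'\text{-}\lim_i\pi(\mu_i^t)v_t$ for an approximate unit $\{\mu_i^t\}_i$ in $I_t$ (the limit being taken in $B''$). **Dual Banach algebras.** A dual Banach algebra is a pair $(B,B_* )$ with $B$ a Banach algebra, $B_*$ a predual Banach space of $B$, and multiplication separately $B_*$-weakly continuous. In this case, for a representation $\pi:A\to B$ and $e\in E(S)$, $\overline\pi_e:\mathcal M(I_e)\to B$ denotes the unique strictly-$B_*$-continuous extension of $\pi|_{I_e}$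 to a representation of $\mathcal M(I_e)$, given by $\overline\pi_e(m)=B_*\text{-}\lim_i\pi(m\mu_i)$ for any approximate unit $\{\mu_i\}$ in $I_e$ (the strict topology on $\mathcal M(I_e)$ is given by the seminorms $m\mapsto\|ma\|$, $m\mapsto\|am\|$, $a\in I_e$). **Covariant representations on a Banach space.** A covariant representation of $\alpha$ on a Banach space $E$ is a pair $(\pi,v)$ where $\pi:A\to B(E)$ is a representation and $v:S\to B(E)_1$ is a semigroup homomorphism such that $v_t\pi(a)=\pi(\alpha_t(a))v_t$ for all $a\in I_{t^*}$, $t\in S$, and $v_tE=\overline{\pi(I_t)E}$ for $t\in S$. **Crossed product.** $\ell^1(\alpha):=\{f\in\ell^1(S,A):f(t)\in I_t,\ t\in S\}$ with norm $\|f\|_1=\sum_t\|f(t)\|$ and product $(f*g)(r)=\sum_{st=r}\alpha_s(\alpha_{s^*}(f(s))g(t))$ is a Banach algebra. For a covariant representation $(\pi,v)$ in $B$, $\pi\times v(f):=\sum_{t\in S}\pi(f(t))v_t$ defines a representation $\pi\times v:\ell^1(\alpha)\to B$. The crossed product $A\rtimes_\alpha S$ is the Hausdorff completion of $\ell^1(\alpha)$ in the submultiplicative seminorm $\|f\|_{\max}:=\sup\{\|\pi\times v(f)\|:(\pi,v)\text{ is a covariant representation of }\alpha\text{ in a Banach algebra}\}$.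
   Formalization: Normalized and 1_t refer to a fixed choice of approximate units converging weak* in A'' (limits can differ, e.g. in L^1(R), so (a) fails otherwise); for dual Banach algebras, v is B-valued and normalized by B_*-limits (B'-limits fail for c_0 in l^∞). *)

(* Defs.v *)
From HB Require Import structures.
From mathcomp Require Import all_boot all_order all_algebra.
From mathcomp Require Import finmap.
From mathcomp Require Import all_classical all_reals topology normedtype.
From mathcomp Require Import complex.
From mathcomp.analysis.showcase Require summability.

Set Implicit Arguments.
Unset Strict Implicit.
Unset Printing Implicit Defensive.

Import Order.TTheory GRing.Theory Num.Theory.
Import numFieldNormedType.Exports.

Local Open Scope classical_set_scope.
Local Open Scope ring_scope.

(** * Scalars, Banach algebras, inverse semigroups *)

Variant real_or_complex (R : realType) : numFieldType -> Prop :=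
| RealScalars : real_or_complex R R
| ComplexScalars : real_or_complex R (R[i])%C.

(* Banach algebras are not assumed unital, so they are not ring structures of
   the MathComp hierarchy. *)
HB.mixin Record isBanachAlgebra (K : numFieldType) B
    of CompleteNormedModule K B := {
  bmul : B -> B -> B;
  bmulA : associative bmul;
  bmulDl : left_distributive bmul +%R;
  bmulDr : right_distributive bmul +%R;
  bmulZl : forall (k : K) x y, bmul (k *: x) y = k *: bmul x y;
  bmulZr : forall (k : K) x y, bmul x (k *: y) = k *: bmul x y;
  bmul_norm : forall x y, `|bmul x y| <= `|x| * `|y|
}.

#[short(type="banachAlgType")]
HB.structure Definition BanachAlgebra (K : numFieldType) :=
  {B of isBanachAlgebra K B & CompleteNormedModule K B}.

Infix "*b" := bmul (at level 40, left associativity) : ring_scope.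

HB.mixin Record isInverseSemigroup S of Semigroup S := {
  star : S -> S;
  mul_starK : forall t : S, (t * star t * t)%g = t;
  star_mulK : forall t : S, (star t * t * star t)%g = star t;
  star_unique : forall t s : S,
    (t * s * t)%g = t -> (s * t * s)%g = s -> s = star t
}.

#[short(type="invSemigroupType")]
HB.structure Definition InverseSemigroup :=
  {S of isInverseSemigroup S & Semigroup S}.

Definition idem (S : invSemigroupType) (e : S) := (e * e)%g = e.

Definition is_zero (S : invSemigroupType) (z : S) :=
  forall s : S, (z * s)%g = z /\ (s * z)%g = z.

Section basic.
Context {K : numFieldType}.

Definition subspace (V : normedModType K) (W : set V) :=
  W 0 /\ forall (k : K) x y, W x -> W y -> W (k *: x + y).

Definition lspan (V : normedModType K) (X : set V) : set V :=
  smallest (@subspace V) X.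

Definition ideal (A : banachAlgType K) (I : set A) :=
  [/\ closed I, subspace I
    & forall a b, I a -> I (a *b b) /\ I (b *b a)].

(* The filter F plays the role of the net: it is the filter of eventuality of
   the net in A, and every proper filter arises in this way. *)
Definition approx_unit (A : banachAlgType K) (I : set A) (F : set_system A) :=
  [/\ ProperFilter F, F [set mu | I mu /\ `|mu| <= 1]
    & forall a, I a -> (mu *b a @[mu --> F] --> a) /\
                       (a *b mu @[mu --> F] --> a)].

Definition representation (A B : banachAlgType K) (pi : A -> B) :=
  [/\ linear pi, forall a b, pi (a *b b) = pi a *b pi b
    & forall a, `|pi a| <= `|a|].

Definition isometric_isomorphism (A B : banachAlgType K) (f : A -> B) :=
  [/\ bijective f, linear f, forall a b, f (a *b b) = f a *b f b
    & forall a, `|f a| = `|a|].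

(* The operator norm of f is at most c; the condition 0 <= c matters only when
   V = 0. *)
Definition opnorm_le (V W : normedModType K) (f : V -> W) (c : K) :=
  0 <= c /\ forall x, `|f x| <= c * `|x|.

Definition bounded_linear (V W : normedModType K) (f : V -> W) :=
  linear f /\ exists c, opnorm_le f c.

End basic.

(** * Duals and biduals *)

Section dual.
Context {K : numFieldType} (V : normedModType K).

Definition dual_pred : {pred V -> K^o} :=
  fun f => `[< bounded_linear (f : V -> K^o) >].

Lemma dual_submod_closed : submod_closed dual_pred.
Proof.
split=> [|a f g /asboolP [lf [c [c0 fc]]] /asboolP [lg [d [d0 gd]]]].
  apply/asboolP; split.
    by move=> k x y; rewrite [LHS]/(0 : K^o) scaler0 addr0.
  by exists 0; split=> // x; rewrite normr0 mul0r.
apply/asboolP; split.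
  move=> k x y; rewrite !fctE lf lg !scalerDr !scalerA mulrC -!addrA.
  by congr (_ + _); rewrite addrCA.
exists (`|a| * c + d); split; first by rewrite addr_ge0 ?mulr_ge0.
move=> x; rewrite !fctE (le_trans (ler_normD _ _)) // mulrDl lerD ?gd //.
by rewrite normrZ -mulrA ler_wpM2l.
Qed.

HB.instance Definition _ :=
  GRing.isSubmodClosed.Build K (V -> K^o) dual_pred dual_submod_closed.

Record dual := Dual { dual_val :> V -> K^o; dualP : dual_val \in dual_pred }.

HB.instance Definition _ := [isSub for dual_val].
HB.instance Definition _ := [Choice of dual by <:].
HB.instance Definition _ := [SubChoice_isSubLmodule of dual by <:].

(* As opnorm_le, the norm on the dual being the operator norm. *)
Definition bidual_le (phi : dual -> K^o) (c : K) :=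
  0 <= c /\ forall (f : dual) (d : K), opnorm_le f d -> `|phi f| <= c * d.

Definition bidual_pred : {pred dual -> K^o} :=
  fun phi => `[< linear phi /\ exists c, bidual_le phi c >].

Record bidual := Bidual
  { bidual_val :> dual -> K^o; bidualP : bidual_val \in bidual_pred }.

HB.instance Definition _ := [isSub for bidual_val].

Lemma embed_subproof (x : V) : (fun f : dual => f x) \in bidual_pred.
Proof.
apply/asboolP; split=> //; exists `|x|; split=> // f d [_ fd].
by rewrite mulrC.
Qed.

Definition embed (x : V) : bidual := Bidual (embed_subproof x).

(* The inverse of the canonical embedding on its range. *)
Definition embed_inv (phi : bidual) : V := xget 0 [set x | embed x = phi].

Definition reflexive_space := forall phi : bidual, exists x, embed x = phi.

(* Convergence in the weak-* topology of the bidual. *)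
Definition bidual_cvg (T : Type) (phi : T -> bidual) (F : set_system T)
    (l : bidual) :=
  forall f : dual, (phi x f : K^o) @[x --> F] --> (l f : K^o).

End dual.

Arguments dual_pred {K} V.
Arguments bidual_pred {K} V.
Arguments embed {K V} x.
Arguments embed_inv {K V} phi.

Section arens.
Context {K : numFieldType} {B : banachAlgType K}.

Lemma dual_mulr_subproof (f : dual B) (y : B) :
  (fun x => f (x *b y)) \in dual_pred B.
Proof.
have /asboolP [lf [c [c0 fc]]] := dualP f.
apply/asboolP; split=> [k u v|]; first by rewrite bmulDl bmulZl lf.
exists (c * `|y|); split=> [|x]; first exact: mulr_ge0.
rewrite (le_trans (fc _)) // -mulrA ler_wpM2l // mulrC.
exact: bmul_norm.
Qed.

Definition dual_mulr (f : dual B) (y : B) : dual B :=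
  Dual (dual_mulr_subproof f y).

Lemma opnorm_le_mulr (f : dual B) (y : B) (c : K) :
  opnorm_le f c -> opnorm_le (dual_mulr f y) (c * `|y|).
Proof.
move=> [c0 fc]; split=> [|x]; first exact: mulr_ge0.
rewrite (le_trans (fc _)) // -mulrA ler_wpM2l // mulrC.
exact: bmul_norm.
Qed.

Lemma dual_mulrD (k : K) (f : dual B) (x y : B) :
  dual_mulr f (k *: x + y) = k *: dual_mulr f x + dual_mulr f y.
Proof.
apply/val_inj/funext => z.
have /asboolP [lf _] := dualP f.
by rewrite /= bmulDr bmulZr lf.
Qed.

Lemma dual_mulrDl (k : K) (f g : dual B) (y : B) :
  dual_mulr (k *: f + g) y = k *: dual_mulr f y + dual_mulr g y.
Proof. exact/val_inj/funext. Qed.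

Lemma arens_inner_subproof (a : bidual B) (f : dual B) :
  (fun y => a (dual_mulr f y)) \in dual_pred B.
Proof.
have /asboolP [_ [c fc]] := dualP f.
have /asboolP [la [d [d0 ad]]] := bidualP a.
apply/asboolP; split=> [k x y|]; first by rewrite dual_mulrD la.
exists (d * c); split=> [|y]; first by rewrite mulr_ge0 //; case: fc.
by rewrite -mulrA; exact: ad (opnorm_le_mulr y fc).
Qed.

Definition arens_inner (a : bidual B) (f : dual B) : dual B :=
  Dual (arens_inner_subproof a f).

Lemma arens_subproof (a b : bidual B) :
  (fun f => b (arens_inner a f)) \in bidual_pred B.
Proof.
have /asboolP [la [c [c0 ac]]] := bidualP a.
have /asboolP [lb [d [d0 bd]]] := bidualP b.
apply/asboolP; split=> [k f g|].
  rewrite -lb; congr (b _); apply/val_inj/funext => y /=.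
  by rewrite dual_mulrDl la.
exists (d * c); split=> [|f e fe]; first exact: mulr_ge0.
rewrite -mulrA; apply: bd; split=> [|y]; first by rewrite mulr_ge0 //; case: fe.
by rewrite -mulrA; exact: ac (opnorm_le_mulr y fe).
Qed.

(* The second Arens product, (a . b)(f) = b(y |-> a(x |-> f(xy))); it is the
   iterated limit in the lemma arens_lim. *)
Definition arens (a b : bidual B) : bidual B := Bidual (arens_subproof a b).

Lemma arens_lim (a b : bidual B) (Fa Fb : set_system B) :
    bidual_cvg embed Fa a -> bidual_cvg embed Fb b ->
  exists l : B -> bidual B,
    (forall y, bidual_cvg (fun x => embed (x *b y)) Fa (l y)) /\
    bidual_cvg l Fb (arens a b).
Proof.
move=> aFa bFb; exists (fun y => arens a (embed y)); split=> [y f|f].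
  exact: (aFa (dual_mulr f y)).
exact: (bFb (arens_inner a f)).
Qed.

End arens.

Infix "**" := arens (at level 40, left associativity) : ring_scope.

(** * Actions *)

(* act t is only meaningful on the ideal dom (star t), which it maps onto
   dom t. *)
Record action {K : numFieldType} (S : invSemigroupType) (A : banachAlgType K) :=
  Action {
    dom : S -> set A;
    act : S -> A -> A;
    dom_ideal : forall t, ideal (dom t);
    act_image : forall t, act t @` dom (star t) = dom t;
    act_linear : forall t k a b, dom (star t) a -> dom (star t) b ->
      act t (k *: a + b) = k *: act t a + act t b;
    act_mul : forall t a b, dom (star t) a -> dom (star t) b ->
      act t (a *b b) = act t a *b act t b;
    act_norm : forall t a, dom (star t) a -> `|act t a| = `|a|;
    act_comp_dom : forall s t,
      dom (star t) `&` act t @^-1` dom (star s) = dom (star (s * t)%g);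
    act_comp : forall s t a, dom (star (s * t)%g) a ->
      act s (act t a) = act (s * t)%g a;
    dom_approx_unit : forall t, exists F, approx_unit (dom t) F;
    dom_dense : closure (lspan (\bigcup_(e in [set e | idem e]) dom e)) = setT;
    dom_zero : forall z, is_zero z -> dom z = [set 0]
  }.

(** * Multiplier algebras *)

Section multipliers.
Context {K : numFieldType} {A : banachAlgType K}.
Implicit Types (I : set A) (m : bidual A).

(* The bidual of a closed subspace I as a subspace of the bidual of A: the
   image of the bidual of the inclusion is the bipolar of I. *)
Definition sub_bidual I : set (bidual A) :=
  [set m | forall f : dual A, (forall a, I a -> f a = 0) -> m f = 0].

Definition multiplier I : set (bidual A) :=
  [set m | sub_bidual I m /\ forall a, I a ->
     (exists2 b, I b & m ** embed a = embed b) /\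
     (exists2 b, I b & embed a ** m = embed b)].

Lemma approx_unit_multiplier I F m :
    approx_unit I F -> bidual_cvg embed F m ->
  [/\ multiplier I m,
      forall a, I a -> m ** embed a = embed a /\ embed a ** m = embed a
    & forall n, sub_bidual I n -> m ** n = n].
Proof.
move=> [FF Fball Fau] mF.
have cv (f : dual A) (g : A -> A) (l : A) : g mu @[mu --> F] --> l ->
    (f (g mu) : K^o) @[mu --> F] --> (f l : K^o).
  have /asboolP [lf [c [c0 fc]]] := dualP f.
  move=> gl; apply/cvgrPdist_lt => e e0.
  have e1 : 0 < e / (c + 1) by rewrite divr_gt0 ?ltr_wpDl.
  move/cvgrPdist_lt : gl => /(_ _ e1); apply: filterS => x xl.
  have -> : (f l : K^o) - f (g x) = f (l - g x).
    by have := lf (-1) (g x) l; rewrite !scaleN1r ![- _ + _]addrC => ->.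
  rewrite (le_lt_trans (fc _)) //.
  rewrite (@le_lt_trans _ _ ((c + 1) * `|l - g x|)) //.
    by rewrite ler_wpM2r // lerDl.
  by rewrite mulrC -ltr_pdivlMr // ltr_wpDl.
have uniq (g : A -> K^o) (k l : K^o) :
    g mu @[mu --> F] --> k -> g mu @[mu --> F] --> l -> k = l.
  move=> gk gl; exact: (@cvg_unique _ (@norm_hausdorff _ _) (g @ F) _ k l gk gl).
have mul a : I a -> m ** embed a = embed a /\ embed a ** m = embed a.
  move=> Ia; have [al ar] := Fau _ Ia; split; apply/val_inj/funext => f.
    exact: (uniq _ _ _ (mF (dual_mulr f a)) (cv f _ _ al)).
  exact: (uniq _ _ _ (mF (arens_inner (embed a) f)) (cv f _ _ ar)).
split=> //.
  split=> [f fI|a Ia]; last first.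
    by have [ma am] := mul _ Ia; split; exists a.
  apply: (uniq _ _ _ (mF f)).
  apply: (@cvg_trans _ ((fun=> 0 : K^o) @ F)); last exact: cvg_cst.
  by apply: near_eq_cvg; apply: filterS Fball => x [Ix _]; rewrite /= fI.
move=> n nI; apply/val_inj/funext => f.
have /asboolP [ln _] := bidualP n.
have nf : n ((-1) *: f + arens_inner m f) = 0.
  apply: nI => a Ia; have [ma _] := mul _ Ia.
  have /= mf := congr1 (fun p : bidual A => p f) ma.
  by rewrite [LHS]/((-1) *: f a + arens_inner m f a) /= mf scaleN1r; exact: addNr.
move: nf; rewrite ln scaleN1r addrC => /eqP; rewrite subr_eq0 => /eqP.
exact.
Qed.

End multipliers.

(* A choice of an approximate unit mu t in every dom t, weak-* convergent in
   the bidual of A with limit one t, the unit 1_t.  The choice matters: the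
   right- and left-sided approximate units of the convolution algebra L^1 of
   the line have different weak-* limit points, both satisfying the conclusions
   of approx_unit_multiplier. *)
Definition unit_system {K : numFieldType} (S : invSemigroupType)
    (A : banachAlgType K) (alpha : action S A)
    (mu : S -> set_system A) (one : S -> bidual A) :=
  forall t, approx_unit (dom alpha t) (mu t) /\ bidual_cvg embed (mu t) (one t).

Lemma real_ultra_cvg (R : realType) (T : Type) (G : set_system T)
    (h : T -> R) (c : R) :
  UltraFilter G -> G [set x | `|h x| <= c] ->
  exists l : R, h x @[x --> G] --> l.
Proof.
move=> GU Gc.
have Gh : (h @ G) `[- c, c]%classic.
  apply: (@filterS _ G _ _ _ _ Gc) => x /=; by rewrite in_itv /= ler_norml.
have [l [_ hl]] := @segment_compact R (- c) c (h @ G) _ Gh.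
exists l => U Ul; have [//|GU'] := in_ultra_setVsetC (h @^-1` U) GU.
by have [y [nUy Uy]] := hl (~` U) U GU' Ul.
Qed.

Lemma scalar_ultra_cvg (R : realType) (K : numFieldType) (T : Type)
    (G : set_system T) (g : T -> K^o) (c : K) :
  real_or_complex R K -> UltraFilter G -> G [set x | `|g x| <= c] ->
  exists2 l : K^o, g x @[x --> G] --> l & `|l| <= c.
Proof.
move=> hK GU Gc.
suff [l gl] : exists l : K^o, g x @[x --> G] --> l.
  exists l => //.
  have cR : c \is Num.real.
    have [x /= xc] := filter_ex Gc; by rewrite realE (le_trans _ xc).
  rewrite real_leNgt // ; apply/negP => cl.
  have e0 : 0 < `|l| - c by rewrite subr_gt0.
  move/cvgrPdist_lt : gl => /(_ _ e0) gl.
  have [x /= [xl xc]] := filter_ex (filterI gl Gc).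
  have := ler_normD (l - g x) (g x); rewrite subrK => ll.
  have : `|l| < `|l| - c + c.
    by rewrite (le_lt_trans ll) // ltr_leD.
  by rewrite subrK ltxx.
case: hK g c Gc => g c Gc; first exact: (real_ultra_cvg GU Gc).
have Gre : G [set x | `|complex.Re (g x)| <= complex.Re c].
  apply: filterS Gc => x /= /(le_trans (normc_ge_Re _)).
  by rewrite lecE => /andP[].
have Gim : G [set x | `|complex.Im (g x)| <= complex.Re c].
  apply: filterS Gc => x /=; rewrite normc_def lecE => /andP[_] /=.
  by apply: le_trans; rewrite -sqrtr_sqr ler_wsqrtr // lerDr sqr_ge0.
have [a ga] := real_ultra_cvg GU Gre.
have [b gb] := real_ultra_cvg GU Gim.
exists (Complex a b); apply/cvgrPdist_lt => e e0.
have [e1 e2] : complex.Im e = 0 /\ 0 < complex.Re e.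
  by move: e0; rewrite ltcE /= => /andP[/eqP].
have e3 : 0 < complex.Re e / 2 by rewrite divr_gt0.
move/cvgrPdist_lt : ga => /(_ _ e3); move/cvgrPdist_lt : gb => /(_ _ e3) Hb Ha.
apply: filterS2 Ha Hb => x ax bx.
case: (g x) ax bx => p q /= ap bq.
have -> : Complex a b - Complex p q = (a - p)%:C%C + 'i%C * (b - q)%:C%C.
  by apply/eqP; rewrite eq_complex /= !(mul0r,mul1r,mulr0,subr0,addr0,add0r) !eqxx.
apply: le_lt_trans (ler_normD _ _) _.
rewrite normrM.
have -> : `|'i%C : R[i]%C| = 1.
  by rewrite normc_def /= expr0n expr1n add0r sqrtr1.
rewrite mul1r; have nC (r : R) : `|r%:C%C| = `|r|%:C%C.
  by rewrite normc_def /= expr0n addr0 sqrtr_sqr.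
rewrite !nC -rmorphD ltcE /= e1 eqxx /=.
by rewrite [ltRHS](splitr (complex.Re e)) ltrD.
Qed.

Lemma unit_system_exists (R : realType) (K : numFieldType)
    (S : invSemigroupType) (A : banachAlgType K) (alpha : action S A) :
  real_or_complex R K -> exists mu one, unit_system alpha mu one.
Proof.
move=> hK.
suff /choice [f fP] : forall t, exists Fm : set_system A * bidual A,
    approx_unit (dom alpha t) Fm.1 /\ bidual_cvg embed Fm.1 Fm.2.
  by exists (fun t => (f t).1), (fun t => (f t).2).
move=> t; have [F [FF Fb Fau]] := dom_approx_unit alpha t.
have [G [GU FG]] := ultraFilterLemma FF.
have GF := @ultra_proper _ _ GU.
have lim_ex (f : dual A) : exists l : K^o, f x @[x --> G] --> l /\
    forall d, opnorm_le f d -> `|l| <= d.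
  have bd d : opnorm_le f d -> G [set x | `|f x| <= d].
    move=> [d0 fd]; apply: filterS (FG _ Fb) => x /= [_ x1].
    by rewrite (le_trans (fd x)) // ler_piMr.
  have /asboolP [_ [c fc]] := dualP f.
  have [l fl lc] := scalar_ultra_cvg hK GU (bd _ fc).
  exists l; split=> // d /bd fd.
  have [l' fl' l'd] := scalar_ultra_cvg hK GU fd.
  by rewrite (@cvg_unique _ (@norm_hausdorff _ _) (f @ G) _ l l' fl fl').
have [phi phiP] := choice lim_ex.
have phi_bidual : phi \in bidual_pred A.
  apply/asboolP; split.
    move=> k f g; have [fk _] := phiP (k *: f + g).
    have [ff _] := phiP f; have [gg _] := phiP g.
    apply: (@cvg_unique _ (@norm_hausdorff _ _) ((k *: f + g) @ G) _ _ _ fk).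
    by apply: cvgD => //; apply: cvgZr.
  exists 1; split=> // f d fd; rewrite mul1r; exact: (phiP f).2.
exists (G, Bidual phi_bidual); split=> /=; last by move=> f; exact: (phiP f).1.
split=> //; first exact: FG.
by move=> a /Fau [al ar]; split; [move: al|move: ar]; apply: cvg_trans => U;
  apply: FG.
Qed.

(** * Covariant representations and the crossed product *)

Section covariant.
Context {K : numFieldType} {S : invSemigroupType} {A : banachAlgType K}.
Variable alpha : action S A.

Definition covariant_rep (B : banachAlgType K) (pi : A -> B)
    (v : S -> bidual B) :=
  [/\ representation pi /\ (forall t, bidual_le (v t) 1),
      forall t a, dom alpha (star t) a ->
        v t ** embed (pi a) = embed (pi (act alpha t a)) ** v t /\
        exists b, v t ** embed (pi a) = embed b,
      forall s t a, dom alpha (s * t)%g a ->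
        embed (pi a) ** v s ** v t = embed (pi a) ** v (s * t)%g
    & forall e a, idem e -> dom alpha e a ->
        embed (pi a) ** v e = embed (pi a)].

(* pi(a) v_t as an element of B. *)
Definition cov_mul (B : banachAlgType K) (pi : A -> B) (v : S -> bidual B)
    (a : A) (t : S) : B :=
  embed_inv (embed (pi a) ** v t).

Definition cov_range (B : banachAlgType K) (pi : A -> B) (v : S -> bidual B) :
    set B :=
  closure (lspan [set cov_mul pi v p.1 p.2 | p in
                  [set p : A * S | dom alpha p.2 p.1]]).

(* Normalization is relative to a choice of approximate units as in
   unit_system; without one, v is not determined by the products pi(a) v_t. *)
Definition normalized (mu : S -> set_system A) (B : banachAlgType K)
    (pi : A -> B) (v : S -> bidual B) :=
  forall t, bidual_cvg (fun a => embed (pi a) ** v t) (mu t) (v t).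

Definition l1 (f : S -> A) :=
  (forall t, dom alpha t (f t)) /\
  exists M : K, forall J : {fset S},
    summability.partial_sum (fun t => `|f t|) J <= M.

Definition conv (f g : S -> A) (r : S) : A :=
  summability.sum (fun p : S * S =>
    if (p.1 * p.2)%g == r
    then act alpha p.1 (act alpha (star p.1) (f p.1) *b g p.2) else 0).

Definition integrated (B : banachAlgType K) (pi : A -> B) (v : S -> bidual B)
    (f : S -> A) : B :=
  summability.sum (fun t => cov_mul pi v (f t) t).

(* The set of which the seminorm |f|_max is the supremum. *)
Definition max_norms (f : S -> A) : set K :=
  [set r | exists (B : banachAlgType K) (pi : A -> B) (v : S -> bidual B),
     covariant_rep pi v /\ r = `|integrated pi v f|].

(* (D, q) is a Hausdorff completion of l^1(alpha) in the seminorm |.|_max; only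
   the values of q on l1 matter. *)
Definition is_crossed_product (D : banachAlgType K) (q : (S -> A) -> D) :=
  [/\ forall (k : K) f g, l1 f -> l1 g -> q (k *: f + g) = k *: q f + q g,
      forall f g, l1 f -> l1 g -> q (conv f g) = q f *b q g,
      forall f, l1 f -> supremums (max_norms f) `|q f|
    & closure (q @` l1) = setT].

Definition universal_cov (D : banachAlgType K) (iota : A -> D)
    (u : S -> bidual D) :=
  forall (B : banachAlgType K) (pi : A -> B) (v : S -> bidual B),
    covariant_rep pi v ->
    exists! Psi : D -> B,
      representation Psi /\
      forall a t, dom alpha t a -> Psi (cov_mul iota u a t) = cov_mul pi v a t.

End covariant.

Definition one_to_one (X Y : Type) (P : X -> Prop) (Q : Y -> Prop)
    (rel : X -> Y -> Prop) :=
  (forall x, P x -> exists! y, Q y /\ rel x y) /\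
  (forall y, Q y -> exists! x, P x /\ rel x y).

(** * Dual Banach algebras *)

Section dual_banach_algebra.
Context {K : numFieldType} {B : banachAlgType K} {P : completeNormedModType K}.
Variable j : B -> dual P.

(* Convergence in the P-weak topology of B, when j identifies B with the dual
   of P. *)
Definition predual_cvg (T : Type) (phi : T -> B) (F : set_system T) (b : B) :=
  forall p : P, (j (phi x) p : K^o) @[x --> F] --> (j b p : K^o).

Definition dual_banach_algebra :=
  [/\ linear j, bijective j, forall b c, opnorm_le (j b) c <-> `|b| <= c
    & forall (F : set_system B) (b c : B), ProperFilter F ->
        predual_cvg id F b ->
        predual_cvg (bmul^~ c) F (b *b c) /\ predual_cvg (bmul c) F (c *b b)].

(* The value at m of the extension of pi from I to multiplier I: the P-weak
   limit of pi (m mu_i) for any approximate unit (mu_i) of I. *)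
Definition multiplier_ext (A : banachAlgType K) (I : set A) (pi : A -> B)
    (m : bidual A) : B :=
  xget 0 [set b | forall F, approx_unit I F ->
                    predual_cvg (fun a => pi (embed_inv (m ** embed a))) F b].

Definition dual_normalized (S : invSemigroupType) (A : banachAlgType K)
    (mu : S -> set_system A) (pi : A -> B) (v : S -> B) :=
  forall t, predual_cvg (fun a => pi a *b v t) (mu t) (v t).

Definition dual_cov_description (S : invSemigroupType) (A : banachAlgType K)
    (alpha : action S A) (one : S -> bidual A) (pi : A -> B) (v : S -> B) :=
  [/\ representation pi,
      (forall t, `|v t| <= 1) /\ (forall s t, v (s * t)%g = v s *b v t),
      forall t a, dom alpha (star t) a ->
        v t *b pi a *b v (star t) = pi (act alpha t a)
    & forall e, idem e -> v e = multiplier_ext (dom alpha e) pi (one e)].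

End dual_banach_algebra.

(** * Representations on Banach spaces *)

Section space.
Context {K : numFieldType} {A : banachAlgType K} {E : completeNormedModType K}.

(* A representation of A in the Banach algebra of bounded operators on E. *)
Definition representation_on (pi : A -> E -> E) :=
  [/\ forall a, linear (pi a),
      forall (k : K) a b, pi (k *: a + b) = k *: pi a + pi b,
      forall a b, pi (a *b b) = pi a \o pi b
    & forall a, opnorm_le (pi a) `|a|].

Definition covariant_rep_on (S : invSemigroupType) (alpha : action S A)
    (pi : A -> E -> E) (v : S -> E -> E) :=
  [/\ representation_on pi,
      forall t, linear (v t) /\ opnorm_le (v t) 1,
      forall s t, v (s * t)%g = v s \o v t,
      forall t a, dom alpha (star t) a ->
        v t \o pi a = pi (act alpha t a) \o v t
    & forall t, range (v t) =
        closure (lspan [set pi p.1 p.2 | p in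
                        [set p : A * E | dom alpha t p.1]])].

End space.

(* Main.v *)
From HB Require Import structures.
From mathcomp Require Import all_boot all_order all_algebra.
From mathcomp Require Import finmap.
From mathcomp Require Import all_classical all_reals topology normedtype.
From mathcomp Require Import complex.
From mathcomp.analysis.showcase Require summability.
Require Import Defs.

Set Implicit Arguments.
Unset Strict Implicit.
Unset Printing Implicit Defensive.

Import Order.TTheory GRing.Theory Num.Theory.
Import numFieldNormedType.Exports.

Local Open Scope classical_set_scope.
Local Open Scope ring_scope.

(** The crossed product is the completion of l^1(alpha), so everything reduces to
    its generators: the classes [gen a t] of the functions with the single value
    a, in I_t, at t. They are linear in a, they multiply by
    gen a s * gen b t = gen (alpha_s (alpha_(star s) (a) b)) (st), they span a
    dense subspace, and a covariant representation (pi, v) sends [gen a t] to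
    pi(a) v_t. Since the norm of the crossed product is a supremum over all
    covariant representations, each of these extends to it by continuity
    ([crossed_product_rep]).

    Existence ([crossed_product_exists]) is shown inside a product of Banach
    algebras: one covariant representation is chosen for every number that occurs
    in one of the suprema, and the closure of the image of l^1(alpha) in the
    l^infinity-product is the crossed product. That the integrated form is
    multiplicative is an interchange of absolutely convergent sums over S
    ([integrated_conv]).

    The map iota sends a sum of elements a_e of the ideals I_e to the sum of the
    [gen a_e e]; it is contractive since the v_e act as units ([iota_exists]). The
    element u_t of the bidual takes a functional f to the limit of f (gen m t)
    along the chosen approximate unit of I_t. This limit exists because
    a |-> f (gen a t) extends from I_t to A by the Hahn-Banach theorem and the
    approximate unit converges weak-* in the bidual of A
    ([limit_multiplier_exists]). Covariance of (iota, u) comes from three limits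
    of products of generators in which the approximate unit is absorbed
    ([gen_iota_cvg], [iota_gen_cvg], [gen_gen_cvg]). Uniqueness of the crossed
    product is formal, and a representation Psi of it corresponds to the pair of
    Psi o iota and the image of u under the second transpose of Psi, which is
    multiplicative for the Arens products ([normalized_correspondence]).

    In a dual Banach algebra bounded nets have weak-* limit points, and two limits
    of approximate units of one ideal agree because each acts as a unit on the
    other ([approx_unit_limit_unique]). Hence the unit for I_st is well defined;
    it fixes v_s v_t, which is a weak-* limit of elements of pi(I_st) B, and maps
    it to v_st, so that v is multiplicative ([normalized_hom]).

    On a reflexive space E the same limits exist in the weak topology, vector by
    vector ([weak_limit_exists]). They are operators v_t with range in the closed
    span of pi(I_t) E, since closed subspaces are weakly closed, and on that space
    vectors are separated by pi(I_t) ([essential_separated]), which gives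
    v_st = v_s v_t. The converse integrates (pi, v) in the Banach algebra of
    bounded operators on E ([operator_algebra_exists]). *)

(** * Scalars *)

(** The order is partial over the complex numbers, so only sets of real elements
    have suprema. *)
Definition real_lubs (K : numFieldType) := forall X : set K, X !=set0 ->
  (forall x, X x -> x \is Num.real) -> ubound X !=set0 ->
  exists s, supremums X s.

Lemma real_or_complex_lubs (R : realType) (K : numFieldType) :
  real_or_complex R K -> real_lubs K.
Proof.
case=> X [x0 Xx0] Xreal [M XM].
  exists (sup X); split; first by move=> x Xx; apply: ub_le_sup => //; exists M.
  by move=> m Xm; apply: ge_sup => //; exists x0.
have imX x y : X x -> x <= y -> complex.Im y = 0.
  move=> /Xreal; rewrite realE !lecE /= => xr /andP[/eqP-> _].
  by case/orP: xr => /andP[/eqP].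
have Re0 : [set complex.Re x | x in X] !=set0 by exists (complex.Re x0), x0.
have Re_ub m : ubound X m -> ubound [set complex.Re x | x in X] (complex.Re m).
  by move=> Xm _ [x /Xm + <-]; rewrite lecE => /andP[].
exists ((sup [set complex.Re x | x in X])%:C)%C; split.
  move=> x Xx; rewrite lecE /= (imX x x) // eqxx /=.
  by apply: ub_le_sup; [exists (complex.Re M); exact: Re_ub|exists x].
move=> m Xm; rewrite lecE /= (imX x0 m) ?eqxx //=; last exact: Xm.
by apply: ge_sup => //; exact: Re_ub.
Qed.

(** The element [i] is a square root of -1 over the complex numbers and 0 over
    the real numbers; this lets both cases share one proof. *)
Lemma real_or_complex_Re (R : realType) (K : numFieldType) :
  real_or_complex R K -> exists (i : K) (re : K -> K),
    [/\ i = 0 \/ i * i = -1,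
        {morph re : x y / x + y},
        forall k z, k \is Num.real -> re (k * z) = k * re z,
        forall z, re z \is Num.real /\ re z <= `|z|
      & forall z, z = re z - i * re (i * z)].
Proof.
case.
  exists 0, id; split=> //; first by left.
    by move=> z; rewrite num_real ler_norm.
  by move=> z; rewrite !mul0r subr0.
exists 'i%C, (fun z => (complex.Re z)%:C%C); split.
- by right; rewrite -expr2 sqr_i.
- by move=> [a b] [c d]; apply/eqP; rewrite eq_complex /= addr0 !eqxx.
- move=> [a b] [c d]; rewrite realE !lecE /= => kr.
  have -> : b = 0 by case/orP: kr => /andP[/eqP].
  by apply/eqP; rewrite eq_complex /= !mul0r !mulr0 subr0 addr0 !eqxx.
- move=> z; split.
    by rewrite realE !lecE /= eqxx /=; exact: num_real.
  rewrite normc_def lecE /= eqxx /=; case: z => a b /=.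
  rewrite (le_trans (ler_norm a)) // -sqrtr_sqr ler_wsqrtr //.
  by rewrite lerDl sqr_ge0.
- move=> [a b]; apply/eqP; rewrite eq_complex /= !mul0r !mulr0 !mul1r.
  by rewrite !(subr0, sub0r, add0r) opprK !eqxx.
Qed.

(** * The Hahn-Banach theorem *)

Section hahn_banach.
Context {K : numFieldType} (V : normedModType K) (c : K).

(** The graph of a real-valued functional, linear over the real scalars and
    dominated by c times the norm; domination makes it single-valued. *)
Definition real_graph (G : set (V * K)) :=
  [/\ G (0, 0),
      forall k x y a b, k \is Num.real -> G (x, a) -> G (y, b) ->
        G (k *: x + y, k * a + b)
    & forall x a, G (x, a) -> a \is Num.real /\ a <= c * `|x|].

Lemma real_graph_fun G x a b :
  real_graph G -> G (x, a) -> G (x, b) -> a = b.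
Proof.
move=> [G0 Glin Gdom].
suff le a' b' : G (x, a') -> G (x, b') -> a' <= b'.
  by move=> xa xb; apply/eqP; rewrite eq_le !le.
move=> xa xb; have := Glin (-1) _ _ _ _ _ xb xa.
rewrite realN real1 => /(_ isT) /Gdom[_].
by rewrite scaleN1r addNr normr0 mulr0 mulN1r addrC subr_le0.
Qed.

(** The value t at x0 must be at least every a - c|x - x0| and at most every
    c|y + x0| - b; the triangle inequality leaves room for it. By scaling, these
    two bounds dominate the functional at every x + k x0. *)
Lemma real_graph_step G x0 : 0 <= c -> real_lubs K -> real_graph G ->
  exists t, real_graph [set p | exists k x a, [/\ k \is Num.real, G (x, a)
    & p = (x + k *: x0, a + k * t)]].
Proof.
move=> c0 lubs [G0 Glin Gdom].
pose X := [set s : K | exists x a, G (x, a) /\ s = a - c * `|x - x0|].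
have creal : c \is Num.real by rewrite realE c0.
have cn z : c * `|z : V| \is Num.real by rewrite realM ?normr_real.
have X0 : X !=set0 by exists (0 - c * `|0 - x0|), 0, 0.
have Xreal s : X s -> s \is Num.real.
  by move=> [x [a [/Gdom[ar _] ->]]]; rewrite realB.
have Xub y b : G (y, b) -> ubound X (c * `|y + x0| - b).
  move=> Gy s [x [a [Gx ->]]].
  have := Glin 1 _ _ _ _ (real1 _) Gx Gy; rewrite scale1r mul1r => /Gdom[_ ab].
  rewrite lerBlDr addrAC lerBrDr (le_trans ab) // -mulrDr ler_wpM2l //.
  have -> : x + y = (x - x0) + (y + x0) by rewrite addrACA addNr addr0.
  by rewrite (le_trans (ler_normD _ _)) // addrC.
have [] := lubs X X0 Xreal; first by exists (c * `|0 + x0| - 0); exact: Xub.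
move=> t [tub tlub].
have treal : t \is Num.real.
  have [s Xs] := X0; have st := tub _ Xs.
  rewrite -(subrK s t); apply: realD; last exact: Xreal.
  by rewrite ger0_real // subr_ge0.
have tl x a : G (x, a) -> a - t <= c * `|x - x0|.
  move=> Gx; rewrite lerBlDr -lerBlDl; apply: tub; by exists x, a.
have tr x a : G (x, a) -> a + t <= c * `|x + x0|.
  by move=> Gx; rewrite -lerBrDl; apply: tlub; exact: Xub.
exists t; split.
- by exists 0, 0, 0; rewrite real0 scale0r mul0r !addr0.
- move=> k x y a b kr [l [x' [a' [lr Gx [-> ->]]]]] [m [y' [b' [mr Gy [-> ->]]]]].
  exists (k * l + m), (k *: x' + y'), (k * a' + b'); split.
  + by rewrite realD ?realM.
  + exact: Glin.
  + congr (_, _).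
      by rewrite scalerDr scalerDl scalerA addrACA.
    by rewrite mulrDr mulrDl mulrA addrACA.
move=> x a [k [x' [a' [kr Gx [-> ->]]]]]; have [a'r a'c] := Gdom _ _ Gx.
split; first by rewrite realD ?realM.
have scaled (l : K) : 0 < l -> G (l^-1 *: x', l^-1 * a').
  move=> l0; have lr : l^-1 \is Num.real by rewrite realV realE ltW.
  by have := Glin _ _ _ _ _ lr Gx G0; rewrite !addr0.
have cZ (l : K) (z : V) : 0 < l -> l * (c * `|z|) = c * `|l *: z|.
  by move=> l0; rewrite normrZ gtr0_norm // mulrCA.
have [k0|k0|k0] := real_ltgtP kr (real0 K).
- have l0 : 0 < - k by rewrite oppr_gt0.
  have := tl _ _ (scaled _ l0); rewrite -(ler_pM2l l0) mulrBr mulVKf ?gt_eqF //.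
  rewrite mulNr opprK cZ // scalerBr.
  by rewrite scalerA divff ?gt_eqF // scale1r scaleNr opprK.
- have := tr _ _ (scaled _ k0); rewrite -(ler_pM2l k0) mulrDr mulVKf ?gt_eqF //.
  by rewrite cZ // scalerDr scalerA divff ?gt_eqF // scale1r.
- by rewrite k0 scale0r mul0r !addr0.
Qed.

Lemma real_hahn_banach G : 0 <= c -> real_lubs K -> real_graph G ->
  exists h : V -> K, [/\ forall x a, G (x, a) -> h x = a,
    forall k x y, k \is Num.real -> h (k *: x + y) = k * h x + h y
  & forall x, h x \is Num.real /\ h x <= c * `|x|].
Proof.
move=> c0 lubs Greal.
(* Maximising the part H beyond G lets the empty chain be bounded too. *)
have [|H [Hreal Hmax]] := @Zorn_bigcup _ [set H | real_graph (G `|` H)].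
  move=> F FP Ftot.
  have [->|/set0P[X0 FX0]] := eqVneq F set0.
    by rewrite /= bigcup_set0 setU0.
  have le2 p r : (G `|` \bigcup_(X in F) X) p -> (G `|` \bigcup_(X in F) X) r ->
      exists2 X, F X & (G `|` X) p /\ (G `|` X) r.
    move=> [Gp|[X FX Xp]] [Gr|[Y FY Yr]].
    - by exists X0 => //; split; left.
    - by exists Y => //; split; [left|right].
    - by exists X => //; split; [right|left].
    - have [XY|YX] := Ftot _ _ FX FY.
        by exists Y => //; split; right=> //; exact: XY.
      by exists X => //; split; right=> //; exact: YX.
  have sub X : F X -> G `|` X `<=` G `|` \bigcup_(X in F) X.
    by move=> FX; apply: setUS => p Xp; exists X.
  split; first by left; case: Greal.
    move=> k x y a b kr /le2 xa /xa [X FX [Xx Xy]].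
    by apply: (sub _ FX); have [_ + _] := FP _ FX; apply.
  move=> x a xa; have [X FX [Xx _]] := le2 _ _ xa xa.
  by have [_ _] := FP _ FX; apply.
have dom x : exists a, (G `|` H) (x, a).
  have [t G1] := real_graph_step x c0 lubs Hreal.
  set G' := [set p | _] in G1.
  have GG' : G `|` H `<=` G'.
    by move=> [y b] yb; exists 0, y, b; rewrite real0 scale0r mul0r !addr0.
  have xG' : G' (x, t).
    by exists 1, 0, 0; rewrite real1 scale1r mul1r !add0r; have [] := Hreal.
  apply: contrapT => nx; apply: (Hmax G').
    split; first by move=> p Hp; apply: GG'; right.
    by move=> G'H; apply: nx; exists t; right; exact: G'H.
  by rewrite /= (setUidr _) // => p Gp; apply: GG'; left.
have [h hP] := choice dom; exists h; split.
- by move=> x a xa; apply: (real_graph_fun Hreal (hP x)); left.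
- move=> k x y kr; apply: (real_graph_fun Hreal (hP _)).
  by have [_ + _] := Hreal; apply.
- by move=> x; have [_ _] := Hreal; apply.
Qed.

End hahn_banach.

(** The real part of g extends to a real-linear h with the same bound, and
    f x = h x - i h (i x) extends g. Multiplying x by a scalar of modulus 1 that
    makes f x positive carries the bound from h over to f. *)
Theorem hahn_banach (R : realType) (K : numFieldType) (V : normedModType K)
    (W : set V) (g : V -> K) (c : K) : real_or_complex R K -> 0 <= c ->
    subspace W ->
    (forall k x y, W x -> W y -> g (k *: x + y) = k * g x + g y) ->
    (forall x, W x -> `|g x| <= c * `|x|) ->
  exists f : dual V, (forall x, W x -> f x = g x) /\ opnorm_le f c.
Proof.
move=> hK c0 [W0 Wlin] glin gc.
have [i [re [i2 reD reZ rereal reE]]] := real_or_complex_Re hK.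
have re0 : re 0 = 0 by rewrite -[X in re X](mul0r 0) reZ ?mul0r ?real0.
have g0 : g 0 = 0.
  by have := glin (-1) _ _ W0 W0; rewrite scaler0 addr0 mulN1r addNr.
have gZ k x : W x -> g (k *: x) = k * g x.
  by move=> Wx; rewrite -[_ *: x]addr0 glin // g0 addr0.
have [|h [hG hlin hc]] := @real_hahn_banach K V c
    [set p | W p.1 /\ p.2 = re (g p.1)] c0 (real_or_complex_lubs hK).
  split=> /=; first by rewrite g0 re0.
    move=> k x y a b kr [Wx ->] [Wy ->]; split; first exact: Wlin.
    by rewrite glin // reD reZ.
  move=> x a [Wx ->]; have [rr rle] := rereal (g x); split=> //.
  exact: le_trans rle (gc _ Wx).
have h0 : h 0 = 0.
  by have := hlin (-1) 0 0 _; rewrite realN real1 => /(_ isT);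
    rewrite scaler0 addr0 mulN1r addNr.
have hD x y : h (x + y) = h x + h y.
  by have := hlin 1 x y (real1 _); rewrite scale1r mul1r.
have hZ k x : k \is Num.real -> h (k *: x) = k * h x.
  by move=> kr; have := hlin k x 0 kr; rewrite !addr0 h0 addr0.
pose f x := h x - i * h (i *: x).
have fD x y : f (x + y) = f x + f y.
  by rewrite /f scalerDr !hD mulrDr opprD addrACA.
have fZr k x : k \is Num.real -> f (k *: x) = k * f x.
  by move=> kr; rewrite /f hZ // scalerA [i * k]mulrC -scalerA hZ // mulrBr mulrCA.
have fZi x : f (i *: x) = i * f x.
  rewrite /f; case: i2 => [->|ii]; first by rewrite scale0r h0 !mul0r subr0.
  rewrite scalerA ii mulrBr mulrA ii !mulN1r opprK addrC; congr (_ + _).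
  by rewrite scaleN1r -scaleN1r hZ ?realN ?real1 // mulN1r mulrN opprK.
have fZ k x : f (k *: x) = k * f x.
  have [ar _] := rereal k; have [br _] := rereal (i * k).
  have -> : k *: x = re k *: x + (- re (i * k)) *: (i *: x).
    by rewrite {1}(reE k) scalerBl scalerA mulNr scaleNr [i * re _]mulrC.
  rewrite fD (fZr _ _ ar) (fZr (- _)) ?realN // fZi [in RHS](reE k).
  by rewrite mulrBl mulNr mulrCA mulrA.
have fc x : `|f x| <= c * `|x|.
  have [->|fx0] := eqVneq (f x) 0; first by rewrite normr0 mulr_ge0.
  pose k := `|f x| / f x.
  have k1 : `|k| = 1 by rewrite normrM normfV normr_id divff ?normr_eq0.
  have fk : f (k *: x) = `|f x| by rewrite fZ mulfVK.
  suff -> : `|f x| = h (k *: x) by have [_] := hc (k *: x); rewrite normrZ k1 mul1r.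
  have [hkr _] := hc (k *: x); have [hkir _] := hc (i *: (k *: x)).
  have fk' : f (k *: x) \is Num.real by rewrite fk normr_real.
  case: i2 => [i0|ii]; first by rewrite -fk /f i0 mul0r subr0.
  (* The square of i h(ikx), which is real, is - h(ikx)^2, so both vanish. *)
  have ir : i * h (i *: (k *: x)) \is Num.real.
    by rewrite -[_ * _](subKr (h (k *: x))) realB.
  have : (i * h (i *: (k *: x))) * (i * h (i *: (k *: x))) = 0.
    apply/eqP; rewrite eq_le -!expr2 real_exprn_even_ge0 // andbT.
    by rewrite exprMn expr2 ii mulN1r oppr_le0 real_exprn_even_ge0.
  by move/eqP; rewrite mulf_eq0 orbb -fk /f => /eqP->; rewrite subr0.
have fdual : (f : V -> K^o) \in dual_pred V.
  apply/asboolP; split; last by exists c.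
  by move=> k x y; rewrite fD fZ.
exists (Dual fdual); split=> //= x Wx; rewrite /f.
have hg y : W y -> h y = re (g y) by move=> Wy; exact: hG.
rewrite !hg //; first by rewrite gZ // -reE.
by rewrite -[_ *: x]addr0; exact: Wlin.
Qed.

(** * Banach algebras of bounded sections *)

Section bounded_sections.
Context {K : numFieldType} (I : Type) (V : I -> completeNormedModType K).

Definition section_bound (w : I -> K) (x : forall i, V i) (c : K) :=
  0 <= c /\ forall i, `|x i| <= c * w i.

(** Weighted-bounded sections of a family of Banach spaces, closed for uniform
    convergence and carrying a submultiplicative product. With the weight 1
    these are closed subalgebras of l^infinity-products of Banach algebras; over
    the points x of one space E, with the weight |x|, bounded operators on E
    arise as the sections that are linear in x. *)
Record section_algebra := SectionAlgebra {
  sa_weight : I -> K;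
  sa_mem : set (forall i, V i);
  sa_mul : (forall i, V i) -> (forall i, V i) -> forall i, V i;
  sa_lubs : real_lubs K;
  sa_weight_ge0 : forall i, 0 <= sa_weight i;
  sa_mem0 : sa_mem (fun=> 0);
  sa_memP : forall k x y, sa_mem x -> sa_mem y ->
    sa_mem (fun i => k *: x i + y i);
  sa_bounded : forall x, sa_mem x -> exists c, section_bound sa_weight x c;
  sa_closed : forall x, (forall e, 0 < e -> exists2 y, sa_mem y &
    section_bound sa_weight (fun i => x i - y i) e) -> sa_mem x;
  sa_memM : forall x y, sa_mem x -> sa_mem y -> sa_mem (sa_mul x y);
  sa_mulA : forall x y z, sa_mem x -> sa_mem y -> sa_mem z ->
    sa_mul x (sa_mul y z) = sa_mul (sa_mul x y) z;
  sa_mulPl : forall k x y z, sa_mem x -> sa_mem y -> sa_mem z ->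
    sa_mul (fun i => k *: x i + y i) z =
    (fun i => k *: sa_mul x z i + sa_mul y z i);
  sa_mulPr : forall k x y z, sa_mem x -> sa_mem y -> sa_mem z ->
    sa_mul z (fun i => k *: x i + y i) =
    (fun i => k *: sa_mul z x i + sa_mul z y i);
  sa_mul_bound : forall x y c d, sa_mem x -> sa_mem y ->
    section_bound sa_weight x c -> section_bound sa_weight y d ->
    section_bound sa_weight (sa_mul x y) (c * d)
}.

Variable d : section_algebra.

Record bsection := BSection { bval :> forall i, V i; bvalP : sa_mem d bval }.

Lemma bsectionP (x y : bsection) : (forall i, x i = y i) -> x = y.
Proof.
case: x y => [x Mx] [y My] /= xy.
have E : x = y by exact: functional_extensionality_dep.
by rewrite -E in My *; rewrite (Prop_irrelevance Mx My).
Qed.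

HB.instance Definition _ := gen_eqMixin bsection.
HB.instance Definition _ := gen_choiceMixin bsection.

Lemma bsection_linP (k : K) (x y : bsection) :
  sa_mem d (fun i => k *: x i + y i).
Proof. by apply: sa_memP; exact: bvalP. Qed.

Let lin k x y := BSection (bsection_linP k x y).
Let zero := BSection (sa_mem0 d).
Let add := lin 1.
Let opp x := lin (-1) x zero.
Let scale k x := lin k x zero.

Let addA : associative add.
Proof. by move=> x y z; apply: bsectionP => i /=; rewrite !scale1r addrA. Qed.
Let addC : commutative add.
Proof. by move=> x y; apply: bsectionP => i /=; rewrite !scale1r addrC. Qed.
Let add0 : left_id zero add.
Proof. by move=> x; apply: bsectionP => i /=; rewrite scale1r add0r. Qed.
Let addN : left_inverse zero opp add.
Proof.
by move=> x; apply: bsectionP => i /=; rewrite scale1r scaleN1r addr0 addNr.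
Qed.

HB.instance Definition _ := GRing.isZmodule.Build bsection addA addC add0 addN.

Let scaleA (a b : K) x : scale a (scale b x) = scale (a * b) x.
Proof. by apply: bsectionP => i /=; rewrite !addr0 scalerA. Qed.
Let scale1 : left_id 1 scale.
Proof. by move=> x; apply: bsectionP => i /=; rewrite addr0 scale1r. Qed.
Let scaleDr : right_distributive scale +%R.
Proof.
by move=> k x y; apply: bsectionP => i /=; rewrite !scale1r !addr0 scalerDr.
Qed.
Let scaleDl (x : bsection) : {morph scale^~ x : a b / a + b}.
Proof.
by move=> a b; apply: bsectionP => i /=; rewrite !scale1r !addr0 scalerDl.
Qed.

HB.instance Definition _ :=
  GRing.Zmodule_isLmodule.Build K bsection scaleA scale1 scaleDr scaleDl.

Lemma bsectionD (x y : bsection) i : (x + y) i = x i + y i.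
Proof. by rewrite /= scale1r. Qed.
Lemma bsectionZ k (x : bsection) i : (k *: x) i = k *: x i.
Proof. by rewrite /= addr0. Qed.
Lemma bsectionB (x y : bsection) i : (x - y) i = x i - y i.
Proof. by rewrite bsectionD /= scaleN1r addr0. Qed.

(** The supremum of the lower bounds of all admissible constants is itself
    admissible. *)
Lemma bnorm_exists (x : bsection) : exists c, section_bound (sa_weight d) x c /\
  forall c', section_bound (sa_weight d) x c' -> c <= c'.
Proof.
pose X := [set r : K | r \is Num.real /\
  forall c, section_bound (sa_weight d) x c -> r <= c].
have [c0 xc0] := sa_bounded (bvalP x).
have X0 : X 0 by split; [exact: real0|move=> c []].
have lubs : real_lubs K := sa_lubs d.
have [|r []//||] := lubs X; [by exists 0|by exists c0 => r [_]; exact|].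
move=> s [sub slub]; exists s; split; last first.
  by move=> c xc; apply: slub => r [_]; exact.
split=> [|i]; first exact: sub.
have [w0|w0] := eqVneq (sa_weight d i) 0.
  by case: xc0 => _ /(_ i); rewrite w0 !mulr0.
have wp : 0 < sa_weight d i by rewrite lt0r w0 sa_weight_ge0.
rewrite -ler_pdivrMr //; apply: sub; split.
  by rewrite realM ?realV ?normr_real // realE ltW.
by move=> c [_ /(_ i)]; rewrite ler_pdivrMr.
Qed.

Definition bnorm (x : bsection) := projT1 (cid (bnorm_exists x)).

Lemma bnorm_bound (x : bsection) : section_bound (sa_weight d) x (bnorm x).
Proof. by rewrite /bnorm; case: cid => c /= []. Qed.

Lemma bnorm_le (x : bsection) c : section_bound (sa_weight d) x c -> bnorm x <= c.
Proof. by rewrite /bnorm; case: cid => s /= [_]; exact. Qed.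

Let bnormD (x y : bsection) : bnorm (x + y) <= bnorm x + bnorm y.
Proof.
have [x0 xb] := bnorm_bound x; have [y0 yb] := bnorm_bound y.
apply: bnorm_le; split=> [|i]; first exact: addr_ge0.
by rewrite bsectionD mulrDl (le_trans (ler_normD _ _)) ?lerD.
Qed.

Let bnormZ_le k (x : bsection) : bnorm (k *: x) <= `|k| * bnorm x.
Proof.
have [x0 xb] := bnorm_bound x.
apply: bnorm_le; split=> [|i]; first exact: mulr_ge0.
by rewrite bsectionZ normrZ -mulrA ler_wpM2l ?xb.
Qed.

Let bnormZ k (x : bsection) : bnorm (k *: x) = `|k| * bnorm x.
Proof.
have [->|k0] := eqVneq k 0.
  rewrite normr0 mul0r; apply/eqP; rewrite eq_le.
  have := bnormZ_le 0 x; rewrite normr0 mul0r => -> /=.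
  by have [] := bnorm_bound (0 *: x).
apply/eqP; rewrite eq_le bnormZ_le /= -ler_pdivlMl ?normr_gt0 // -normfV.
by rewrite -{1}[x](scalerK k0) bnormZ_le.
Qed.

Let bnorm0 (x : bsection) : bnorm x = 0 -> x = 0.
Proof.
move=> x0; apply: bsectionP => i; apply/eqP; rewrite -normr_le0.
by have [_ /(_ i)] := bnorm_bound x; rewrite x0 mul0r.
Qed.

HB.instance Definition _ :=
  Lmodule_isNormed.Build K bsection bnormD bnormZ bnorm0.

Lemma bsection_normP (x : bsection) c :
  `|x| <= c <-> section_bound (sa_weight d) x c.
Proof.
have [x0 xb] := bnorm_bound x.
split=> [xc|]; last exact: bnorm_le.
split=> [|i]; first exact: le_trans xc.
by rewrite (le_trans (xb i)) // ler_wpM2r // sa_weight_ge0.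
Qed.

(** The limit exists at every index, and the Cauchy condition, being uniform in
    the index, makes it a uniform limit of members. *)
Lemma bsection_cauchy_cvg (F : set_system bsection) :
  ProperFilter F -> cauchy F -> cvg F.
Proof.
move=> FF Fc; have ballF e : 0 < e -> exists x : bsection, F [set y | `|x - y| < e].
  move=> e0; have [x Fx] := (iffLR (cauchyP F)) Fc e e0.
  by exists x; move: Fx; rewrite -ball_normE.
have lim_ex i : exists l : V i, (fun x : bsection => x i) @ F --> l.
  suff : cvg ((fun x : bsection => x i) @ F).
    by exists (lim ((fun x : bsection => x i) @ F)).
  apply: cauchy_cvg; apply: cauchy_exP => e e0.
  have w1 : 0 < sa_weight d i + 1 by rewrite ltr_wpDl // sa_weight_ge0.
  have [x Fx] := ballF (e / (sa_weight d i + 1)) (divr_gt0 e0 w1).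
  exists (x i); change (F [set y : bsection | ball (x i) e (y i)]).
  apply: filterS Fx => y /= xy; rewrite -ball_normE /=.
  have [_ /(_ i)] := (iffLR (bsection_normP (x - y) _)) (lexx _).
  rewrite bsectionB => /le_lt_trans; apply.
  rewrite (@le_lt_trans _ _ (`|x - y| * (sa_weight d i + 1))) //.
    by rewrite ler_wpM2l // lerDl.
  by rewrite -ltr_pdivlMr.
pose l i := projT1 (cid (lim_ex i)).
have lP i : (fun x : bsection => x i) @ F --> l i by rewrite /l; case: cid.
have near_l e : 0 < e -> exists x : bsection,
    F [set y | `|x - y| < e] /\ section_bound (sa_weight d) (fun i => l i - x i) e.
  move=> e0; have [x Fx] := ballF e e0; exists x; split=> //.
  split=> [|i]; first exact: ltW.
  have cl : (fun y : bsection => y i - x i) @ F --> l i - x i.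
    by apply: cvgB; [exact: lP|exact: cvg_cst].
  have /cvg_norm cn := cl.
  have er : e * sa_weight d i \is Num.real.
    by rewrite realE mulr_ge0 ?sa_weight_ge0 // ltW.
  rewrite real_leNgt ?normr_real //; apply/negP => lt.
  have e'0 : 0 < `|l i - x i| - e * sa_weight d i by rewrite subr_gt0.
  move/cvgrPdist_lt : cl => /(_ _ e'0) cl.
  have [y [/= yl yx]] := filter_ex (filterI cl Fx).
  have [_ /(_ i)] := (iffLR (bsection_normP (x - y) _)) (ltW yx).
  rewrite bsectionB distrC => yxi.
  have := ler_normD (l i - x i - (y i - x i)) (y i - x i); rewrite subrK.
  by move/le_lt_trans => /(_ _ (ltr_leD yl yxi)); rewrite subrK ltxx.
have Ml : sa_mem d l.
  by apply: sa_closed => e /near_l[x [_ xe]]; exists x => //; exact: bvalP.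
apply/cvg_ex; exists (BSection Ml); apply/cvgrPdist_lt => e e0.
have e2 : 0 < e / 2 by rewrite divr_gt0.
have [x [Fx xl]] := near_l _ e2; apply: filterS Fx => y /= xy.
rewrite (splitr e) -(subrK x (BSection Ml)) -addrA.
rewrite (le_lt_trans (ler_normD _ _)) // ler_ltD //.
apply/bsection_normP; case: xl => e20 xl; split=> // i.
by rewrite bsectionB.
Qed.

HB.instance Definition _ :=
  Uniform_isComplete.Build bsection bsection_cauchy_cvg.

Definition bmulsec (x y : bsection) :=
  BSection (sa_memM (bvalP x) (bvalP y)).

Let bmulsecA : associative bmulsec.
Proof.
move=> x y z; apply: bsectionP => i /=; rewrite sa_mulA //; exact: bvalP.
Qed.
Let mul0sec x : sa_mem d x -> sa_mul d (fun=> 0) x = fun=> 0.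
Proof.
move=> Mx; have := sa_mulPl (-1) (sa_mem0 d) (sa_mem0 d) Mx.
rewrite (_ : (fun i => _) = fun=> 0); last first.
  by apply: functional_extensionality_dep => i; rewrite scaler0 addr0.
move=> ->; apply: functional_extensionality_dep => i.
by rewrite scaleN1r addNr.
Qed.
Let mulsec0 x : sa_mem d x -> sa_mul d x (fun=> 0) = fun=> 0.
Proof.
move=> Mx; have := sa_mulPr (-1) (sa_mem0 d) (sa_mem0 d) Mx.
rewrite (_ : (fun i => _) = fun=> 0); last first.
  by apply: functional_extensionality_dep => i; rewrite scaler0 addr0.
move=> ->; apply: functional_extensionality_dep => i.
by rewrite scaleN1r addNr.
Qed.
Let bmulsecDl : left_distributive bmulsec +%R.
Proof.
move=> x y z; apply: bsectionP => i.
by rewrite bsectionD /= sa_mulPl ?scale1r //; exact: bvalP.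
Qed.
Let bmulsecDr : right_distributive bmulsec +%R.
Proof.
move=> x y z; apply: bsectionP => i.
by rewrite bsectionD /= sa_mulPr ?scale1r //; exact: bvalP.
Qed.
Let bmulsecZl k x y : bmulsec (k *: x) y = k *: bmulsec x y.
Proof.
apply: bsectionP => i; rewrite bsectionZ /= sa_mulPl //.
- by rewrite mul0sec ?addr0 //; exact: bvalP.
- exact: bvalP.
- exact: sa_mem0.
- exact: bvalP.
Qed.
Let bmulsecZr k x y : bmulsec x (k *: y) = k *: bmulsec x y.
Proof.
apply: bsectionP => i; rewrite bsectionZ /= sa_mulPr //.
- by rewrite mulsec0 ?addr0 //; exact: bvalP.
- exact: bvalP.
- exact: sa_mem0.
- exact: bvalP.
Qed.
Let bmulsec_norm (x y : bsection) : `|bmulsec x y| <= `|x| * `|y|.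
Proof.
by apply/bsection_normP/sa_mul_bound; try exact: bvalP; exact/bsection_normP.
Qed.

HB.instance Definition _ := isBanachAlgebra.Build K bsection
  bmulsecA bmulsecDl bmulsecDr bmulsecZl bmulsecZr bmulsec_norm.

End bounded_sections.

(** * Unconditional sums in Banach spaces *)

#[local] Existing Instance summability.totally_filter.

Section sums.
Context {K : numFieldType}.
Implicit Types (T U : choiceType) (V : normedModType K).

(** Convergence along the net of the finite subsets of T. *)
Definition has_sum T V (x : T -> V) (s : V) := forall e : K, 0 < e ->
  exists J0 : {fset T}, forall J : {fset T}, (J0 `<=` J)%fset ->
    `|s - \sum_(t <- J) x t| <= e.

Definition abs_sum T V (x : T -> V) (M : K) :=
  forall J : {fset T}, \sum_(t <- J) `|x t| <= M.

Lemma partial_sumE T (V : zmodType) (x : T -> V) (J : {fset T}) :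
  summability.partial_sum x J = \sum_(t <- J) x t.
Proof. by rewrite /summability.partial_sum big_seq_fsetE. Qed.

Lemma half_lt (e : K) : 0 < e -> 0 < e / 2 /\ e / 2 < e.
Proof.
by move=> e0; rewrite divr_gt0 // ltr_pdivrMr // ltr_pMr // ltr1n.
Qed.

Lemma has_sum_cvg T V (x : T -> V) s : has_sum x s ->
  summability.partial_sum x @ summability.totally --> s.
Proof.
move=> xs; apply/cvgrPdist_lt => e e0; have [e2 e2e] := half_lt e0.
have [J0 J0P] := xs _ e2; exists J0 => // J J0J.
by rewrite partial_sumE (le_lt_trans (J0P _ J0J)).
Qed.

Lemma has_sumE T V (x : T -> V) s : has_sum x s -> summability.sum x = s.
Proof. by move/has_sum_cvg => xs; apply: cvg_lim => //; exact: norm_hausdorff. Qed.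

Lemma fset_sumD T (V : nmodType) (x : T -> V) (J0 J : {fset T}) :
  (J0 `<=` J)%fset ->
  \sum_(t <- J) x t = \sum_(t <- J0) x t + \sum_(t <- (J `\` J0)%fset) x t.
Proof.
move=> J0J; rewrite (big_fsetID _ [in J0]) /=; congr (_ + _).
  apply: eq_fbigl => t; rewrite !inE /=; apply/andP/idP => [[]//|tJ0].
  by rewrite (fsubsetP J0J).
by apply: eq_fbigl => t; rewrite !inE /= andbC.
Qed.

Lemma fset_sum_le T (x : T -> K) (J0 J : {fset T}) : (forall t, 0 <= x t) ->
  (J0 `<=` J)%fset -> \sum_(t <- J0) x t <= \sum_(t <- J) x t.
Proof. by move=> x0 /fset_sumD->; rewrite lerDl sumr_ge0. Qed.

(** A finite sum within e of the supremum of the finite sums leaves at most e to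
    all sums outside its range. *)
Lemma abs_sum_tail T V (x : T -> V) M e : real_lubs K -> abs_sum x M -> 0 < e ->
  exists J0 : {fset T}, forall J : {fset T}, [disjoint J0 & J]%fset ->
    \sum_(t <- J) `|x t| <= e.
Proof.
move=> lubs xM e0.
pose X := [set r : K | exists J : {fset T}, r = \sum_(t <- J) `|x t|].
have Xge0 r : X r -> 0 <= r by move=> [J ->]; exact: sumr_ge0.
have [|r /Xge0 r0||s [sub slub]] := lubs X; [by exists 0, fset0; rewrite big_nil|
  by rewrite ger0_real|by exists M => _ [J ->]; exact: xM|].
have [J0 /= sJ0] : exists J : {fset T}, s - e < \sum_(t <- J) `|x t|.
  apply: contrapT => nJ; suff : s <= s - e by rewrite lt_geF // ltrBlDr ltrDl.
  apply: slub => _ [J ->].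
  have s0 : 0 <= s by rewrite (le_trans _ (sub _ (ex_intro _ J erefl))) ?sumr_ge0.
  have sr : s - e \is Num.real by apply: realB; [exact: ger0_real|exact: gtr0_real].
  rewrite real_leNgt //; last by rewrite ger0_real // sumr_ge0.
  by apply/negP => lt; apply: nJ; exists J.
exists J0 => J dJ; have := sub _ (ex_intro _ (J0 `|` J)%fset erefl).
rewrite (fset_sumD _ (fsubsetUl J0 J)).
have -> : ((J0 `|` J) `\` J0 = J)%fset.
  apply/fsetP => t; rewrite !inE.
  by case: (boolP (t \in J0)) => //= /(fdisjointP dJ)/negbTE->.
rewrite -lerBrDl => /le_trans; apply.
by rewrite lerBlDr -lerBlDl ltW.
Qed.

Lemma has_sum_unique T V (x : T -> V) s s' :
  has_sum x s -> has_sum x s' -> s = s'.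
Proof. by move=> /has_sumE <- /has_sumE <-. Qed.

Lemma le_add_eps (a b : K) : a \is Num.real -> b \is Num.real ->
  (forall e, 0 < e -> a <= b + e) -> a <= b.
Proof.
move=> ar br ab; rewrite real_leNgt //; apply/negP => ba.
have d0 : 0 < a - b by rewrite subr_gt0.
have [d2 d2d] := half_lt d0.
by have := ab _ d2; rewrite -lerBlDl (lt_geF d2d).
Qed.

Lemma has_sum_norm T V (x : T -> V) s M : has_sum x s ->
  (forall J : {fset T}, `|\sum_(t <- J) x t| <= M) -> `|s| <= M.
Proof.
move=> xs xM; have M0 : 0 <= M by rewrite (le_trans _ (xM fset0)).
apply: le_add_eps => [||e e0]; rewrite ?normr_real ?ger0_real //.
have [J0 /(_ J0 (fsubset_refl _)) sJ] := xs _ e0.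
by rewrite -[s](subrK (\sum_(t <- J0) x t)) addrC (le_trans (ler_normD _ _)) ?lerD.
Qed.

Lemma has_sum_lin T V (x y : T -> V) k s r : has_sum x s -> has_sum y r ->
  has_sum (fun t => k *: x t + y t) (k *: s + r).
Proof.
move=> xs yr e e0; have [e2 _] := half_lt e0.
have k0 : 0 < `|k| + 1 by rewrite ltr_wpDl.
have [J1 J1P] := xs _ (divr_gt0 e2 k0); have [J2 J2P] := yr _ e2.
exists (J1 `|` J2)%fset => J; rewrite fsubUset => /andP[/J1P xJ /J2P yJ].
rewrite big_split /= -scaler_sumr opprD addrACA -scalerBr (splitr e).
rewrite (le_trans (ler_normD _ _)) // lerD // normrZ.
rewrite (le_trans (ler_wpM2l (normr_ge0 _) xJ)) // mulrCA ler_piMr ?ltW //.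
by rewrite ltr_pdivrMr // mul1r ltrDl.
Qed.

Lemma has_sum0 T V : has_sum (fun _ : T => 0 : V) 0.
Proof. by move=> e e0; exists fset0 => J _; rewrite big1 // subrr normr0 ltW. Qed.

Lemma has_sum_sum T V (I : Type) (r : seq I) (x : I -> T -> V) (s : I -> V) :
  (forall i, has_sum (x i) (s i)) ->
  has_sum (fun t => \sum_(i <- r) x i t) (\sum_(i <- r) s i).
Proof.
move=> xs; elim: r => [|i r IH].
  rewrite big_nil.
  under [fun t => _]functional_extensionality_dep => t do rewrite big_nil.
  exact: has_sum0.
rewrite big_cons -[s i]scale1r.
under [fun t => _]functional_extensionality_dep => t
  do rewrite big_cons -[x i t]scale1r.
exact: has_sum_lin.
Qed.

Lemma has_sum_fin T V (x : T -> V) (J : {fset T}) :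
  (forall t, t \notin J -> x t = 0) -> has_sum x (\sum_(t <- J) x t).
Proof.
move=> xJ e e0; exists J => J' JJ'; rewrite (fset_sumD _ JJ') opprD addrA.
rewrite subrr sub0r normrN big_seq big1 ?normr0 ?ltW // => t.
by rewrite inE => /andP[/xJ].
Qed.

Lemma has_sum_single T V (x : T -> V) t :
  (forall s, s != t -> x s = 0) -> has_sum x (x t).
Proof.
move=> xt; rewrite -(big_seq_fset1 +%R t x); apply: has_sum_fin => s.
by rewrite inE => /xt.
Qed.

Lemma has_sum_fset_sub T V (W : set V) (x : T -> V) (J : {fset T}) :
  subspace W -> (forall t, W (x t)) -> W (\sum_(t <- J) x t).
Proof.
move=> [W0 WP] xW; apply: (big_ind W) => // a b Wa Wb.
by rewrite -[a]scale1r; apply: WP.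
Qed.

Lemma has_sum_closed T V (W : set V) (x : T -> V) s : closed W -> subspace W ->
  (forall t, W (x t)) -> has_sum x s -> W s.
Proof.
move=> Wc Ws xW /has_sum_cvg xs; apply: (closed_cvg _ Wc _ _ xs).
by exists fset0 => // J _; rewrite partial_sumE; exact: has_sum_fset_sub.
Qed.

(** Linearity is only asked on a closed subspace because the maps
    a |-> pi(a) v_t are linear on the ideal I_t only. *)
Lemma has_sum_map T V V' (W : set V) (f : V -> V') (c : K) (x : T -> V) s :
  closed W -> subspace W ->
  (forall k a b, W a -> W b -> f (k *: a + b) = k *: f a + f b) ->
  (forall a, W a -> `|f a| <= c * `|a|) ->
  (forall t, W (x t)) -> has_sum x s -> has_sum (f \o x) (f s).
Proof.
move=> Wc Ws flin fc xW xs.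
have sW := has_sum_closed Wc Ws xW xs.
have [W0 WP] := Ws.
have f0 : f 0 = 0.
  by have := flin (-1) _ _ W0 W0; rewrite scaler0 addr0 scaleN1r addNr.
have fJ (J : {fset T}) : f (\sum_(t <- J) x t) = \sum_(t <- J) f (x t).
  suff [] : W (\sum_(t <- J) x t) /\
    f (\sum_(t <- J) x t) = \sum_(t <- J) f (x t) by [].
  apply: (big_ind2 (fun a b => W a /\ f a = b)) => // a _ b _ [Wa <-] [Wb <-].
  have := WP 1 _ _ Wa Wb; have := flin 1 _ _ Wa Wb; rewrite !scale1r.
  by split.
move=> e e0; have c0 : 0 < `|c| + 1 by rewrite ltr_wpDl.
have [J0 J0P] := xs _ (divr_gt0 e0 c0).
exists J0 => J /J0P sJ /=; rewrite -fJ.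
have WJ := has_sum_fset_sub J Ws xW.
have -> : f s - f (\sum_(t <- J) x t) = f (s - \sum_(t <- J) x t).
  by rewrite addrC -scaleN1r -flin // scaleN1r addrC.
have WB : W (s - \sum_(t <- J) x t).
  by rewrite addrC -scaleN1r; exact: WP.
have cle : c * `|s - \sum_(t <- J) x t| <= (`|c| + 1) * `|s - \sum_(t <- J) x t|.
  have [->|n0] := eqVneq `|s - \sum_(t <- J) x t| 0; first by rewrite !mulr0.
  have np : 0 < `|s - \sum_(t <- J) x t| by rewrite lt0r n0 /=.
  rewrite ler_pM2r // (@le_trans _ _ `|c|) ?lerDl //.
  have : 0 <= c.
    by rewrite -(pmulr_lge0 _ np) (le_trans (normr_ge0 _) (fc _ WB)).
  by move=> /ger0_norm->.
rewrite (le_trans (fc _ WB)) // (le_trans cle) //.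
by rewrite mulrC -ler_pdivlMr.
Qed.

End sums.

Section complete_sums.
Context {K : numFieldType} (lubs : real_lubs K).
Implicit Types (T U : choiceType) (V : completeNormedModType K).

Lemma abs_sum_has_sum T V (x : T -> V) M : abs_sum x M ->
  exists s, has_sum x s.
Proof.
move=> xM.
have xcvg : cvg (summability.partial_sum x @ summability.totally).
  apply: cauchy_cvg; apply: cauchy_exP => e e0; have [e2 e2e] := half_lt e0.
  have [J0 J0P] := abs_sum_tail lubs xM e2.
  exists (\sum_(t <- J0) x t); exists J0 => // J J0J.
  rewrite -ball_normE /= partial_sumE (fset_sumD _ J0J) opprD addrA subrr sub0r.
  rewrite normrN (le_lt_trans (ler_norm_sum _ _ _)) //.
  rewrite (le_lt_trans (J0P _ _)) //.
  by apply/fdisjointP => t tJ0; rewrite inE tJ0.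
exists (lim (summability.partial_sum x @ summability.totally)) => e e0.
move/cvgrPdist_lt : xcvg => /(_ _ e0)[J0 _ J0P].
by exists J0 => J /J0P /=; rewrite partial_sumE => /ltW.
Qed.

Lemma abs_sumE T V (x : T -> V) M : abs_sum x M ->
  has_sum x (summability.sum x).
Proof. by move=> /abs_sum_has_sum[s xs]; rewrite (has_sumE xs). Qed.

Lemma abs_sum_norm T V (x : T -> V) M s : abs_sum x M -> has_sum x s ->
  `|s| <= M.
Proof.
move=> xM xs; apply: has_sum_norm xs _ => J.
exact: le_trans (ler_norm_sum _ _ _) (xM J).
Qed.

Lemma abs_sum_fiber T U V (pr : T -> U) (x : T -> V) M u : abs_sum x M ->
  abs_sum (fun t => if pr t == u then x t else 0) M.
Proof.
move=> xM J; apply: le_trans (xM J); apply: ler_sum => t _.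
by case: ifP => //; rewrite normr0.
Qed.

Lemma fset_sum_fiber T U (V : nmodType) (pr : T -> U) (x : T -> V)
    (U1 : {fset U}) t :
  \sum_(u <- U1) (if pr t == u then x t else 0) =
  if pr t \in U1 then x t else 0.
Proof.
case: ifPn => [tU|tU]; last first.
  rewrite big_seq big1 // => u uU; case: eqP => // tu.
  by move: tU; rewrite tu uU.
rewrite (bigD1_seq (pr t)) //= eqxx big1 ?addr0 // => u.
by rewrite eq_sym => /negbTE->.
Qed.

(** Summation by the fibres of a map: the tails outside a finite set J0 are
    small, so is the difference once all fibres that meet J0 are included. *)
Lemma has_sum_fiber T U V (pr : T -> U) (x : T -> V) M s : abs_sum x M ->
  has_sum x s ->
  let y u := summability.sum (fun t => if pr t == u then x t else 0) in
  has_sum y s /\ abs_sum y M.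
Proof.
move=> xM xs y.
have yP u : has_sum (fun t => if pr t == u then x t else 0) (y u).
  exact: abs_sumE (abs_sum_fiber _ _ xM).
split=> [e e0|U1].
  have [J0 J0P] := abs_sum_tail lubs xM e0.
  exists [fset pr t | t in J0]%fset => U1 J0U1.
  have := has_sum_lin (-1) (has_sum_sum U1 yP) xs.
  rewrite scaleN1r addrC => /has_sum_norm; apply=> J.
  rewrite (eq_bigr (fun t => if pr t \in U1 then 0 else x t)); last first.
    move=> t _; rewrite fset_sum_fiber scaleN1r.
    by case: ifP => _; rewrite ?addNr ?oppr0 ?add0r.
  rewrite (big_fsetID _ [pred t | pr t \in U1]) /= big_seq big1 ?add0r; last first.
    by move=> t; rewrite !inE /= => /andP[_ ->].
  rewrite (le_trans (ler_norm_sum _ _ _)) //.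
  rewrite (le_trans _ (J0P [fset t in J | ~~ (pr t \in U1)]%fset _)) //.
    by apply: ler_sum => t _; case: ifP => //; rewrite normr0.
  apply/fdisjointP => t tJ0; rewrite !inE /= negb_and negbK.
  by rewrite (fsubsetP J0U1) ?orbT //; apply/imfsetP; exists t.
have M0 : 0 <= M by rewrite (le_trans _ (xM fset0)) // big_nil.
apply: le_add_eps => [||e e0]; rewrite ?ger0_real ?sumr_ge0 //.
have n0 : 0 < (size U1).+1%:R :> K by rewrite ltr0Sn.
have e1 := divr_gt0 e0 n0.
(* One finite J that serves all u in U1 up to an equal share of e. *)
have [J JP] : exists J : {fset T}, forall u, u \in U1 ->
    `|y u - \sum_(t <- J) (if pr t == u then x t else 0)| <= e / (size U1).+1%:R.
  have [f fP] := choice (fun u => yP u _ e1).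
  exists (\bigcup_(u <- U1) f u)%fset => u uU; apply: fP.
  by apply: bigfcup_sup.
rewrite (@le_trans _ _ (\sum_(u <- U1)
    (\sum_(t <- J) (if pr t == u then `|x t| else 0) + e / (size U1).+1%:R))) //.
  rewrite big_seq [leRHS]big_seq; apply: ler_sum => u /JP yJ.
  rewrite -[y u](subrK (\sum_(t <- J) (if pr t == u then x t else 0))) addrC.
  rewrite (le_trans (ler_normD _ _)) // lerD //.
  rewrite (le_trans (ler_norm_sum _ _ _)) // ler_sum // => t _.
  by case: ifP => //; rewrite normr0.
rewrite big_split /= lerD //.
  rewrite exchange_big /= (le_trans _ (xM J)) // ler_sum // => t _.
  rewrite (fset_sum_fiber pr (fun t => `|x t|)).
  by case: ifP.
rewrite big_const_seq count_predT iter_addr_0.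
rewrite -(mulr_natr (_ / _)) mulrAC -mulrA ler_piMr ?ltW // ltr_pdivrMr //.
by rewrite mul1r ltr_nat.
Qed.

End complete_sums.

Section bilinear_sums.
Context {K : numFieldType} {B : banachAlgType K}.
Implicit Types a b : B.

Lemma bmul0l b : (0 : B) *b b = 0.
Proof. by apply: (@addrI _ (0 *b b)); rewrite -bmulDl !addr0. Qed.

Lemma bmul0r b : b *b (0 : B) = 0.
Proof. by apply: (@addrI _ (b *b 0)); rewrite -bmulDr !addr0. Qed.

Lemma bmulBl a b c : (a - b) *b c = a *b c - b *b c.
Proof. by rewrite -scaleN1r bmulDl bmulZl scaleN1r. Qed.

Lemma bmulBr a b c : c *b (a - b) = c *b a - c *b b.
Proof. by rewrite -scaleN1r bmulDr bmulZr scaleN1r. Qed.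

Lemma bmul_suml I (r : seq I) (x : I -> B) b :
  (\sum_(i <- r) x i) *b b = \sum_(i <- r) (x i *b b).
Proof.
by apply: (big_morph (fun a => a *b b)) => [a c|]; [exact: bmulDl|exact: bmul0l].
Qed.

Lemma bmul_sumr I (r : seq I) (x : I -> B) b :
  b *b (\sum_(i <- r) x i) = \sum_(i <- r) (b *b x i).
Proof.
by apply: (big_morph (fun a => b *b a)) => [a c|]; [exact: bmulDr|exact: bmul0r].
Qed.

Lemma fset_sumM (T U : choiceType) (V : nmodType) (F : T * U -> V)
    (J1 : {fset T}) (J2 : {fset U}) :
  \sum_(p <- (J1 `*` J2)%fset) F p = \sum_(t <- J1) \sum_(u <- J2) F (t, u).
Proof. by rewrite big_imfset2 // => [[? ?] [? ?]] _ _ /= [-> ->]. Qed.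

Lemma fsub_fsetM (T U : choiceType) (J : {fset T * U}) :
  (J `<=` [fset p.1 | p in J] `*` [fset p.2 | p in J])%fset.
Proof.
apply/fsubsetP => p pJ; rewrite in_fsetM.
by apply/andP; split; apply/imfsetP; exists p.
Qed.

Lemma abs_sum_prod (T U : choiceType) (V1 V2 V : normedModType K) (x : T -> V1)
    (y : U -> V2) (F : T * U -> V) M N : abs_sum x M -> abs_sum y N ->
    (forall p, `|F p| <= `|x p.1| * `|y p.2|) -> abs_sum F (M * N).
Proof.
move=> xM yN FP J.
set J1 := [fset p.1 | p in J]%fset; set J2 := [fset p.2 | p in J]%fset.
rewrite (@le_trans _ _ (\sum_(p <- J) `|x p.1| * `|y p.2|)) ?ler_sum //.
rewrite (@le_trans _ _ (\sum_(p <- (J1 `*` J2)%fset) `|x p.1| * `|y p.2|)) //.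
  by apply: fset_sum_le; [move=> p; exact: mulr_ge0|exact: fsub_fsetM].
rewrite fset_sumM /=.
rewrite (eq_bigr (fun t => `|x t| * \sum_(u <- J2) `|y u|)); last first.
  by move=> t _; rewrite mulr_sumr.
by rewrite -mulr_suml ler_pM ?sumr_ge0.
Qed.

Variables (T U : choiceType) (x : T -> B) (y : U -> B) (M N : K).
Hypotheses (xM : abs_sum x M) (yN : abs_sum y N).

(** Rectangles are cofinal among the finite subsets of T * U, and over a
    rectangle the sum of the products is the product of the sums. *)
Lemma has_sum_prod a b : real_lubs K -> has_sum x a -> has_sum y b ->
  has_sum (fun p : T * U => x p.1 *b y p.2) (a *b b).
Proof.
move=> lubs xa yb; have [s xys] := abs_sum_has_sum lubs
  (abs_sum_prod xM yN (fun p => bmul_norm _ _)).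
suff -> : a *b b = s by [].
apply/eqP; rewrite -subr_eq0 -normr_le0; apply: le_add_eps => [||e e0];
  rewrite ?normr_real ?real0 //.
rewrite add0r; have [e2 _] := half_lt e0; have [e4 _] := half_lt e2.
have b0 : 0 < `|b| + 1 by rewrite ltr_wpDl.
have a0 : 0 < `|a| + 1 by rewrite ltr_wpDl.
have N0 : 0 < `|N| + 1 by rewrite ltr_wpDl.
have [J1 J1P] := xa _ (divr_gt0 e4 N0).
have [J2 J2P] := yb _ (divr_gt0 e4 a0).
have [J JP] := xys _ e2.
set J1' := (J1 `|` [fset p.1 | p in J])%fset.
set J2' := (J2 `|` [fset p.2 | p in J])%fset.
have /JP : (J `<=` J1' `*` J2')%fset.
  apply/fsubsetP => p pJ; have := fsubsetP (fsub_fsetM J) _ pJ.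
  by rewrite !in_fsetM !inE => /andP[-> ->]; rewrite !orbT.
have /J1P x1 : (J1 `<=` J1')%fset by exact: fsubsetUl.
have /J2P y2 : (J2 `<=` J2')%fset by exact: fsubsetUl.
rewrite fset_sumM (eq_bigr (fun t => x t *b \sum_(u <- J2') y u)); last first.
  by move=> t _; rewrite bmul_sumr.
rewrite -bmul_suml; set X := \sum_(_ <- J1') _ in x1 *.
set Y := \sum_(_ <- J2') _ in y2 * => sXY.
have -> : a *b b - s = (a *b (b - Y) + (a - X) *b Y) - (s - X *b Y).
  rewrite bmulBr bmulBl opprB !addrA; congr (_ - _).
  by rewrite !subrK.
rewrite (le_trans (ler_normB _ _)) // (splitr e) lerD //.
rewrite (le_trans (ler_normD _ _)) // (splitr (e / 2)) lerD //.
  rewrite (le_trans (bmul_norm _ _)) //.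
  rewrite (le_trans (ler_wpM2l (normr_ge0 _) y2)) // mulrCA ler_piMr ?ltW //.
  by rewrite ltr_pdivrMr // mul1r ltrDl.
have YN : `|Y| <= `|N| + 1.
  rewrite (le_trans (ler_norm_sum _ _ _)) // (le_trans (yN _)) //.
  have : 0 <= N by rewrite (le_trans _ (yN fset0)) // big_seq_fset0.
  by move=> /ger0_norm->; rewrite lerDl.
rewrite (le_trans (bmul_norm _ _)) //.
by rewrite (le_trans (ler_pM _ _ x1 YN)) // mulfVK // gt_eqF.
Qed.

End bilinear_sums.

(** * Linear maps, dense subspaces and duals *)

Section linear_maps.
Context {K : numFieldType}.
Implicit Types (V W : lmodType K).

Lemma linear_map0 V W (f : V -> W) (fl : linear f) : f 0 = 0.
Proof.
by have := fl (-1) 0 0; rewrite scaler0 addr0 scaleN1r addNr.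
Qed.

Lemma linear_mapZ V W (f : V -> W) (fl : linear f) k x : f (k *: x) = k *: f x.
Proof. by rewrite -[_ *: x]addr0 fl (linear_map0 fl) addr0. Qed.

Lemma linear_mapD V W (f : V -> W) (fl : linear f) x y : f (x + y) = f x + f y.
Proof. by rewrite -[x]scale1r fl !scale1r. Qed.

Lemma linear_mapB V W (f : V -> W) (fl : linear f) x y : f (x - y) = f x - f y.
Proof.
by rewrite (linear_mapD fl) -scaleN1r (linear_mapZ fl) scaleN1r.
Qed.

End linear_maps.

Section normed.
Context {K : numFieldType}.
Implicit Types V W : normedModType K.

Lemma closureE V (X : set V) x : closure X x <->
  forall e, 0 < e -> exists2 y, X y & `|x - y| <= e.
Proof.
split=> [clx e e0|clx N /nbhs_ballP[e /= e0 eN]].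
  have [|y [Xy]] := clx (ball x e); first by exact: nbhsx_ballx.
  by rewrite -ball_normE /= => /ltW; exists y.
have [e2 e2e] := half_lt e0; have [y Xy xy] := clx _ e2.
by exists y; split=> //; apply: eN; rewrite -ball_normE /= (le_lt_trans xy).
Qed.

Lemma closed_eps V (X : set V) :
  (forall x, (forall e, 0 < e -> exists2 y, X y & `|x - y| <= e) -> X x) ->
  closed X.
Proof.
move=> XP; apply/closure_id/seteqP; split=> [|x /closureE /XP//].
exact: subset_closure.
Qed.

Lemma subspaceD V (X : set V) x y : subspace X -> X x -> X y -> X (x + y).
Proof. by move=> [_ XP] Xx Xy; rewrite -[x]scale1r; exact: XP. Qed.

Lemma subspaceZ V (X : set V) k x : subspace X -> X x -> X (k *: x).
Proof. by move=> [X0 XP] Xx; rewrite -[_ *: x]addr0; exact: XP. Qed.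

Lemma subspaceB V (X : set V) x y : subspace X -> X x -> X y -> X (x - y).
Proof.
by move=> Xs Xx Xy; apply: subspaceD => //; rewrite -scaleN1r; exact: subspaceZ.
Qed.

Lemma lspan_subspace V (X : set V) : subspace (lspan X).
Proof.
split=> [Y [Ys _]|k x y Xx Xy Y [Ys XY]]; first by case: Ys.
by case: (Ys) => _; apply; [apply: Xx|apply: Xy].
Qed.

Lemma lspan_sub V (X : set V) : X `<=` lspan X.
Proof. by move=> x Xx Y [_]; apply. Qed.

Lemma lspan_min V (X Y : set V) : subspace Y -> X `<=` Y -> lspan X `<=` Y.
Proof. by move=> Ys XY x; apply. Qed.

Lemma closure_subspace V (X : set V) : subspace X -> subspace (closure X).
Proof.
move=> Xs; split; first by apply: subset_closure; case: Xs.
move=> k x y /closureE xX /closureE yX; apply/closureE => e e0.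
have [e2 _] := half_lt e0; have k0 : 0 < `|k| + 1 by rewrite ltr_wpDl.
have [x' Xx' xx'] := xX _ (divr_gt0 e2 k0); have [y' Xy' yy'] := yX _ e2.
exists (k *: x' + y'); first by case: Xs => _; apply.
rewrite opprD addrACA -scalerBr (splitr e) (le_trans (ler_normD _ _)) // lerD //.
rewrite normrZ (le_trans (ler_wpM2l (normr_ge0 _) xx')) // mulrCA ler_piMr ?ltW //.
by rewrite ltr_pdivrMr // mul1r ltrDl.
Qed.

Lemma closure_lspan_min V (X Y : set V) : closed Y -> subspace Y -> X `<=` Y ->
  closure (lspan X) `<=` Y.
Proof.
move=> Yc Ys XY; rewrite (closure_id Y).1 //; apply: closureS.
exact: lspan_min.
Qed.

Lemma dense_ind V (X Y : set V) x : closure (lspan X) = setT -> closed Y ->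
  subspace Y -> X `<=` Y -> Y x.
Proof.
by move=> XT Yc Ys XY; apply: (closure_lspan_min Yc Ys XY); rewrite XT.
Qed.

Lemma cvg_bounded_linear V W (f : V -> W) c (T : Type) (F : set_system T)
    (x : T -> V) (l : V) : Filter F -> linear f -> opnorm_le f c ->
  x t @[t --> F] --> l -> f (x t) @[t --> F] --> f l.
Proof.
move=> FF fl [c0 fc] xl; apply/cvgrPdist_lt => e e0.
have e1 : 0 < e / (c + 1) by rewrite divr_gt0 // ltr_wpDl.
move/cvgrPdist_lt : xl => /(_ _ e1); apply: filterS => t xt.
rewrite -(linear_mapB fl) (le_lt_trans (fc _)) //.
rewrite (@le_lt_trans _ _ ((c + 1) * `|l - x t|)) ?ler_wpM2r ?lerDl //.
by rewrite mulrC -ltr_pdivlMr // ltr_wpDl.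
Qed.

Lemma normed_cvg_unique V (T : Type) (F : set_system T) (x : T -> V)
    (l l' : V) : ProperFilter F ->
  x t @[t --> F] --> l -> x t @[t --> F] --> l' -> l = l'.
Proof.
by move=> FF; apply: (@cvg_unique _ (@norm_hausdorff _ _) (x @ F)).
Qed.

Lemma cvg_norm_le V (T : Type) (F : set_system T) (x : T -> V)
    (l : V) c : ProperFilter F -> F [set t | `|x t| <= c] ->
  x t @[t --> F] --> l -> `|l| <= c.
Proof.
move=> FF xc xl; have [t0 /= t0c] := filter_ex xc.
have c0 : 0 <= c := le_trans (normr_ge0 _) t0c.
apply: le_add_eps => [||e e0]; rewrite ?normr_real ?ger0_real //.
move/cvgrPdist_lt : xl => /(_ _ e0) xl.
have [t [/= tc tl]] := filter_ex (filterI xc xl).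
rewrite -[l](subrK (x t)) addrC (le_trans (ler_normD _ _)) // lerD //.
exact: ltW.
Qed.

(** Hence bounded linear maps that agree on a set agree on its closed span. *)
Lemma bounded_linear_eq_closed V W (f g : V -> W) c c' :
  linear f -> linear g -> opnorm_le f c -> opnorm_le g c' ->
  closed [set x | f x = g x] /\ subspace [set x | f x = g x].
Proof.
move=> fl gl [c0 fc] [c'0 gc]; split; last first.
  split=> /= [|k x y /= xE yE]; first by rewrite (linear_map0 fl) (linear_map0 gl).
  by rewrite fl gl xE yE.
apply: closed_eps => x xP /=; apply/eqP; rewrite -subr_eq0 -normr_le0.
apply: le_add_eps => [||e e0]; rewrite ?normr_real ?real0 // add0r.
have cc : 0 < c + c' + 1 by rewrite ltr_wpDl // addr_ge0.
have [y /= fgy xy] := xP _ (divr_gt0 e0 cc).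
have -> : f x - g x = f (x - y) - g (x - y).
  by rewrite (linear_mapB fl) (linear_mapB gl) fgy opprB addrA subrK.
rewrite (le_trans (ler_normB _ _)) // (le_trans (lerD (fc _) (gc _))) // -mulrDl.
rewrite (@le_trans _ _ ((c + c' + 1) * `|x - y|)) ?ler_wpM2r ?lerDl //.
by rewrite mulrC -ler_pdivlMr.
Qed.

Lemma dense_linear_eq V W (X : set V) (f g : V -> W) c c' :
  closure (lspan X) = setT ->
  linear f -> linear g -> opnorm_le f c -> opnorm_le g c' ->
  (forall x, X x -> f x = g x) -> f = g.
Proof.
move=> XT fl gl fc gc fg; apply/funext => x.
have [cl sub] := bounded_linear_eq_closed fl gl fc gc.
exact: (@dense_ind _ X _ x XT cl sub fg).
Qed.

End normed.

(** The closure of a bounded linear graph over a dense subspace is the graph of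
    the extension by continuity. *)
Section dense_extension.
Context {K : numFieldType} {V : normedModType K} {W : completeNormedModType K}.
Variables (G : set (V * W)) (c : K).
Hypothesis c0 : 0 <= c.
Hypothesis Glin : forall k x y a b, G (x, a) -> G (y, b) ->
  G (k *: x + y, k *: a + b).
Hypothesis Gbound : forall x a, G (x, a) -> `|a| <= c * `|x|.
Hypothesis Gdense : forall x e, 0 < e -> exists x' a, G (x', a) /\ `|x - x'| <= e.

Definition graph_closure (x : V) (a : W) := forall e, 0 < e ->
  exists x' a', [/\ G (x', a'), `|x - x'| <= e & `|a - a'| <= e].

Lemma graph_closure_sub x a : G (x, a) -> graph_closure x a.
Proof. by move=> Gx e e0; exists x, a; rewrite !subrr !normr0 ltW. Qed.

Lemma graph_closure_lin k x y a b : graph_closure x a -> graph_closure y b ->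
  graph_closure (k *: x + y) (k *: a + b).
Proof.
move=> xa yb e e0; have [e2 _] := half_lt e0.
have k0 : 0 < `|k| + 1 by rewrite ltr_wpDl.
have [x' [a' [Ga xx aa]]] := xa _ (divr_gt0 e2 k0).
have [y' [b' [Gb yy bb]]] := yb _ e2.
have le (U : normedModType K) (p p' r r' : U) :
    `|p - p'| <= e / 2 / (`|k| + 1) -> `|r - r'| <= e / 2 ->
    `|k *: p + r - (k *: p' + r')| <= e.
  move=> pp rr; rewrite opprD addrACA -scalerBr (splitr e).
  rewrite (le_trans (ler_normD _ _)) // lerD // normrZ.
  rewrite (le_trans (ler_wpM2l (normr_ge0 _) pp)) // mulrCA ler_piMr ?ltW //.
  by rewrite ltr_pdivrMr // mul1r ltrDl.
exists (k *: x' + y'), (k *: a' + b'); split; [exact: Glin|exact: le|exact: le].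
Qed.

Lemma graph_closure_bound x a : graph_closure x a -> `|a| <= c * `|x|.
Proof.
move=> xa; apply: le_add_eps => [||e e0];
  rewrite ?normr_real ?ger0_real ?mulr_ge0 //.
have c1 : 0 < c + 1 by rewrite ltr_wpDl.
have [x' [a' [Gx xx aa]]] := xa _ (divr_gt0 e0 c1).
rewrite -[a](subrK a') (le_trans (ler_normD _ _)) //.
have x'le : `|x'| <= `|x| + e / (c + 1).
  rewrite -[x'](subrK x) addrC (le_trans (ler_normD _ _)) // lerD //.
  by rewrite distrC.
rewrite (le_trans (lerD aa (le_trans (Gbound Gx) (ler_wpM2l c0 x'le)))) //.
rewrite mulrDr addrCA lerD // -[X in X + _]mul1r -mulrDl [1 + c]addrC.
by rewrite mulrC mulfVK // gt_eqF.
Qed.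

Lemma graph_closure_fun x a b : graph_closure x a -> graph_closure x b -> a = b.
Proof.
move=> xa xb; have := graph_closure_bound (graph_closure_lin (-1) xb xa).
rewrite !scaleN1r addNr normr0 mulr0 normr_le0 addrC subr_eq0.
by move/eqP.
Qed.

Lemma graph_closure_total x : exists a, graph_closure x a.
Proof.
pose F := filter_from [set e : K | 0 < e]
  (fun e => [set a | exists x', G (x', a) /\ `|x - x'| <= e]).
have FF : ProperFilter F.
  apply: filter_from_proper; last first.
    by move=> e /(Gdense x)[x' [a [Gx xx]]]; exists a, x'.
  apply: filter_from_filter; first by exists 1; rewrite /= ltr01.
  move=> e e' /= e0 e'0; exists (e * e' / (e + e')) => /=.
    by rewrite divr_gt0 ?mulr_gt0 ?addr_gt0.
  have mine : e * e' / (e + e') <= e.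
    by rewrite -mulrA ler_piMr ?ltW // ltr_pdivrMr ?addr_gt0 // mul1r ltrDr.
  have mine' : e * e' / (e + e') <= e'.
    by rewrite mulrAC ler_piMl ?ltW // ltr_pdivrMr ?addr_gt0 // mul1r ltrDl.
  move=> a [x' [Gx xx]].
  by split; exists x'; split=> //; exact: le_trans xx _.
have c1 : 0 < c * 2 + 1 by rewrite ltr_wpDl // mulr_ge0.
have Fc : cauchy F.
  apply: cauchy_exP => e e0.
  have d0 := divr_gt0 e0 c1; have [x0 [a0 [Gx0 xx0]]] := Gdense x d0.
  exists a0; exists (e / (c * 2 + 1)) => // a [x' [Gx xx]].
  rewrite -ball_normE /=.
  have := Gbound (Glin (-1) Gx Gx0); rewrite !scaleN1r addrC => /le_lt_trans; apply.
  have xle : `|- x' + x0| <= 2 * (e / (c * 2 + 1)).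
    rewrite (_ : - x' + x0 = (x - x') - (x - x0)); last first.
      by rewrite opprB [RHS]addrC addrA addrNK addrC.
    by rewrite (le_trans (ler_normB _ _)) // mulr_natl mulr2n lerD.
  rewrite (le_lt_trans (ler_wpM2l c0 xle)) // mulrA mulrCA gtr_pMr //.
  by rewrite ltr_pdivrMr // mul1r ltrDl.
have Fcv := @cauchy_cvg _ F FF Fc.
exists (lim F) => e e0.
have /cvgrPdist_lt/(_ _ e0) Fe : id @ F --> lim F by exact: Fcv.
have Fxe : F [set a | exists x', G (x', a) /\ `|x - x'| <= e] by exists e.
have [a [/= ae [x' [Gx xe]]]] := filter_ex (filterI Fe Fxe).
by exists x', a; split=> //; exact: ltW.
Qed.

Lemma dense_extension : exists f : V -> W,
  [/\ linear f, opnorm_le f c & forall x a, graph_closure x a <-> f x = a].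
Proof.
have [f fP] := choice graph_closure_total; exists f; split.
- move=> k x y; apply: graph_closure_fun (fP _) _; exact: graph_closure_lin.
- by split=> // x; exact: graph_closure_bound.
- by move=> x a; split=> [|<-//]; exact: graph_closure_fun (fP _).
Qed.

End dense_extension.

(** The constant e / (M + e) is at most 1, which bounds |r'| by |r| + 1, and its
    product with M is at most e. *)
Lemma bmul_close (K : numFieldType) (C : banachAlgType K) (M e : K)
    (p p' r r' : C) : 0 < M -> 0 < e -> `|p| + `|r| + 1 <= M ->
  `|p - p'| <= e / (M + e) -> `|r - r'| <= e / (M + e) ->
  `|p *b r - p' *b r'| <= e.
Proof.
move=> M0 e0 prM pp rr; have Me : 0 < M + e by rewrite addr_gt0.
have d0 : 0 < e / (M + e) by rewrite divr_gt0.
have dM : e / (M + e) * M <= e.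
  by rewrite mulrAC ler_pdivrMr // ler_pM2l // lerDl ltW.
have d1 : e / (M + e) <= 1 by rewrite ler_pdivrMr // mul1r lerDr ltW.
have r'le : `|r'| <= `|r| + 1.
  rewrite -[r'](subrK r) addrC (le_trans (ler_normD _ _)) // lerD //.
  by rewrite distrC (le_trans rr).
have -> : p *b r - p' *b r' = p *b (r - r') + (p - p') *b r'.
  by rewrite bmulBr bmulBl addrA subrK.
rewrite (le_trans (ler_normD _ _)) //.
rewrite (le_trans (lerD (bmul_norm _ _) (bmul_norm _ _))) //.
rewrite (le_trans (lerD (ler_wpM2l (normr_ge0 _) rr)
  (ler_pM (normr_ge0 _) (normr_ge0 _) pp r'le))) //.
rewrite [X in X + _ <= _]mulrC -mulrDr addrA (le_trans _ dM) // ler_wpM2l //.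
exact: ltW.
Qed.

Lemma graph_closure_mul (K : numFieldType) (A B : banachAlgType K)
    (G : set (A * B)) x y a b :
  (forall x y a b, G (x, a) -> G (y, b) -> G (x *b y, a *b b)) ->
  graph_closure G x a -> graph_closure G y b -> graph_closure G (x *b y) (a *b b).
Proof.
move=> Gmul xa yb e e0.
pose M := `|x| + `|y| + `|a| + `|b| + 1.
have M0 : 0 < M by rewrite ltr_wpDl // !addr_ge0.
have Me : 0 < M + e by rewrite addr_gt0.
have d0 : 0 < e / (M + e) by rewrite divr_gt0.
have [x' [a' [Gx xx aa]]] := xa _ d0; have [y' [b' [Gy yy bb]]] := yb _ d0.
exists (x' *b y'), (a' *b b'); split; [exact: Gmul| |];
  apply: (@bmul_close _ _ M) => //.
  by rewrite /M lerD // -!addrA !lerD // lerDl addr_ge0.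
by rewrite /M lerD // lerD // lerDr addr_ge0.
Qed.

Section duals.
Context {K : numFieldType}.
Implicit Types V W : normedModType K.

Lemma dual_linear V (f : dual V) : linear f.
Proof. by have /asboolP[] := dualP f. Qed.

Lemma dual_bound V (f : dual V) : exists c, opnorm_le f c.
Proof. by have /asboolP[] := dualP f. Qed.

Lemma bidual_linear V (phi : bidual V) : linear phi.
Proof. by have /asboolP[] := bidualP phi. Qed.

Lemma bidual_bound V (phi : bidual V) : exists c, bidual_le phi c.
Proof. by have /asboolP[] := bidualP phi. Qed.

Lemma dualE V (f g : dual V) : (forall x, f x = g x) -> f = g.
Proof. by move=> fg; apply/val_inj/funext. Qed.

Lemma bidualE V (phi psi : bidual V) : (forall f, phi f = psi f) -> phi = psi.
Proof. by move=> fg; apply/val_inj/funext. Qed.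

Lemma dual_cvg V (f : dual V) (T : Type) (F : set_system T) (x : T -> V)
    (l : V) : Filter F -> x t @[t --> F] --> l ->
  (f (x t) : K^o) @[t --> F] --> (f l : K^o).
Proof.
move=> FF; have [c fc] := dual_bound f.
exact: (cvg_bounded_linear FF (dual_linear f) fc).
Qed.

(** Total versions of the constructors: zero stands for the maps that are not
    bounded and linear. *)
Definition mk_dual V (f : V -> K^o) : dual V := insubd 0 f.
Definition mk_bidual V (phi : dual V -> K^o) : bidual V := insubd (embed 0) phi.

Lemma mk_dualE V (f : V -> K^o) c : linear f -> opnorm_le f c ->
  mk_dual f = f :> (V -> K^o).
Proof.
move=> fl fc; apply: (@insubdK _ _ (dual V)).
by apply/asboolP; split=> //; exists c.
Qed.

Lemma mk_bidualE V (phi : dual V -> K^o) c : linear phi -> bidual_le phi c ->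
  mk_bidual phi = phi :> (dual V -> K^o).
Proof.
move=> fl fc; apply: (@insubdK _ _ (bidual V)).
by apply/asboolP; split=> //; exists c.
Qed.

End duals.

Section hahn_banach_consequences.
Context {R : realType} {K : numFieldType} (hK : real_or_complex R K).
Implicit Types V W : normedModType K.

Lemma norming_functional V (x : V) :
  exists f : dual V, opnorm_le f 1 /\ f x = `|x|.
Proof.
have [->|x0] := eqVneq x 0.
  exists 0; split; last by rewrite normr0.
  by split=> // y; rewrite mul1r normr0.
pose g (z : V) : K := xget 0 [set k | z = k *: x].
have gE k : g (k *: x) = k.
  rewrite /g; case: xgetP => [l _ /= /esym/eqP|/(_ k)/(_ erefl)//].
  by rewrite -subr_eq0 -scalerBl scaler_eq0 (negbTE x0) orbF subr_eq0 => /eqP.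
have [|k y z [l ->] [m ->]|y [l ->]|f [fg f1]] :=
    @hahn_banach R K V [set z | exists k, z = k *: x] (fun z => g z * `|x|) 1 hK ler01.
- split; first by exists 0; rewrite scale0r.
  move=> k _ _ [l ->] [m ->]; exists (k * l + m).
  by rewrite scalerA scalerDl.
- by rewrite scalerA -scalerDl !gE mulrDl mulrA.
- by rewrite gE normrM normr_id mul1r normrZ.
- exists f; split=> //; rewrite fg; last by exists 1; rewrite scale1r.
  by rewrite -[in g x](scale1r x) gE mul1r.
Qed.

Lemma embed_le V (x : V) c : bidual_le (embed x) c -> `|x| <= c.
Proof.
move=> [_ xc]; have [f [f1 fx]] := norming_functional x.
by have := xc _ _ f1; rewrite /= fx normr_id mulr1.
Qed.

Lemma bidual_le_embed V (x : V) c : `|x| <= c -> bidual_le (embed x) c.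
Proof.
move=> xc; have c0 := le_trans (normr_ge0 _) xc; split=> // f d [d0 fd].
by rewrite (le_trans (fd x)) // mulrC ler_wpM2r.
Qed.

Lemma dual_separates V (x y : V) : (forall f : dual V, f x = f y) -> x = y.
Proof.
move=> xy; have [f [_ fxy]] := norming_functional (x - y).
apply/eqP; rewrite -subr_eq0 -normr_eq0 -fxy.
by rewrite (linear_mapB (dual_linear f)) xy subrr.
Qed.

Lemma embed_inj V : injective (@embed K V).
Proof.
move=> x y xy; apply: dual_separates => f.
exact: (congr1 (fun p : bidual V => p f) xy).
Qed.

Lemma embedK V : cancel (@embed K V) embed_inv.
Proof.
move=> x; rewrite /embed_inv; case: xgetP => [y _ /embed_inj//|/(_ x)].
by move=> /(_ erefl).
Qed.

(** The functional w + k x |-> k on W + K x is bounded by the inverse of the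
    distance from x to W. *)
Lemma closed_subspace_separation V (W : set V) (x : V) : closed W ->
  subspace W -> ~ W x -> exists f : dual V, (forall w, W w -> f w = 0) /\ f x = 1.
Proof.
move=> Wc Ws nWx.
have [e e0 eW] : exists2 e, 0 < e & forall w, W w -> e <= `|x - w|.
  apply: contrapT => ne; apply: nWx; rewrite (closure_id W).1 //.
  apply/closureE => e e0; apply: contrapT => nw; apply: ne; exists e => // w Ww.
  rewrite real_leNgt; [apply/negP => lt; apply: nw|exact: gtr0_real|exact: normr_real].
  by exists w => //; exact: ltW.
pose g (z : V) : K := xget 0 [set k | W (z - k *: x)].
have guniq z k l : W (z - k *: x) -> W (z - l *: x) -> k = l.
  move=> zk zl; apply/eqP; rewrite -subr_eq0; apply: contrapT => /negP kl.
  apply: nWx; rewrite -[x](scalerK kl); apply: subspaceZ => //.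
  have := subspaceB Ws zl zk.
  by rewrite opprB addrC addrA subrK -scalerBl.
have gE z k : W (z - k *: x) -> g z = k.
  move=> zk; apply: (guniq z) => //.
  by apply: (@xgetPex _ 0 [set k | W (z - k *: x)]); exists k.
have [||k y z [l yl] [m zm]|y [l yl]|f [fg f1]] :=
    @hahn_banach R K V [set z | exists k, W (z - k *: x)] g e^-1 hK.
- by rewrite invr_ge0 ltW.
- split; first by exists 0; rewrite scale0r subr0; case: Ws.
  move=> k y z [l yl] [m zm]; exists (k * l + m).
  rewrite scalerDl -scalerA opprD addrACA -scalerBr.
  by case: (Ws) => _; apply.
- rewrite (gE _ _ yl) (gE _ _ zm); apply: gE.
  rewrite scalerDl -scalerA opprD addrACA -scalerBr.
  by case: (Ws) => _; apply.
- rewrite (gE _ _ yl); have [->|l0] := eqVneq l 0.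
    by rewrite normr0 mulr_ge0 // invr_ge0 ltW.
  rewrite mulrC ler_pdivlMr // -[y](scalerKV l0).
  have := eW _ (subspaceZ (- l^-1) Ws yl).
  rewrite scalerBr scalerA mulNr mulVf // scaleN1r opprB addrA.
  rewrite subrr sub0r scaleNr opprK => le.
  by rewrite normrZ ler_wpM2l.
- exists f; split=> [w Ww|].
    have wW : W (w - 0 *: x) by rewrite scale0r subr0.
    by rewrite fg ?(gE _ _ wW) //; exists 0.
  have xW : W (x - 1 *: x) by rewrite scale1r subrr; case: Ws.
  by rewrite fg ?(gE _ _ xW) //; exists 1.
Qed.

(** A weak limit outside of W would be separated from W by a functional that
    vanishes on W. *)
Lemma closed_subspace_weakly_closed V (W : set V) (T : Type) (F : set_system T)
    (x : T -> V) (l : V) : closed W -> subspace W -> ProperFilter F ->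
  F [set t | W (x t)] ->
  (forall f : dual V, (f (x t) : K^o) @[t --> F] --> (f l : K^o)) -> W l.
Proof.
move=> Wc Ws FF FW xl; apply: contrapT => /(closed_subspace_separation Wc Ws).
move=> [f [fW f1]]; have : f l = 0.
  apply: (normed_cvg_unique FF (xl f)).
  apply: (@cvg_trans _ ((fun=> 0 : K^o) @ F)); last exact: cvg_cst.
  by apply: near_eq_cvg; apply: filterS FW => t Wt; rewrite /= fW.
by rewrite f1 => /eqP; rewrite oner_eq0.
Qed.

End hahn_banach_consequences.

Section arens_facts.
Context {K : numFieldType}.
Implicit Types A B : banachAlgType K.

Lemma arensE B (a b : bidual B) f : (a ** b) f = b (arens_inner a f).
Proof. by []. Qed.

Lemma arens_embed B (x y : B) : embed x ** embed y = embed (x *b y).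
Proof. exact: bidualE. Qed.

Lemma arens_innerA B (a b : bidual B) f :
  arens_inner (a ** b) f = arens_inner b (arens_inner a f).
Proof.
apply: dualE => y /=; congr (b _); apply: dualE => z /=; congr (a _).
by apply: dualE => x /=; rewrite bmulA.
Qed.

Lemma arensA B : associative (@arens K B).
Proof. by move=> a b c; apply: bidualE => f; rewrite !arensE arens_innerA. Qed.

Lemma arens_embedl B (x : B) (a : bidual B) f :
  (embed x ** a) f = a (arens_inner (embed x) f).
Proof. by []. Qed.

End arens_facts.

(** * Inverse semigroups and their actions *)

Section inverse_semigroups.
Context {S : invSemigroupType}.
Implicit Types s t e f : S.

Lemma starK t : star (star t) = t.
Proof. by rewrite -(@star_unique S (star t) t) // ?mul_starK ?star_mulK. Qed.

Lemma star_idem e : idem e -> star e = e.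
Proof. by move=> ee; rewrite -(@star_unique S e e) // !ee. Qed.

Lemma idem_mul_star t : idem (t * star t)%g.
Proof. by rewrite /idem mulgA mul_starK. Qed.

Lemma idem_star_mul t : idem (star t * t)%g.
Proof. by rewrite /idem mulgA star_mulK. Qed.

(** Idempotents of an inverse semigroup commute: the inverse x of ef equals
    fxe, which is idempotent, hence so is ef; then fe is also an inverse of
    ef. *)
Lemma idem_mul e f : idem e -> idem f -> idem (e * f)%g.
Proof.
move=> ee ff; set x := star (e * f)%g.
have efx : (e * f * x * (e * f) = e * f)%g := mul_starK (e * f)%g.
have xef : (x * (e * f) * x = x)%g := star_mulK (e * f)%g.
have xE : (f * x * e)%g = x.
  apply: star_unique.
    rewrite -[RHS]efx -!mulgA; congr (e * _)%g; rewrite 2!mulgA ff -!mulgA.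
    by congr (f * (x * _))%g; rewrite mulgA ee.
  rewrite -[in RHS]xef -!mulgA; congr (f * _)%g; congr (x * _)%g.
  by rewrite mulgA ee; congr (e * _)%g; rewrite !mulgA ff.
have xx : idem x.
  rewrite /idem -{1 2}xE; rewrite -[RHS]xE -[in RHS]xef -!mulgA.
  by [].
by rewrite -[(e * f)%g]starK -/x (star_idem xx).
Qed.

Lemma idem_comm e f : idem e -> idem f -> (e * f)%g = (f * e)%g.
Proof.
move=> ee ff; have ef := idem_mul ee ff; have fe := idem_mul ff ee.
rewrite -[LHS](star_idem ef); symmetry; apply: star_unique.
  rewrite -[RHS]ef -!mulgA; congr (e * _)%g; rewrite mulgA ff.
  by congr (f * _)%g; rewrite mulgA ee.
rewrite -[RHS]fe -!mulgA; congr (f * _)%g; rewrite mulgA ee.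
by congr (e * _)%g; rewrite mulgA ff.
Qed.

Lemma starM s t : star (s * t)%g = (star t * star s)%g.
Proof.
have comm := idem_comm (idem_mul_star t) (idem_star_mul s).
symmetry; apply: star_unique.
  have -> : (s * t * (star t * star s) * (s * t) =
             s * (t * star t * (star s * s)) * t)%g by rewrite !mulgA.
  by rewrite comm !mulgA mul_starK -!mulgA [(t * _)%g]mulgA mul_starK.
have -> : (star t * star s * (s * t) * (star t * star s) =
           star t * (star s * s * (t * star t)) * star s)%g by rewrite !mulgA.
by rewrite -comm !mulgA star_mulK -!mulgA [(star s * _)%g]mulgA star_mulK.
Qed.

End inverse_semigroups.

Section actions.
Context {K : numFieldType} {S : invSemigroupType} {A : banachAlgType K}.
Variable alpha : action S A.
Implicit Types (s t e : S) (a b : A).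
Local Notation Dom := (dom alpha).

Lemma dom_subspace t : subspace (Dom t).
Proof. by have [] := dom_ideal alpha t. Qed.

Lemma dom_closed t : closed (Dom t).
Proof. by have [] := dom_ideal alpha t. Qed.

Lemma dom0 t : Dom t 0.
Proof. by have [] := dom_subspace t. Qed.

Lemma domMr t a b : Dom t a -> Dom t (a *b b).
Proof. by move=> ta; have [_ _ /(_ a b ta)[]] := dom_ideal alpha t. Qed.

Lemma domMl t a b : Dom t a -> Dom t (b *b a).
Proof. by move=> ta; have [_ _ /(_ a b ta)[]] := dom_ideal alpha t. Qed.

Lemma act_dom t a : Dom (star t) a -> Dom t (act alpha t a).
Proof. by move=> ta; rewrite -(act_image alpha t); exists a. Qed.

Lemma act_star_dom t a : Dom t a -> Dom (star t) (act alpha (star t) a).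
Proof. by move=> ta; apply: act_dom; rewrite starK. Qed.

(** The map alpha_t followed by alpha_(star t) has the domain of alpha_t, and it
    is alpha at the idempotent star t * t. *)
Lemma dom_star t : Dom (star t) = Dom (star t * t)%g.
Proof.
have := act_comp_dom alpha (star t) t.
rewrite starK (star_idem (idem_star_mul t)) => <-.
by apply/seteqP; split=> [a ta|a []//]; split=> //; exact: act_dom.
Qed.

Lemma dom_mul_star t : Dom t = Dom (t * star t)%g.
Proof. by rewrite -{1}(starK t) dom_star starK. Qed.

Lemma domE s t a : Dom (s * t)%g a <-> Dom s a /\ Dom t (act alpha (star s) a).
Proof.
have := act_comp_dom alpha (star t) (star s).
by rewrite -starM !starK => <-.
Qed.

(** alpha_e is isometric and satisfies alpha_e (alpha_e a) = alpha_e a. *)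
Lemma act_idem e a : idem e -> Dom e a -> act alpha e a = a.
Proof.
move=> ee ea; have Ie : Dom (star e) = Dom e by rewrite star_idem.
have eea : act alpha e (act alpha e a) = act alpha e a.
  by rewrite act_comp ee // Ie.
have ea' : Dom e (act alpha e a) by apply: act_dom; rewrite Ie.
apply/eqP; rewrite -subr_eq0 -normr_eq0 -(@act_norm _ _ _ alpha e); last first.
  by rewrite Ie; apply: subspaceB => //; exact: dom_subspace.
rewrite -scaleN1r addrC act_linear ?Ie // scaleN1r eea addNr normr0 //.
Qed.

Lemma act_starK t a : Dom t a -> act alpha t (act alpha (star t) a) = a.
Proof.
move=> ta; have tta : Dom (t * star t)%g a by rewrite -dom_mul_star.
have tt := idem_mul_star t.
by rewrite act_comp ?act_idem // star_idem.
Qed.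

Lemma starK_act t a : Dom (star t) a -> act alpha (star t) (act alpha t a) = a.
Proof. by move=> ta; have := act_starK ta; rewrite starK. Qed.

Lemma dom_mul_idem t a : Dom (star t) a -> Dom (star t * t)%g a.
Proof. by rewrite -dom_star. Qed.

(** In the convolution algebra, the product of a at s with b at t is
    [twist s a b] at st. *)
Definition twist s a b := act alpha s (act alpha (star s) a *b b).

Lemma twist_dom s t a b : Dom s a -> Dom t b -> Dom (s * t)%g (twist s a b).
Proof.
move=> sa tb; have sc : Dom (star s) (act alpha (star s) a *b b).
  by apply: domMr; exact: act_star_dom.
apply/domE; split; first exact: act_dom.
by rewrite starK_act //; exact: domMl.
Qed.

Lemma twist_norm s a b : Dom s a -> `|twist s a b| <= `|a| * `|b|.
Proof.
move=> sa; rewrite /twist act_norm; last first.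
  by apply: domMr; exact: act_star_dom.
by rewrite (le_trans (bmul_norm _ _)) // act_norm ?starK.
Qed.

Lemma twist_act t a b : Dom t a -> Dom (star t) b ->
  twist t a b = a *b act alpha t b.
Proof.
by move=> ta tb; rewrite /twist act_mul ?act_starK //; exact: act_star_dom.
Qed.

Lemma twist_idem e a b : idem e -> Dom e a -> twist e a b = a *b b.
Proof.
move=> ee ea; rewrite /twist star_idem // act_idem // act_idem //.
exact: domMr.
Qed.

Lemma twist_linr s k a b b' : Dom s a ->
  twist s a (k *: b + b') = k *: twist s a b + twist s a b'.
Proof.
move=> sa; rewrite /twist bmulDr bmulZr act_linear //; apply: domMr;
  exact: act_star_dom.
Qed.

Lemma twist_linl s k a a' b : Dom s a -> Dom s a' ->
  twist s (k *: a + a') b = k *: twist s a b + twist s a' b.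
Proof.
move=> sa sa'; rewrite /twist act_linear ?starK // bmulDl bmulZl.
by rewrite act_linear //; apply: domMr; exact: act_star_dom.
Qed.

End actions.

(** * Products in a covariant representation *)

Section covariant_products.
Context {R : realType} {K : numFieldType} (hK : real_or_complex R K).
Context {S : invSemigroupType} {A B : banachAlgType K} (alpha : action S A).
Variables (pi : A -> B) (v : S -> bidual B).
Hypothesis cov : covariant_rep alpha pi v.
Implicit Types (s t e : S) (a b : A).
Local Notation Dom := (dom alpha).

Lemma cov_linear : linear pi.
Proof. by case: cov => -[[]]. Qed.

Lemma cov_pi_mul a b : pi (a *b b) = pi a *b pi b.
Proof. by case: cov => -[[]]. Qed.

Lemma cov_pi_norm a : `|pi a| <= `|a|.
Proof. by case: cov => -[[]]. Qed.

(** The first covariance condition puts pi(alpha_t(b)) v_t into B for b in the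
    domain of alpha_t; these alpha_t(b) exhaust I_t. *)
Lemma cov_mulE t a : Dom t a -> embed (cov_mul pi v a t) = embed (pi a) ** v t.
Proof.
move=> ta; have [_ cr1 _ _] := cov; have ta' := act_star_dom ta.
have := cr1 t _ ta'; rewrite act_starK // => -[E [b bE]].
by rewrite /cov_mul -E bE (embedK hK).
Qed.

Lemma cov_mul_act t a : Dom (star t) a ->
  embed (cov_mul pi v (act alpha t a) t) = v t ** embed (pi a).
Proof.
move=> ta; rewrite cov_mulE; last exact: act_dom.
by have [_ cr1 _ _] := cov; have [] := cr1 t _ ta.
Qed.

Lemma cov_mul_lin t k a b : Dom t a -> Dom t b ->
  cov_mul pi v (k *: a + b) t = k *: cov_mul pi v a t + cov_mul pi v b t.
Proof.
move=> ta tb; have tab : Dom t (k *: a + b) by case: (dom_subspace alpha t) => _; exact.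
apply: (embed_inj hK); rewrite cov_mulE //; apply: bidualE => f.
have E c : Dom t c -> (embed (pi c) ** v t) f = f (cov_mul pi v c t).
  by move=> tc; rewrite -cov_mulE.
change (v t (arens_inner (embed (pi (k *: a + b))) f) =
        f (k *: cov_mul pi v a t + cov_mul pi v b t)).
rewrite (dual_linear f) -!E // !arens_embedl.
rewrite -(bidual_linear (v t)); congr (v t _); apply: dualE => y /=.
rewrite cov_linear bmulDl bmulZl; exact: dual_linear.
Qed.

Lemma cov_mul0 t : cov_mul pi v 0 t = 0.
Proof.
have := cov_mul_lin (-1) (dom0 alpha t) (dom0 alpha t).
by rewrite scaler0 addr0 scaleN1r addNr.
Qed.

Lemma cov_mul_norm t a : Dom t a -> `|cov_mul pi v a t| <= `|a|.
Proof.
move=> ta; apply: le_trans (cov_pi_norm a).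
apply: (embed_le hK); rewrite cov_mulE //; split=> // f d [d0 fd].
rewrite arens_embedl; have [[_ /(_ t)[_ vt]] _ _ _] := cov.
rewrite -[_ * d]mul1r; apply: vt; split=> [|y]; first exact: mulr_ge0.
rewrite /= (le_trans (fd _)) // [X in _ <= X * _]mulrC -mulrA ler_wpM2l //.
exact: bmul_norm.
Qed.

Lemma cov_mul_idem e a : idem e -> Dom e a -> cov_mul pi v a e = pi a.
Proof.
move=> ee ea; apply: (embed_inj hK); rewrite cov_mulE //.
by have [_ _ _] := cov; apply.
Qed.

(** Writing pi(a) v_s as v_s pi(a') with a' = alpha_(star s)(a) brings pi(a') and
    pi(b) together; the product pi(a' b) then moves back to the left of v_s. *)
Lemma cov_mulM s t a b : Dom s a -> Dom t b ->
  cov_mul pi v a s *b cov_mul pi v b t = cov_mul pi v (twist alpha s a b) (s * t)%g.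
Proof.
move=> sa tb; have sa' := act_star_dom sa.
apply: (embed_inj hK); rewrite -arens_embed -{1}(act_starK sa) cov_mul_act //.
rewrite cov_mulE // cov_mulE; last exact: twist_dom.
rewrite !arensA -[v s ** _ ** _]arensA arens_embed -cov_pi_mul.
have [_ cr1 cr2 _] := cov; have sab := domMr b sa'.
by have [-> _] := cr1 s _ sab; rewrite cr2 //; exact: twist_dom.
Qed.

End covariant_products.

(** * The integrated form and the existence of the crossed product *)

Section integrated_form.
Context {R : realType} {K : numFieldType} (hK : real_or_complex R K).
Context {S : invSemigroupType} {A : banachAlgType K} (alpha : action S A).
Implicit Types (f g : S -> A).
Local Notation Dom := (dom alpha).

Let lubs : real_lubs K := real_or_complex_lubs hK.

Lemma l1_abs_sum f : l1 alpha f -> exists M, abs_sum f M.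
Proof. by move=> [_ [M fM]]; exists M => J; rewrite -partial_sumE. Qed.

Lemma abs_sum_l1 f M : (forall t, Dom t (f t)) -> abs_sum f M -> l1 alpha f.
Proof. by move=> fD fM; split=> //; exists M => J; rewrite partial_sumE. Qed.

Lemma l1_linP k f g : l1 alpha f -> l1 alpha g -> l1 alpha (k *: f + g).
Proof.
move=> fl gl; have [M fM] := l1_abs_sum fl; have [N gN] := l1_abs_sum gl.
apply: (@abs_sum_l1 _ (`|k| * M + N)) => [t|J].
  by case: (dom_subspace alpha t) => _; apply; [case: fl|case: gl].
rewrite (@le_trans _ _ (\sum_(t <- J) (`|k| * `|f t| + `|g t|))) //.
  by apply: ler_sum => t _; rewrite (le_trans (ler_normD _ _)) // normrZ.
by rewrite big_split /= -mulr_sumr lerD // ler_wpM2l.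
Qed.

Lemma l1_0 : l1 alpha (fun=> 0).
Proof.
apply: (@abs_sum_l1 _ 0) => [t|J]; first exact: dom0.
by rewrite big1 // => t _; rewrite normr0.
Qed.

Let twists f g (p : S * S) := twist alpha p.1 (f p.1) (g p.2).

Lemma twists_abs_sum f g M N : (forall t, Dom t (f t)) -> abs_sum f M -> abs_sum g N ->
  abs_sum (twists f g) (M * N).
Proof.
move=> fD fM gN; apply: (abs_sum_prod fM gN) => p; exact: twist_norm.
Qed.

Lemma fiber_twist_dom f g r p : l1 alpha f -> l1 alpha g ->
  Dom r (if (p.1 * p.2)%g == r then twists f g p else 0).
Proof.
move=> [fD _] [gD _]; case: eqP => [<-|_]; last exact: dom0.
exact: twist_dom.
Qed.

Lemma conv_has_sum f g r : l1 alpha f -> l1 alpha g ->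
  has_sum (fun p : S * S => if (p.1 * p.2)%g == r then twists f g p else 0)
    (conv alpha f g r).
Proof.
move=> fl gl; have [M fM] := l1_abs_sum fl; have [N gN] := l1_abs_sum gl.
apply: (abs_sumE lubs (M := M * N)).
by apply: abs_sum_fiber; apply: twists_abs_sum => //; case: fl.
Qed.

Lemma conv_l1 f g : l1 alpha f -> l1 alpha g -> l1 alpha (conv alpha f g).
Proof.
move=> fl gl; have [M fM] := l1_abs_sum fl; have [N gN] := l1_abs_sum gl.
have fgMN : abs_sum (twists f g) (M * N) by apply: twists_abs_sum => //; case: fl.
apply: (@abs_sum_l1 _ (M * N)) => [r|].
  apply: (has_sum_closed _ _ _ (conv_has_sum r fl gl)).
  - exact: dom_closed.
  - exact: dom_subspace.
  - by move=> p; exact: fiber_twist_dom.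
have [s fgs] := abs_sum_has_sum lubs fgMN.
exact: (has_sum_fiber lubs (fun p : S * S => (p.1 * p.2)%g) fgMN fgs).2.
Qed.

Section one_representation.
Context {B : banachAlgType K} (pi : A -> B) (v : S -> bidual B).
Hypothesis cov : covariant_rep alpha pi v.

Lemma cov_mul_abs_sum f M : (forall t, Dom t (f t)) -> abs_sum f M ->
  abs_sum (fun t => cov_mul pi v (f t) t) M.
Proof.
move=> fD fM J; apply: le_trans (fM J); apply: ler_sum => t _.
exact: (cov_mul_norm hK cov).
Qed.

Lemma integrated_has_sum f : l1 alpha f ->
  has_sum (fun t => cov_mul pi v (f t) t) (integrated pi v f).
Proof.
move=> fl; have [M fM] := l1_abs_sum fl; apply: (abs_sumE lubs (M := M)).
by apply: cov_mul_abs_sum => //; case: fl.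
Qed.

Lemma integrated_norm f M : (forall t, Dom t (f t)) -> abs_sum f M ->
  `|integrated pi v f| <= M.
Proof.
move=> fD fM; apply: (abs_sum_norm (cov_mul_abs_sum fD fM)).
exact: integrated_has_sum (abs_sum_l1 fD fM).
Qed.

Lemma integrated_lin k f g : l1 alpha f -> l1 alpha g ->
  integrated pi v (k *: f + g) = k *: integrated pi v f + integrated pi v g.
Proof.
move=> fl gl; apply: has_sum_unique (integrated_has_sum (l1_linP k fl gl)) _.
have := has_sum_lin k (integrated_has_sum fl) (integrated_has_sum gl).
congr has_sum; apply/funext => t; rewrite (cov_mul_lin hK cov) //.
  by case: fl.
by case: gl.
Qed.

(** Both sides are the sum over all pairs (s, t) of the products of
    [pi (f s) v_s] and [pi (g t) v_t]; the left one groups them by st. *)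
Lemma integrated_conv f g : l1 alpha f -> l1 alpha g ->
  integrated pi v (conv alpha f g) = integrated pi v f *b integrated pi v g.
Proof.
move=> fl gl; have [M fM] := l1_abs_sum fl; have [N gN] := l1_abs_sum gl.
have [fD _] := fl; have [gD _] := gl.
have fM' := cov_mul_abs_sum fD fM; have gN' := cov_mul_abs_sum gD gN.
have fgs := has_sum_prod fM' gN' lubs (integrated_has_sum fl) (integrated_has_sum gl).
have fgMN := abs_sum_prod fM' gN' (fun p => bmul_norm _ _).
have [+ _] := has_sum_fiber lubs (fun p : S * S => (p.1 * p.2)%g) fgMN fgs.
move=> /= fibers; apply: has_sum_unique (integrated_has_sum (conv_l1 fl gl)) _.
move: fibers; congr has_sum; apply/funext => r; apply: has_sumE.
have cov_r : has_sum ((cov_mul pi v)^~ r \o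
    (fun p : S * S => if (p.1 * p.2)%g == r then twists f g p else 0))
    (cov_mul pi v (conv alpha f g r) r).
  apply: (@has_sum_map _ _ _ _ (Dom r) _ 1).
  - exact: dom_closed.
  - exact: dom_subspace.
  - by move=> k a b ra rb; exact: (cov_mul_lin hK cov).
  - by move=> a ra; rewrite mul1r; exact: (cov_mul_norm hK cov).
  - by move=> p; exact: fiber_twist_dom.
  - exact: conv_has_sum.
move: cov_r; congr has_sum; apply/funext => p /=; case: eqP => [<-|_].
  by rewrite (cov_mulM hK cov).
exact: (cov_mul0 hK cov).
Qed.

End one_representation.

Lemma zero_covariant : covariant_rep alpha (fun _ : A => 0 : A) (fun=> embed 0).
Proof.
split.
- split; first split.
  + by move=> k x y; rewrite scaler0 addr0.
  + by move=> a b; rewrite bmul0l.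
  + by move=> a; rewrite normr0.
  + by move=> t; apply: bidual_le_embed; rewrite normr0 ler01.
- move=> t a _; split=> //; exists 0; by rewrite arens_embed bmul0l.
- by move=> s t a _; rewrite !arens_embed !bmul0l.
- by move=> e a _ _; rewrite arens_embed bmul0l.
Qed.

(** The zero representation shows that the supremum is not over the empty
    set. *)
Lemma max_norms_ub_ge0 f m : ubound (max_norms alpha f) m -> 0 <= m.
Proof.
move=> fm; pose r := `|integrated (fun _ : A => 0 : A) (fun=> embed 0) f|.
apply: (le_trans (normr_ge0 _ : 0 <= r)); apply: fm.
by exists A, (fun=> 0), (fun=> embed 0); split=> //; exact: zero_covariant.
Qed.

Lemma max_norms_le f M : (forall t, Dom t (f t)) -> abs_sum f M ->
  ubound (max_norms alpha f) M.
Proof. by move=> fD fM _ [B [pi [v [cov ->]]]]; exact: integrated_norm. Qed.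

(** One covariant representation for every value that occurs in the supremum
    suffices to realise the supremum; the crossed product is the closure of the
    image of l^1 in the product of these. *)
Lemma crossed_product_exists : exists (D : banachAlgType K) (q : (S -> A) -> D),
  is_crossed_product alpha q.
Proof.
pose I := {p : (S -> A) * K | max_norms alpha p.1 p.2}.
have repP (i : I) : exists Bpv : {B : banachAlgType K &
    ((A -> B) * (S -> bidual B))%type},
    covariant_rep alpha (projT2 Bpv).1 (projT2 Bpv).2 /\
    (projT1 i).2 = `|integrated (projT2 Bpv).1 (projT2 Bpv).2 (projT1 i).1|.
  case: i => p [B [pi [v [cov pE]]]]; by exists (existT _ B (pi, v)).
have [rep {}repP] := choice repP.
pose B i : banachAlgType K := projT1 (rep i).
pose int f i : B i := integrated (projT2 (rep i)).1 (projT2 (rep i)).2 f.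
have cov i := (repP i).1.
pose V i : completeNormedModType K := B i.
pose w (i : I) : K := 1.
pose bound := section_bound (V := V) w.
pose mem (x : forall i, V i) := forall e, 0 < e ->
  exists2 f, l1 alpha f & bound (fun i => x i - int f i) e.
have int_bound f : l1 alpha f -> exists M, bound (int f) M.
  move=> fl; have [M fM] := l1_abs_sum fl; have [fD _] := fl.
  exists M; split=> [|i]; first by rewrite (le_trans _ (fM fset0)) // big_seq_fset0.
  rewrite mulr1; exact: (integrated_norm (cov i)).
have int_lin k f g i : l1 alpha f -> l1 alpha g ->
    int (k *: f + g) i = k *: int f i + int g i.
  move=> fl gl; exact: (integrated_lin (cov i) k fl gl).
have mem_int f : l1 alpha f -> mem (int f).
  move=> fl e e0; exists f => //; split; first exact: ltW.
  by move=> i; rewrite subrr normr0 mulr1 ltW.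
have mem_bound x : mem x -> exists c, bound x c.
  move=> /(_ _ ltr01)[f fl [_ xf]]; have [M [M0 fM]] := int_bound _ fl.
  exists (1 + M); split=> [|i]; first by rewrite addr_ge0.
  by rewrite -[x i](subrK (int f i)) mulrDl (le_trans (ler_normD _ _)) // lerD.
have bound_close (x y z : forall i, V i) e : 0 < e ->
    bound (fun i => x i - y i) (e / 2) -> bound (fun i => y i - z i) (e / 2) ->
    bound (fun i => x i - z i) e.
  move=> e0 [_ xy] [_ yz]; split=> [|i]; first exact: ltW.
  rewrite -(subrK (y i) (x i)) -addrA (splitr e) mulrDl.
  by rewrite (le_trans (ler_normD _ _)) // lerD.
have [d [dM dmul dw]] : exists d : section_algebra V,
    [/\ sa_mem d = mem, sa_mul d = (fun x y i => (x i : B i) *b (y i : B i))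
      & sa_weight d = w].
  unshelve eexists (@SectionAlgebra K I V w mem
    (fun x y i => (x i : B i) *b (y i : B i)) lubs _ _ _ _ _ _ _ _ _ _) => //.
  - move=> e e0; exists (fun=> 0); first exact: l1_0.
    split=> [|i]; first exact: ltW.
    have : `|int (fun=> 0) i| <= 0.
      apply: (integrated_norm (cov i)) => [t|J]; first exact: dom0.
      by rewrite big1 // => t _; rewrite normr0.
    by rewrite normr_le0 => /eqP->; rewrite subrr normr0 mulr1 ltW.
  - move=> k x y xM yM e e0; have [e2 _] := half_lt e0.
    have k0 : 0 < `|k| + 1 by rewrite ltr_wpDl.
    have [f fl [_ xf]] := xM _ (divr_gt0 e2 k0); have [g gl [_ yg]] := yM _ e2.
    exists (k *: f + g); first exact: l1_linP.
    split=> [|i]; first exact: ltW.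
    rewrite int_lin // opprD addrACA -scalerBr mulr1 (splitr e).
    have := xf i; have := yg i; rewrite !mulr1 => ygi xfi.
    rewrite (le_trans (ler_normD _ _)) // lerD // normrZ.
    rewrite (le_trans (ler_wpM2l (normr_ge0 _) xfi)) // mulrCA ler_piMr ?ltW //.
    by rewrite ltr_pdivrMr // mul1r ltrDl.
  - move=> x xM e e0; have [e2 _] := half_lt e0.
    have [y yM xy] := xM _ e2; have [f fl yf] := yM _ e2.
    by exists f => //; exact: bound_close xy yf.
  - move=> x y xM yM e e0.
    have [c [c0 xc]] := mem_bound _ xM; have [c' [c'0 yc]] := mem_bound _ yM.
    have M0 : 0 < c + c' + 1 by rewrite ltr_wpDl // addr_ge0.
    have d0 : 0 < e / (c + c' + 1 + e) by rewrite divr_gt0 // addr_gt0.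
    have [f fl [_ xf]] := xM _ d0; have [g gl [_ yg]] := yM _ d0.
    exists (conv alpha f g); first exact: conv_l1.
    split=> [|i]; first exact: ltW.
    have -> : int (conv alpha f g) i = int f i *b int g i.
      exact: (integrated_conv (cov i) fl gl).
    have := xf i; have := yg i; have := xc i; have := yc i.
    rewrite !mulr1 => yci xci ygi xfi.
    by apply: (bmul_close M0) => //; rewrite !lerD.
  - by move=> x y z _ _ _; apply: functional_extensionality_dep => i; rewrite bmulA.
  - move=> k x y z _ _ _; apply: functional_extensionality_dep => i.
    by rewrite bmulDl bmulZl.
  - move=> k x y z _ _ _; apply: functional_extensionality_dep => i.
    by rewrite bmulDr bmulZr.
  - move=> x y c c' _ _ [c0 xc] [c'0 yc]; split=> [|i]; first exact: mulr_ge0.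
    have := xc i; have := yc i; rewrite !mulr1 => yci xci.
    by rewrite (le_trans (bmul_norm _ _)) // ler_pM.
pose D : banachAlgType K := bsection d.
pose q f : D := xget (0 : D) [set x : D | forall i, (x : bsection d) i = int f i].
have qE f i : l1 alpha f -> (q f : bsection d) i = int f i.
  move=> fl; rewrite /q; case: xgetP => [x _ //|/=].
  have fM : sa_mem d (int f) by rewrite dM; exact: mem_int.
  by move=> /(_ (BSection fM)); case.
exists D, q; split.
- move=> k f g fl gl; apply: bsectionP => i; rewrite bsectionD bsectionZ !qE //.
    exact: int_lin.
  exact: l1_linP.
- move=> f g fl gl; apply: bsectionP => i; rewrite qE; last exact: conv_l1.
  rewrite /= dmul !qE //; exact: (integrated_conv (cov i) fl gl).
- move=> f fl; split.
    move=> r fr; pose i : I := exist _ (f, r) fr.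
    have -> : r = `|int f i| by have [_] := repP i.
    have [_ /(_ i)] := (iffLR (bsection_normP (q f : bsection d) _)) (lexx _).
    by rewrite dw mulr1 qE.
  move=> m fm; have m0 := max_norms_ub_ge0 fm.
  apply/bsection_normP; split=> // i; rewrite dw mulr1 qE //; apply: fm.
  by exists (B i), (projT2 (rep i)).1, (projT2 (rep i)).2; split=> //; exact: cov.
- apply/seteqP; split=> // x _; apply/closureE => e e0.
  have := bvalP (x : bsection d); rewrite dM => /(_ _ e0)[f fl xf].
  exists (q f); first by exists f.
  apply/bsection_normP; case: xf => _ xf; split=> [|i]; first exact: ltW.
  by rewrite bsectionB qE // dw.
Qed.

End integrated_form.

(** * The universal covariant representation *)

Section representations.
Context {K : numFieldType}.
Implicit Types A B C : banachAlgType K.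

Lemma rep_linear A B (f : A -> B) : representation f -> linear f.
Proof. by case. Qed.

Lemma rep_mul A B (f : A -> B) x y : representation f -> f (x *b y) = f x *b f y.
Proof. by case. Qed.

Lemma rep_norm A B (f : A -> B) : representation f -> opnorm_le f 1.
Proof. by case=> _ _ fn; split=> // x; rewrite mul1r. Qed.

Lemma rep_comp A B C (f : A -> B) (g : B -> C) :
  representation f -> representation g -> representation (g \o f).
Proof.
move=> [fl fm fn] [gl gm gn]; split=> [k x y|x y|x] /=.
- by rewrite fl gl.
- by rewrite fm gm.
- exact: le_trans (gn _) (fn _).
Qed.

Lemma rep_id A : representation (@id A).
Proof. by split. Qed.

Lemma rep_eq A B (X : set A) (f g : A -> B) : closure (lspan X) = setT ->
  representation f -> representation g -> (forall x, X x -> f x = g x) -> f = g.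
Proof.
move=> XT fr gr; apply: (dense_linear_eq XT (rep_linear fr) (rep_linear gr)
  (rep_norm fr) (rep_norm gr)).
Qed.

(** Multiplicativity extends to closed spans in one variable at a time. *)
Lemma rep_of_dense A B (X : set A) (f : A -> B) : closure (lspan X) = setT ->
  linear f -> (forall a, `|f a| <= `|a|) ->
  (forall a b, X a -> X b -> f (a *b b) = f a *b f b) -> representation f.
Proof.
move=> XT fl fn fX; split=> //.
have extl a : (forall b, X b -> f (a *b b) = f a *b f b) ->
    forall b, f (a *b b) = f a *b f b.
  move=> ab b; have := @dense_linear_eq _ _ _ X (fun b => f (a *b b))
    (fun b => f a *b f b) `|a| `|a| XT.
  move=> H; apply: (congr1 (fun h => h b) (H _ _ _ _ ab)) => {H}.
  - by move=> k x y; rewrite bmulDr bmulZr fl.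
  - by move=> k x y; rewrite fl bmulDr bmulZr.
  - by split=> // x; rewrite (le_trans (fn _)) // bmul_norm.
  - by split=> // x; rewrite (le_trans (bmul_norm _ _)) // ler_pM.
move=> a b; apply: extl => {}b Xb.
have := @dense_linear_eq _ _ _ X (fun a => f (a *b b))
  (fun a => f a *b f b) `|b| `|b| XT.
move=> H; have {}H := H _ _ _ _ (fun a' Xa' => fX a' b Xa' Xb).
apply: (congr1 (fun h => h a) (H _ _ _ _)) => {H}.
- by move=> k x y; rewrite bmulDl bmulZl fl.
- by move=> k x y; rewrite fl bmulDl bmulZl.
- by split=> // x; rewrite (le_trans (fn _)) // mulrC bmul_norm.
- by split=> // x; rewrite (le_trans (bmul_norm _ _)) // mulrC ler_pM.
Qed.

End representations.

Section crossed_product.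
Context {R : realType} {K : numFieldType} (hK : real_or_complex R K).
Context {S : invSemigroupType} {A : banachAlgType K} (alpha : action S A).
Context {D : banachAlgType K} (q : (S -> A) -> D).
Hypothesis qP : is_crossed_product alpha q.
Implicit Types (s t e : S) (a b : A) (f g : S -> A).
Local Notation Dom := (dom alpha).

Let lubs : real_lubs K := real_or_complex_lubs hK.

Definition point_mass a t : S -> A := fun s => if s == t then a else 0.

Lemma point_massE a t : point_mass a t t = a.
Proof. by rewrite /point_mass eqxx. Qed.

Lemma point_mass_dom a t s : Dom t a -> Dom s (point_mass a t s).
Proof. by rewrite /point_mass; case: eqP => [->//|_ _]; exact: dom0. Qed.

Lemma point_mass_abs_sum a t : abs_sum (point_mass a t) `|a|.
Proof.
move=> J; rewrite (_ : \sum_(s <- J) _ = if t \in J then `|a| else 0).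
  by case: ifP.
rewrite -(fset_sum_fiber id (fun _ : S => `|a|)); apply: eq_bigr => s _.
by rewrite /point_mass eq_sym; case: eqP => // _; rewrite normr0.
Qed.

Lemma point_mass_l1 a t : Dom t a -> l1 alpha (point_mass a t).
Proof.
move=> ta; apply: (abs_sum_l1 _ (point_mass_abs_sum a t)) => s.
exact: point_mass_dom.
Qed.

Lemma integrated_point_mass (B : banachAlgType K) (pi : A -> B) v a t :
  covariant_rep alpha pi v -> Dom t a ->
  integrated pi v (point_mass a t) = cov_mul pi v a t.
Proof.
move=> cov ta; apply: has_sumE.
have := @has_sum_single K S B (fun s => cov_mul pi v (point_mass a t s) s) t.
rewrite point_massE; apply=> s /negbTE st.
by rewrite /point_mass st (cov_mul0 hK cov).
Qed.

Lemma conv_point_mass a b s t : Dom s a -> Dom t b ->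
  conv alpha (point_mass a s) (point_mass b t) =
  point_mass (twist alpha s a b) (s * t)%g.
Proof.
move=> sa tb; apply/funext => r; apply: has_sumE.
have := @has_sum_single K _ A (fun p : S * S => if (p.1 * p.2)%g == r then
  twist alpha p.1 (point_mass a s p.1) (point_mass b t p.2) else 0) (s, t).
rewrite [X in has_sum _ X]/= /point_mass !eqxx eq_sym; apply=> -[s' t'] /= st.
case: ifP => // _; case: (s' =P s) st => [->|_ _]; last first.
  have := @twist_linl _ _ _ alpha s' (-1) 0 0 (if t' == t then b else 0)
    (dom0 _ _) (dom0 _ _).
  by rewrite scaler0 addr0 scaleN1r addNr.
rewrite xpair_eqE eqxx /= => /negbTE->.
have := @twist_linr _ _ _ alpha s (-1) a 0 0 sa.
by rewrite scaler0 addr0 scaleN1r addNr.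
Qed.

Definition gen a t := q (point_mass a t).

Lemma q_lin k f g : l1 alpha f -> l1 alpha g -> q (k *: f + g) = k *: q f + q g.
Proof. by case: qP => + _ _ _; exact. Qed.

Lemma q_mul f g : l1 alpha f -> l1 alpha g -> q (conv alpha f g) = q f *b q g.
Proof. by case: qP => _ + _ _; exact. Qed.

Lemma q_norm f M : (forall t, Dom t (f t)) -> abs_sum f M -> `|q f| <= M.
Proof.
move=> fD fM; have [_ _ /(_ _ (abs_sum_l1 fD fM))[_ + _]] := qP; apply.
exact: (max_norms_le hK).
Qed.

Lemma integrated_le (B : banachAlgType K) (pi : A -> B) v f :
  covariant_rep alpha pi v -> l1 alpha f -> `|integrated pi v f| <= `|q f|.
Proof.
move=> cov fl; have [_ _ /(_ _ fl)[+ _] _] := qP; apply.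
by exists B, pi, v.
Qed.

Lemma q_le f m : l1 alpha f ->
  (forall (B : banachAlgType K) (pi : A -> B) v, covariant_rep alpha pi v ->
    `|integrated pi v f| <= m) -> `|q f| <= m.
Proof.
move=> fl fm; have [_ _ /(_ _ fl)[_ + _]] := qP; apply.
by move=> _ [B [pi [v [cov ->]]]]; exact: fm.
Qed.

Lemma gen_lin k a b t : Dom t a -> Dom t b ->
  gen (k *: a + b) t = k *: gen a t + gen b t.
Proof.
move=> ta tb; rewrite /gen -q_lin; [|exact: point_mass_l1..].
congr q; apply/funext => s; rewrite !fctE /point_mass.
by case: eqP => // _; rewrite scaler0 addr0.
Qed.

Lemma gen_norm a t : Dom t a -> `|gen a t| <= `|a|.
Proof.
move=> ta; apply: q_norm (point_mass_abs_sum a t) => s; exact: point_mass_dom.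
Qed.

Lemma gen_mul a b s t : Dom s a -> Dom t b ->
  gen a s *b gen b t = gen (twist alpha s a b) (s * t)%g.
Proof.
by move=> sa tb; rewrite /gen -conv_point_mass // q_mul //; exact: point_mass_l1.
Qed.

Lemma gen_cvg (T : Type) (F : set_system T) (x : T -> A) a t : Filter F ->
  F [set i | Dom t (x i)] -> Dom t a -> x i @[i --> F] --> a ->
  gen (x i) t @[i --> F] --> gen a t.
Proof.
move=> FF Fx ta xa; apply/cvgrPdist_lt => e e0.
move/cvgrPdist_lt : xa => /(_ _ e0) xa; apply: filterS2 xa Fx => i ax tx.
rewrite -scaleN1r addrC -gen_lin // (le_lt_trans (gen_norm _)) //.
  by case: (dom_subspace alpha t) => _; apply.
by rewrite scaleN1r addrC.
Qed.

Definition gens : set D := [set gen p.1 p.2 | p in [set p : A * S | Dom p.2 p.1]].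

(** What f leaves outside a finite set J has small l^1-norm, hence small
    seminorm. *)
Lemma q_has_sum f : l1 alpha f -> has_sum (fun t => gen (f t) t) (q f).
Proof.
move=> fl e e0; have [M fM] := l1_abs_sum fl; have [fD _] := fl.
have [J0 J0P] := abs_sum_tail lubs fM e0; exists J0 => J J0J.
pose fJ (J : {fset S}) s := if s \in J then f s else 0.
have fJl J' : l1 alpha (fJ J').
  apply: (@abs_sum_l1 _ _ _ _ _ M) => [s|J1]; rewrite /fJ.
    by case: ifP => // _; exact: dom0.
  apply: le_trans (fM J1); apply: ler_sum => s _.
  by case: ifP => // _; rewrite normr0.
have qJ : \sum_(t <- J) gen (f t) t = q (fJ J).
  have gen0 : q (fun=> 0) = 0.
    have := q_lin (-1) (l1_0 alpha) (l1_0 alpha).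
    by rewrite scaler0 addr0 scaleN1r addNr.
  suff H (r : seq S) : uniq r -> l1 alpha (fun s => if s \in r then f s else 0) /\
      \sum_(t <- r) gen (f t) t = q (fun s => if s \in r then f s else 0).
    by have [] := H J (fset_uniq J).
  elim: r => [_|t r IH /= /andP[tr /IH[rl rE]]].
    by split; [exact: l1_0|rewrite big_nil].
  have E : (fun s => if s \in t :: r then f s else 0) =
      1 *: point_mass (f t) t + (fun s => if s \in r then f s else 0).
    apply/funext => s; rewrite !fctE /point_mass inE scale1r.
    by case: eqP => [->|_]; rewrite ?(negbTE tr) ?addr0 ?add0r.
  rewrite E; split; first by apply: l1_linP => //; exact: point_mass_l1.
  by rewrite q_lin ?scale1r ?big_cons ?rE //; exact: point_mass_l1.
rewrite qJ -scaleN1r addrC -q_lin //; apply: q_norm => [s|J1].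
  by case: (dom_subspace alpha s) => _; apply=> //; case: (fJl J).
rewrite (le_trans _ (J0P [fset s in J1 | s \notin J]%fset _)) //; last first.
  by apply/fdisjointP => s sJ0; rewrite !inE /= (fsubsetP J0J) // andbF.
rewrite (big_fsetID _ [pred s | s \in J]) /= big_seq big1 ?add0r; last first.
  move=> s; rewrite !inE /= => /andP[_ sJ].
  by rewrite !fctE /fJ sJ scaleN1r addNr normr0.
rewrite big_seq [leRHS]big_seq; apply: ler_sum => s; rewrite !inE /= => /andP[_ sJ].
by rewrite !fctE /fJ (negbTE sJ) scaler0 add0r.
Qed.

Lemma gens_dense : closure (lspan gens) = setT.
Proof.
have [_ _ _ qT] := qP; apply/seteqP; split=> // x _.
suff : closure (q @` l1 alpha) `<=` closure (lspan gens) by rewrite qT; exact.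
have spanq : q @` l1 alpha `<=` closure (lspan gens).
  move=> _ [f fl <-]; apply: has_sum_closed (q_has_sum fl).
  - exact: closed_closure.
  - exact: closure_subspace (lspan_subspace _).
  - move=> t; apply: subset_closure; apply: lspan_sub; exists (f t, t) => //=.
    by case: fl.
by move=> y /(closureS spanq); rewrite -(closure_id _).1 //; exact: closed_closure.
Qed.

(** The integrated form is dominated by the seminorm, so it factors through the
    image of q and extends to the completion. *)
Lemma crossed_product_rep (B : banachAlgType K) (pi : A -> B) v :
  covariant_rep alpha pi v -> exists Psi : D -> B, representation Psi /\
    forall a t, Dom t a -> Psi (gen a t) = cov_mul pi v a t.
Proof.
move=> cov; have [_ _ _ qT] := qP.
pose G := [set p : D * B | exists f, l1 alpha f /\ p = (q f, integrated pi v f)].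
have Gmul (x y : D) (a b : B) : G (x, a) -> G (y, b) -> G (x *b y, a *b b).
  move=> [f [fl [-> ->]]] [g [gl [-> ->]]]; exists (conv alpha f g).
  by split; [exact: (conv_l1 hK)|rewrite q_mul // (integrated_conv hK cov)].
have [k x y a b [f [fl [-> ->]]] [g [gl [-> ->]]]|x a [f [fl [-> ->]]]|x e e0|
    Psi [Psil Psin PsiP]] := @dense_extension K D B G 1 ler01.
- exists (k *: f + g); split; first exact: l1_linP.
  by rewrite q_lin // (integrated_lin hK cov).
- by rewrite mul1r; exact: integrated_le.
- have : closure (q @` l1 alpha) x by rewrite qT.
  move=> /closureE/(_ _ e0)[_ [f fl <-] xf].
  by exists (q f), (integrated pi v f); split=> //; exists f.
exists Psi; split; first split=> //.
- move=> x y; apply/PsiP; apply: graph_closure_mul => //; exact/PsiP.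
- by move=> x; case: Psin => _ /(_ x); rewrite mul1r.
move=> a t ta; apply/PsiP; apply: graph_closure_sub.
exists (point_mass a t); split; first exact: point_mass_l1.
by rewrite integrated_point_mass.
Qed.

(** The seminorm of a function f supported on idempotents is at most the norm of
    the sum of its values, since pi(f e) v_e = pi(f e) in every covariant
    representation. *)
Lemma iota_exists : exists iota : A -> D, representation iota /\
  forall e a, idem e -> Dom e a -> iota a = gen a e.
Proof.
pose G := [set p : A * D | exists f, [/\ l1 alpha f,
  forall t, ~ idem t -> f t = 0, has_sum f p.1 & p.2 = q f]].
have G0 : G (0, 0).
  exists (fun=> 0); split=> //=; [exact: l1_0|exact: has_sum0|].
  have := q_lin (-1) (l1_0 alpha) (l1_0 alpha).
  by rewrite scaler0 addr0 scaleN1r addNr.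
have Glin k (x y : A) (a b : D) : G (x, a) -> G (y, b) -> G (k *: x + y, k *: a + b).
  move=> [f [fl fi /= fx ->]] [g [gl gi /= gy ->]]; exists (k *: f + g).
  split=> /=; [exact: l1_linP| |exact: has_sum_lin|by rewrite q_lin].
  by move=> t ti; rewrite !fctE fi // gi // scaler0 addr0.
have Ggen e a : idem e -> Dom e a -> G (a, gen a e).
  move=> ee ea; exists (point_mass a e); split=> //=.
  - exact: point_mass_l1.
  - by move=> t ti; rewrite /point_mass; case: eqP => // te; case: ti; rewrite te.
  - have := @has_sum_single K S A (point_mass a e) e.
    rewrite point_massE; apply=> t.
    by rewrite /point_mass => /negbTE->.
have [//|x a [f [fl fi /= fx ->]]|x e e0|
    iota [iotal iotan iotaP]] := @dense_extension K A D G 1 ler01.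
- rewrite mul1r; apply: q_le => // B pi v cov.
  have -> : integrated pi v f = pi x.
    apply: has_sum_unique (integrated_has_sum hK cov fl) _.
    have := @has_sum_map _ _ _ _ setT pi 1 f x closedT _ _ _ _ fx.
    have -> : pi \o f = fun t => cov_mul pi v (f t) t.
      apply/funext => t /=; have [it|/fi->] := pselect (idem t).
        by rewrite (cov_mul_idem hK cov) //; case: fl.
      by rewrite (cov_mul0 hK cov) (linear_map0 (cov_linear cov)).
    apply=> //; first by move=> k a0 b0 _ _; exact: (cov_linear cov).
    by move=> a0 _; rewrite mul1r; exact: (cov_pi_norm cov).
  exact: (cov_pi_norm cov).
- have : closure (lspan (\bigcup_(e in [set e | idem e]) Dom e)) x.
    by rewrite dom_dense.
  move=> /closureE/(_ _ e0)[y yspan xy]; suff [b Gb] : exists b : D, G (y, b).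
    by exists y, b.
  apply: (lspan_min (Y := [set y | exists b : D, G (y, b)]) _ _ yspan).
    split; first by exists 0.
    by move=> k z z' [b zb] [b' zb']; exists (k *: b + b'); exact: Glin.
  by move=> z [e' ee ez]; exists (gen z e'); exact: Ggen.
have iota_gen e a : idem e -> Dom e a -> iota a = gen a e.
  by move=> ee ea; apply/iotaP; apply: graph_closure_sub; exact: Ggen.
exists iota; split=> //; apply: (rep_of_dense (dom_dense alpha) iotal).
  by move=> a; case: iotan => _ /(_ a); rewrite mul1r.
move=> a b [e ee ea] [e' ee' eb].
rewrite (iota_gen e a) // (iota_gen e' b) // gen_mul // twist_idem //.
apply: iota_gen; first exact: idem_mul.
by rewrite -(twist_idem b ee ea); exact: twist_dom.
Qed.

End crossed_product.

(** * Pushing covariant representations forward *)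

Section push_forward.
Context {R : realType} {K : numFieldType} (hK : real_or_complex R K).
Context {D B : banachAlgType K} (Psi : D -> B).
Hypothesis PsiR : representation Psi.

(** The transpose and the second transpose of Psi. *)
Definition dual_pull (f : dual B) : dual D := mk_dual (f \o Psi).

Definition bidual_push (phi : bidual D) : bidual B :=
  mk_bidual (phi \o dual_pull).

Lemma dual_pull_bound (f : dual B) c : opnorm_le f c -> opnorm_le (f \o Psi) c.
Proof.
move=> [c0 fc]; split=> // x; rewrite (le_trans (fc _)) // ler_wpM2l //.
by case: PsiR.
Qed.

Lemma dual_pullE f : dual_pull f = f \o Psi :> (D -> K^o).
Proof.
have [c fc] := dual_bound f; apply: (mk_dualE _ (dual_pull_bound fc)).
by move=> k x y /=; rewrite (rep_linear PsiR); exact: (dual_linear f).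
Qed.

Lemma bidual_push_bound phi c :
  bidual_le phi c -> bidual_le (V := B) (phi \o dual_pull) c.
Proof.
move=> [c0 phic]; split=> // f d fd; apply: phic.
by rewrite dual_pullE; exact: dual_pull_bound.
Qed.

Lemma bidual_pushE phi : bidual_push phi = phi \o dual_pull :> (dual B -> K^o).
Proof.
have [c phic] := bidual_bound phi; apply: (mk_bidualE _ (bidual_push_bound phic)).
move=> k f g /=; rewrite -(bidual_linear phi); congr (phi _).
by apply: dualE => x; rewrite dual_pullE /= !dual_pullE.
Qed.

Lemma bidual_push_embed x : bidual_push (embed x) = embed (Psi x).
Proof. by apply: bidualE => f; rewrite bidual_pushE /= dual_pullE. Qed.

Lemma bidual_push_arens a b :
  bidual_push (a ** b) = bidual_push a ** bidual_push b.
Proof.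
apply: bidualE => f; rewrite bidual_pushE [LHS]/= arensE bidual_pushE /=.
congr (b _); apply: dualE => y; rewrite dual_pullE /= bidual_pushE /=.
congr (a _); apply: dualE => x; rewrite /= !dual_pullE /=.
by rewrite (rep_mul _ _ PsiR).
Qed.

Context {S : invSemigroupType} {A : banachAlgType K} (alpha : action S A).
Variables (pi : A -> D) (v : S -> bidual D).
Hypothesis cov : covariant_rep alpha pi v.

(** Covariance is a set of identities between Arens products, and the second
    transpose of a representation is multiplicative. *)
Lemma push_covariant : covariant_rep alpha (Psi \o pi) (bidual_push \o v).
Proof.
have [[piR vn] cr1 cr2 cr3] := cov; split.
- by split=> [|t]; [exact: rep_comp|rewrite /= bidual_pushE; exact: bidual_push_bound].
- move=> t a ta /=; have [E [b bE]] := cr1 t a ta.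
  rewrite -!bidual_push_embed -!bidual_push_arens E; split=> //.
  by exists (Psi b); rewrite -E bE bidual_push_embed.
- move=> s t a sta /=; rewrite -!bidual_push_embed -!bidual_push_arens cr2 //.
- by move=> e a ee ea /=; rewrite -!bidual_push_embed -!bidual_push_arens cr3.
Qed.

Lemma push_cov_mul a t : dom alpha t a ->
  cov_mul (Psi \o pi) (bidual_push \o v) a t = Psi (cov_mul pi v a t).
Proof.
move=> ta; apply: (embed_inj hK); rewrite (cov_mulE hK push_covariant) //=.
by rewrite -!bidual_push_embed -bidual_push_arens -(cov_mulE hK cov).
Qed.

Lemma push_normalized mu :
  normalized mu pi v -> normalized mu (Psi \o pi) (bidual_push \o v).
Proof.
move=> nv t f.
have -> : (bidual_push \o v) t f = v t (dual_pull f) by rewrite /= bidual_pushE.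
rewrite (_ : (fun a => _) = (fun a => (embed (pi a) ** v t) (dual_pull f))).
  exact: nv.
apply/funext => a.
have -> : embed ((Psi \o pi) a) ** (bidual_push \o v) t =
    bidual_push (embed (pi a) ** v t).
  by rewrite bidual_push_arens bidual_push_embed.
by rewrite bidual_pushE.
Qed.

End push_forward.

Section normalization.
Context {R : realType} {K : numFieldType} (hK : real_or_complex R K).
Context {S : invSemigroupType} {A B : banachAlgType K} (alpha : action S A).
Context (mu : S -> set_system A) (one : S -> bidual A).
Hypothesis muP : unit_system alpha mu one.
Local Notation Dom := (dom alpha).

Lemma mu_filter t : ProperFilter (mu t).
Proof. by have [[]] := muP t. Qed.

Lemma mu_ball t : mu t [set a | Dom t a /\ `|a| <= 1].
Proof. by have [[]] := muP t. Qed.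

Lemma mu_dom t : mu t (Dom t).
Proof.
by have ? := mu_filter t; apply: filterS (mu_ball t) => a [].
Qed.

Lemma mu_cvgl t a : Dom t a -> m *b a @[m --> mu t] --> a.
Proof. by have [[_ _ /(_ a)]] := muP t => + _ => /[apply] -[]. Qed.

Lemma mu_cvgr t a : Dom t a -> a *b m @[m --> mu t] --> a.
Proof. by have [[_ _ /(_ a)]] := muP t => + _ => /[apply] -[]. Qed.

(** A bounded functional on the ideal I_t extends to A, where the approximate
    unit converges weakly. *)
Lemma mu_functional_cvg t (g : A -> K) c : 0 <= c ->
  (forall k a b, Dom t a -> Dom t b -> g (k *: a + b) = k * g a + g b) ->
  (forall a, Dom t a -> `|g a| <= c * `|a|) ->
  exists l : K^o, (g a : K^o) @[a --> mu t] --> l.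
Proof.
move=> c0 glin gc; have mt := mu_filter t.
have [f [fg fc]] := hahn_banach hK c0 (dom_subspace alpha t) glin gc.
exists (one t f); have [_ /(_ f)] := muP t; apply: cvg_trans.
by apply: near_eq_cvg; apply: filterS (mu_dom t) => a ta /=; rewrite fg.
Qed.

(** On I_e the representation pi is the product with v_e, and the I_e span a
    dense subspace; v_t is the limit of the products pi(m) v_t. *)
Lemma normalized_unique (pi pi' : A -> B) (v v' : S -> bidual B) :
  covariant_rep alpha pi v -> covariant_rep alpha pi' v' ->
  normalized mu pi v -> normalized mu pi' v' ->
  (forall a t, Dom t a -> cov_mul pi v a t = cov_mul pi' v' a t) ->
  (pi, v) = (pi', v').
Proof.
move=> cov cov' nv nv' E; congr (_, _).
  have [[piR _] _ _ _] := cov; have [[piR' _] _ _ _] := cov'.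
  apply: (rep_eq (dom_dense alpha) piR piR') => a [e ee ea].
  by rewrite -(cov_mul_idem hK cov ee) // E // (cov_mul_idem hK cov' ee).
apply/funext => t; have mt := mu_filter t; apply: bidualE => f.
have vE a : Dom t a -> embed (pi' a) ** v' t = embed (pi a) ** v t.
  by move=> ta; rewrite -(cov_mulE hK cov) // -(cov_mulE hK cov') // E.
apply: (normed_cvg_unique mt (nv t f)); apply: cvg_trans (nv' t f).
apply: near_eq_cvg; apply: filterS (mu_dom t) => a ta.
exact: (congr1 (fun p : bidual B => p f) (vE a ta)).
Qed.

End normalization.

(** * The canonical covariant representation in the crossed product *)

Section canonical_representation.
Context {R : realType} {K : numFieldType} (hK : real_or_complex R K).
Context {S : invSemigroupType} {A : banachAlgType K} (alpha : action S A).
Context {D : banachAlgType K} (q : (S -> A) -> D).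
Hypothesis qP : is_crossed_product alpha q.
Context (mu : S -> set_system A) (one : S -> bidual A).
Hypothesis muP : unit_system alpha mu one.
Implicit Types (s t e : S) (a b : A).
Local Notation Dom := (dom alpha).
Local Notation gen := (gen q).

(** The element u_t is the weak-* limit of the generators along the chosen
    approximate unit of I_t at t. *)
Lemma limit_multiplier_exists : exists u : S -> bidual D, forall t,
  bidual_le (u t) 1 /\
  forall f : dual D, (f (gen a t) : K^o) @[a --> mu t] --> (u t f : K^o).
Proof.
suff ut t : exists ut : bidual D, bidual_le ut 1 /\
    forall f : dual D, (f (gen a t) : K^o) @[a --> mu t] --> (ut f : K^o).
  by have [u uP] := choice ut; exists u.
have mt := mu_filter muP t.
have lim_ex (f : dual D) : exists l : K^o, (f (gen a t) : K^o) @[a --> mu t] --> l.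
  have [c [c0 fc]] := dual_bound f.
  apply: (mu_functional_cvg hK muP (c := c)) => // [k a b ta tb|a ta].
    by rewrite (gen_lin qP) //; exact: (dual_linear f).
  by rewrite (le_trans (fc _)) // ler_wpM2l // (gen_norm hK qP).
have [l lP] := choice lim_ex.
have l_le : bidual_le l 1.
  split=> // f d [d0 fd]; rewrite mul1r; apply: (cvg_norm_le mt _ (lP f)).
  apply: filterS (mu_ball muP t) => a [ta a1] /=.
  rewrite (le_trans (fd _)) // ler_piMr // (le_trans _ a1) //.
  exact: (gen_norm hK qP).
have l_lin : linear l.
  move=> k f g; apply: (normed_cvg_unique mt (lP _)).
  have fk : k *: (f (gen a t) : K^o) @[a --> mu t] --> k *: (l f : K^o).
    by apply: cvgZl_tmp; exact: lP.
  exact: (cvgD fk (lP g)).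
by exists (mk_bidual l); rewrite (mk_bidualE l_lin l_le).
Qed.

Variables (iota : A -> D) (u : S -> bidual D).
Hypothesis iotaR : representation iota.
Hypothesis iota_gen : forall e a, idem e -> Dom e a -> iota a = gen a e.
Hypothesis u_le : forall t, bidual_le (u t) 1.
Hypothesis u_cvg : forall t (f : dual D),
  (f (gen a t) : K^o) @[a --> mu t] --> (u t f : K^o).

Lemma iota_mul_gen t a b : Dom t a -> Dom t b ->
  iota a *b gen b t = gen (a *b b) t.
Proof.
move=> ta tb; have tta : Dom (t * star t)%g a by rewrite -dom_mul_star.
rewrite (iota_gen (idem_mul_star t)) // (gen_mul qP) // mul_starK.
by rewrite twist_idem //; exact: idem_mul_star.
Qed.

Lemma gen_mul_iota t a b : Dom t a -> Dom (star t) b ->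
  gen a t *b iota b = gen (a *b act alpha t b) t.
Proof.
move=> ta tb; rewrite (iota_gen (idem_star_mul t)); last exact: dom_mul_idem.
rewrite (gen_mul qP) ?mulgA ?mul_starK ?twist_act //.
exact: dom_mul_idem.
Qed.

Lemma bidual_eq_embed (T : Type) (F : set_system T) (x : T -> D) l
    (phi : bidual D) : ProperFilter F ->
  (forall f : dual D, (f (x i) : K^o) @[i --> F] --> (phi f : K^o)) ->
  x i @[i --> F] --> l -> phi = embed l.
Proof.
move=> FF xphi xl; apply: bidualE => f.
apply: (normed_cvg_unique FF (xphi f)); exact: dual_cvg xl.
Qed.

Lemma gen_near_cvg t (x : A -> D) (y : A -> A) s b : Dom s b ->
  (forall m, Dom t m -> Dom s (y m)) -> (forall m, Dom t m -> x m = gen (y m) s) ->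
  y m @[m --> mu t] --> b -> x m @[m --> mu t] --> gen b s.
Proof.
move=> sb yD xE yb; have mt := mu_filter muP t.
apply: cvg_trans (gen_cvg hK qP _ _ sb yb).
  by apply: near_eq_cvg; apply: filterS (mu_dom muP t) => m tm /=; rewrite xE.
by apply: filterS (mu_dom muP t) => m; exact: yD.
Qed.

(** In this and the next two limits a product of generators absorbs the
    approximate unit. They give the covariance conditions for every kind of limit
    of the generators at t: in the bidual, in a dual Banach algebra and in the
    weak operator topology. *)
Lemma gen_iota_cvg t a : Dom (star t) a ->
  gen m t *b iota a @[m --> mu t] --> gen (act alpha t a) t.
Proof.
move=> ta; have tta := act_dom ta.
apply: (gen_near_cvg (y := fun m => m *b act alpha t a)) => //.
- by move=> m; exact: domMr.
- by move=> m tm; rewrite gen_mul_iota.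
- exact: (mu_cvgl muP).
Qed.

Lemma iota_gen_cvg t a : Dom t a ->
  iota a *b gen m t @[m --> mu t] --> gen a t.
Proof.
move=> ta; apply: (gen_near_cvg (y := fun m => a *b m)) => //.
- by move=> m; exact: domMl.
- by move=> m tm; rewrite iota_mul_gen.
- exact: (mu_cvgr muP).
Qed.

Lemma gen_gen_cvg s t a : Dom (s * t)%g a ->
  gen a s *b gen m t @[m --> mu t] --> gen a (s * t)%g.
Proof.
move=> sta; have mt := mu_filter muP t.
have [sa ta] := (domE alpha s t a).1 sta; have sa' := act_star_dom sa.
apply: (gen_near_cvg (y := fun m => twist alpha s a m)) => //.
- by move=> m; exact: twist_dom.
- by move=> m tm; rewrite (gen_mul qP).
apply/cvgrPdist_lt => e e0.
have /cvgrPdist_lt/(_ _ e0) := mu_cvgr muP ta; apply: filterS => m am.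
rewrite -{1}(act_starK sa) /twist -scaleN1r addrC -act_linear //; last first.
  exact: domMr.
rewrite act_norm; first by rewrite scaleN1r addrC.
by case: (dom_subspace alpha (star s)) => _; apply=> //; exact: domMr.
Qed.

Lemma u_iota t a : Dom (star t) a ->
  u t ** embed (iota a) = embed (gen (act alpha t a) t).
Proof.
move=> ta; have mt := mu_filter muP t.
apply: (@bidual_eq_embed _ (mu t) _ _ _ mt _ (gen_iota_cvg ta)).
by move=> f; exact: (@u_cvg t (dual_mulr f (iota a))).
Qed.

Lemma iota_u t a : Dom t a -> embed (iota a) ** u t = embed (gen a t).
Proof.
move=> ta; have mt := mu_filter muP t.
apply: (@bidual_eq_embed _ (mu t) _ _ _ mt _ (iota_gen_cvg ta)).
by move=> f; exact: (@u_cvg t (arens_inner (embed (iota a)) f)).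
Qed.

Lemma gen_u s t a : Dom (s * t)%g a ->
  embed (gen a s) ** u t = embed (gen a (s * t)%g).
Proof.
move=> sta; have mt := mu_filter muP t.
apply: (@bidual_eq_embed _ (mu t) _ _ _ mt _ (gen_gen_cvg sta)).
by move=> f; exact: (@u_cvg t (arens_inner (embed (gen a s)) f)).
Qed.

Lemma canonical_covariant : covariant_rep alpha iota u.
Proof.
split=> //.
- move=> t a ta; rewrite u_iota // iota_u; last exact: act_dom.
  by split=> //; exists (gen (act alpha t a) t).
- move=> s t a sta; have [sa _] := (domE alpha s t a).1 sta.
  by rewrite !iota_u // gen_u.
- by move=> e a ee ea; rewrite iota_u // -iota_gen.
Qed.

Lemma canonical_cov_mul t a : Dom t a -> cov_mul iota u a t = gen a t.
Proof.
by move=> ta; apply: (embed_inj hK); rewrite (cov_mulE hK canonical_covariant) // iota_u.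
Qed.

Lemma canonical_normalized : normalized mu iota u.
Proof.
move=> t f; have mt := mu_filter muP t; apply: cvg_trans (@u_cvg t f).
apply: near_eq_cvg; apply: filterS (mu_dom muP t) => a ta.
exact/esym/(congr1 (fun p : bidual D => p f) (iota_u ta)).
Qed.

Lemma cov_range_gens (C : banachAlgType K) (pi : A -> C) (v : S -> bidual C)
    (g : A -> S -> C) : (forall t a, Dom t a -> cov_mul pi v a t = g a t) ->
  cov_range alpha pi v =
  closure (lspan [set g p.1 p.2 | p in [set p : A * S | Dom p.2 p.1]]).
Proof.
move=> E; rewrite /cov_range; congr (closure (lspan _)).
apply/seteqP; split=> _ [[a t] /= ta <-]; exists (a, t) => //=; by rewrite E.
Qed.

Lemma canonical_range : cov_range alpha iota u = setT.
Proof. by rewrite (cov_range_gens canonical_cov_mul) (gens_dense hK qP). Qed.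

Lemma canonical_universal : universal_cov alpha iota u.
Proof.
move=> B pi v cov; have [Psi [PsiR PsiE]] := crossed_product_rep hK qP cov.
exists Psi; split.
  by split=> // a t ta; rewrite canonical_cov_mul // PsiE.
move=> Psi' [PsiR' PsiE']; apply: (rep_eq canonical_range) => // _ [[a t] /= ta <-].
by rewrite PsiE' // canonical_cov_mul // PsiE.
Qed.

(** The representations that the two universal properties provide are inverse
    to each other and contractive, hence isometric. *)
Lemma canonical_unique (C : banachAlgType K) (iota' : A -> C) (u' : S -> bidual C) :
  covariant_rep alpha iota' u' -> cov_range alpha iota' u' = setT ->
  universal_cov alpha iota' u' ->
  exists Phi : C -> D, isometric_isomorphism Phi /\
    forall a t, Dom t a -> Phi (cov_mul iota' u' a t) = cov_mul iota u a t.
Proof.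
move=> cov' range' univ'.
have [Phi [[PhiR PhiE] _]] := univ' _ _ _ canonical_covariant.
have [Theta [[ThetaR ThetaE] _]] := canonical_universal cov'.
have ThetaPhi : Theta \o Phi = id.
  apply: (rep_eq range' (rep_comp PhiR ThetaR) (rep_id C)) => _ [[a t] /= ta <-].
  by rewrite PhiE // ThetaE.
have PhiTheta : Phi \o Theta = id.
  apply: (rep_eq canonical_range (rep_comp ThetaR PhiR) (rep_id D)).
  by move=> _ [[a t] /= ta <-]; rewrite ThetaE // PhiE.
exists Phi; split=> //; case: (PhiR) => Phil Phim Phin; split=> //.
  exists Theta => x; first exact: (congr1 (fun h => h x) ThetaPhi).
  exact: (congr1 (fun h => h x) PhiTheta).
move=> x; apply/eqP; rewrite eq_le Phin /=.
have {1}-> : x = Theta (Phi x) by exact/esym/(congr1 (fun h => h x) ThetaPhi).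
by case: ThetaR.
Qed.

Lemma normalized_correspondence (B : banachAlgType K) :
  one_to_one (fun Psi : D -> B => representation Psi)
    (fun pv : (A -> B) * (S -> bidual B) =>
       covariant_rep alpha pv.1 pv.2 /\ normalized mu pv.1 pv.2)
    (fun Psi pv => forall a t, Dom t a ->
       Psi (cov_mul iota u a t) = cov_mul pv.1 pv.2 a t).
Proof.
split=> [Psi PsiR|[pi v] /= [cov _]]; last exact: canonical_universal.
have cov := push_covariant PsiR canonical_covariant.
have nv := push_normalized PsiR canonical_normalized.
have E a t : Dom t a -> Psi (cov_mul iota u a t) =
    cov_mul (Psi \o iota) (bidual_push Psi \o u) a t.
  by move=> ta; rewrite (push_cov_mul hK PsiR canonical_covariant).
exists (Psi \o iota, bidual_push Psi \o u); split=> // -[pi v] /= [[cov' nv'] E'].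
by apply: (normalized_unique hK muP) => // a t ta; rewrite -E // E'.
Qed.

End canonical_representation.

(** * Representations in dual Banach algebras *)

(** If X fails in F then F has a proper refinement that contains the complement
    of X. *)
Lemma ultra_limit (T : Type) (F : set_system T) (X : set T) :
  ProperFilter F ->
  (forall G, UltraFilter G -> F `<=` G -> G X) -> F X.
Proof.
move=> FF FX; apply: contrapT => nX.
have wF : ProperFilter (within (~` X) F).
  split; last exact: within_filter.
  move=> F0; apply: nX; apply: (@filterS _ F _ [set x | (~` X) x -> set0 x]) F0.
  by move=> x /= nnX; apply: contrapT => /nnX.
have [G [GU wG]] := ultraFilterLemma wF; have GF := @ultra_proper _ _ GU.
have GX : G X.
  by apply: FX => // Y FY; apply: wG; apply: filterS FY => x.
have GnX : G (~` X) by apply: wG; exact: withinT.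
by have [x [Xx nXx]] := filter_ex (filterI GX GnX).
Qed.

Section dual_banach_algebras.
Context {R : realType} {K : numFieldType} (hK : real_or_complex R K).
Context {B : banachAlgType K} {P : completeNormedModType K} (j : B -> dual P).
Hypothesis jP : dual_banach_algebra j.
Local Notation pcvg := (predual_cvg j).

Lemma predual_linear : linear j.
Proof. by case: jP. Qed.

Lemma predual_bound b : opnorm_le (j b) `|b|.
Proof. by have [_ _ jn _] := jP; exact/jn. Qed.

Lemma predual_inj b b' : (forall p, j b p = j b' p) -> b = b'.
Proof. by move=> bb'; have [_ /bij_inj ji _ _] := jP; apply/ji/dualE. Qed.

Lemma predual_surj (f : dual P) : exists b, j b = f.
Proof. by have [_ [g _ gK] _ _] := jP; exists (g f); exact: gK. Qed.

Lemma predual_cvg_unique (T : Type) (F : set_system T) (x : T -> B) b b' :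
  ProperFilter F -> pcvg x F b -> pcvg x F b' -> b = b'.
Proof.
move=> FF xb xb'; apply: predual_inj => p.
exact: (normed_cvg_unique FF (@xb p) (@xb' p)).
Qed.

Lemma predual_cvg_eq (T : Type) (F : set_system T) (x y : T -> B) b :
  Filter F -> F [set t | x t = y t] -> pcvg x F b -> pcvg y F b.
Proof.
move=> FF xy xb p; apply: cvg_trans (@xb p); apply: near_eq_cvg.
by apply: filterS xy => t /= ->.
Qed.

Lemma predual_cvg_norm (T : Type) (F : set_system T) (x : T -> B) b :
  Filter F -> x t @[t --> F] --> b -> pcvg x F b.
Proof.
move=> FF xb p; apply: (cvg_bounded_linear (f := fun b => j b p : K^o) (c := `|p|)) xb.
  by move=> k y z; rewrite predual_linear.
by split=> // y; rewrite mulrC; case: (predual_bound y) => _; exact.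
Qed.

Lemma predual_cvg_mul (T : Type) (F : set_system T) (x : T -> B) b c :
  ProperFilter F -> pcvg x F b ->
  pcvg (fun t => x t *b c) F (b *b c) /\ pcvg (fun t => c *b x t) F (c *b b).
Proof.
move=> FF xb; have [_ _ _ jm] := jP.
by apply: (jm (x @ F)) => //; exact: fmap_proper_filter.
Qed.

Lemma predual_cvg_le (T : Type) (F : set_system T) (x : T -> B) b c :
  ProperFilter F -> 0 <= c -> F [set t | `|x t| <= c] -> pcvg x F b -> `|b| <= c.
Proof.
move=> FF c0 xc xb; have [_ _ jn _] := jP; apply/jn; split=> // p.
apply: (cvg_norm_le FF _ (@xb p)); apply: filterS xc => t /= xtc.
by have [_ /(_ p)/le_trans] := predual_bound (x t); apply; rewrite ler_wpM2r.
Qed.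

(** Banach-Alaoglu: along an ultrafilter all the scalars j (x t) p converge, and
    their limits define an element of the dual of P, that is, of B. *)
Lemma predual_ultra_cvg (T : Type) (G : set_system T) (x : T -> B) c :
  UltraFilter G -> G [set t | `|x t| <= c] -> exists b, pcvg x G b.
Proof.
move=> GU xc; have GF := @ultra_proper _ _ GU.
have [t0 /= t0c] := filter_ex xc; have c0 := le_trans (normr_ge0 _) t0c.
have lim_ex p : exists l : K^o, j (x t) p @[t --> G] --> l /\ `|l| <= c * `|p|.
  have [|l xl lc] := @scalar_ultra_cvg R K T G (fun t => j (x t) p) (c * `|p|) hK GU.
    apply: filterS xc => t /= xtc.
    by have [_ /(_ p)/le_trans] := predual_bound (x t); apply; rewrite ler_wpM2r.
  by exists l.
have [l lP] := choice lim_ex.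
have l_lin : linear l.
  move=> k p p'; apply: (normed_cvg_unique GF (lP _).1).
  have kp : k *: (j (x t) p : K^o) @[t --> G] --> k *: (l p : K^o).
    by apply: cvgZl_tmp; exact: (lP p).1.
  rewrite (_ : (fun t => _) = (fun t => k *: (j (x t) p : K^o) + (j (x t) p' : K^o))).
    exact: (cvgD kp (lP p').1).
  by apply/funext => t; rewrite (dual_linear (j (x t))).
have [b bE] := predual_surj (mk_dual l).
exists b => p; have lE := mk_dualE l_lin (conj c0 (fun p => (lP p).2)).
by rewrite bE lE; exact: (lP p).1.
Qed.

Section approximate_units.
Context {A : banachAlgType K} (pi : A -> B).
Hypothesis piR : representation pi.
Variable I : set A.

Lemma approx_unit_proper F : approx_unit I F -> ProperFilter F.
Proof. by case. Qed.

Lemma approx_unit_mem F : approx_unit I F -> F I.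
Proof. by case=> FF Fb _; apply: filterS Fb => a []. Qed.

Lemma approx_unit_limit F e a : approx_unit I F -> pcvg pi F e -> I a ->
  e *b pi a = pi a /\ pi a *b e = pi a.
Proof.
move=> FI Fe Ia; have FF := approx_unit_proper FI; have [_ _ /(_ _ Ia)[al ar]] := FI.
have [l r] := predual_cvg_mul (pi a) FF Fe.
have cv (y : A -> A) : y m @[m --> F] --> a -> pcvg (fun m => pi (y m)) F (pi a).
  move=> ya; apply: predual_cvg_norm.
  exact: (cvg_bounded_linear _ (rep_linear piR) (rep_norm piR) ya).
split; apply: (predual_cvg_unique FF).
- exact: l.
- apply: predual_cvg_eq (cv _ al); apply: filterE => m /=.
  by rewrite (rep_mul _ _ piR).
- exact: r.
- apply: predual_cvg_eq (cv _ ar); apply: filterE => m /=.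
  by rewrite (rep_mul _ _ piR).
Qed.

(** Each of two limits of approximate units is a unit for the other one. *)
Lemma approx_unit_limit_unique F F' e e' : approx_unit I F -> approx_unit I F' ->
  pcvg pi F e -> pcvg pi F' e' -> e = e'.
Proof.
move=> FI F'I Fe F'e'.
have FF := approx_unit_proper FI; have FF' := approx_unit_proper F'I.
have [l _] := predual_cvg_mul e' FF Fe; have [_ r] := predual_cvg_mul e FF' F'e'.
have -> : e = e *b e'.
  apply: (predual_cvg_unique FF Fe); apply: predual_cvg_eq l.
  apply: filterS (approx_unit_mem FI) => m Im /=.
  by have [_ ->] := approx_unit_limit F'I F'e' Im.
apply: (predual_cvg_unique FF' r); apply: predual_cvg_eq F'e'.
apply: filterS (approx_unit_mem F'I) => m Im /=.
by have [-> _] := approx_unit_limit FI Fe Im.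
Qed.

(** By compactness every approximate unit has limits along ultrafilters, all of
    which are the same. *)
Lemma approx_unit_limit_all F F' e : approx_unit I F -> approx_unit I F' ->
  pcvg pi F e -> pcvg pi F' e.
Proof.
move=> FI [FF' Fb' Fau'] Fe p X Xp; apply: (@ultra_limit _ F') => G GU FG.
have GF := @ultra_proper _ _ GU.
have GI : approx_unit I G.
  split=> //; first exact: FG.
  by move=> a /Fau'[al ar]; split; [move: al|move: ar]; apply: cvg_trans => U;
    exact: FG.
have [|e' Ge'] := @predual_ultra_cvg _ G pi 1 GU.
  apply: FG; apply: filterS Fb' => a [_ a1] /=; rewrite (le_trans _ a1) //.
  by case: piR.
by rewrite (approx_unit_limit_unique FI GI Fe Ge') in Xp; exact: (Ge' p).
Qed.

Lemma multiplier_extE F e m : approx_unit I F -> bidual_cvg embed F m ->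
  pcvg pi F e -> multiplier_ext j I pi m = e.
Proof.
move=> FI mF Fe; have [_ mI _] := approx_unit_multiplier FI mF.
have nearI F' : approx_unit I F' ->
    F' [set a | pi a = pi (embed_inv (m ** embed a))].
  move=> F'I; have FF' := approx_unit_proper F'I.
  apply: filterS (approx_unit_mem F'I) => a Ia /=.
  by have [-> _] := mI a Ia; rewrite (embedK hK).
rewrite /multiplier_ext; case: xgetP => [b _ /(_ F FI) Fb|].
  have FF := approx_unit_proper FI; apply: (predual_cvg_unique FF) Fe.
  apply: predual_cvg_eq Fb; apply: filterS (nearI F FI) => a; exact: esym.
move=> /(_ e) []; move=> F' F'I; have FF' := approx_unit_proper F'I.
exact: predual_cvg_eq (nearI F' F'I) (approx_unit_limit_all FI F'I Fe).
Qed.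

End approximate_units.

(** Restricted to the functionals on B that come from P, an element of the
    bidual of B is a functional on P, hence an element of B. *)
Lemma predual_proj_exists (phi : bidual B) :
  exists b, forall p, j b p = phi (mk_dual (fun b => j b p)).
Proof.
have evP p : linear (fun b => j b p : K^o) /\ opnorm_le (fun b => j b p : K^o) `|p|.
  split; first by move=> k y z; rewrite predual_linear.
  by split=> // y; rewrite mulrC; case: (predual_bound y) => _; exact.
have evE p : mk_dual (fun b => j b p : K^o) = (fun b => j b p : K^o) :> (B -> K^o).
  by have [l n] := evP p; exact: mk_dualE l n.
have [c [c0 phic]] := bidual_bound phi.
pose f p := phi (mk_dual (fun b => j b p : K^o)).
have f_lin : linear f.
  move=> k p p'; rewrite /f -(bidual_linear phi); congr (phi _).
  by apply: dualE => b; rewrite evE (dual_linear (j b)) /= !evE.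
have f_bound : opnorm_le f c.
  split=> // p; apply: phic; rewrite evE; exact: (evP p).2.
have [b bE] := predual_surj (mk_dual f).
by exists b => p; rewrite bE (mk_dualE f_lin f_bound).
Qed.

Lemma bidual_predual_cvg (T : Type) (F : set_system T) (x : T -> B) phi :
  bidual_cvg (fun t => embed (x t)) F phi -> exists b, pcvg x F b.
Proof.
move=> xphi; have [b bE] := predual_proj_exists phi; exists b => p.
rewrite bE; have := xphi (mk_dual (fun b => j b p : K^o)).
rewrite /= (mk_dualE (c := `|p|)) //.
  by move=> k y z; rewrite predual_linear.
by split=> // y; rewrite mulrC; case: (predual_bound y) => _; exact.
Qed.

Context {S : invSemigroupType} {A : banachAlgType K} (alpha : action S A).
Context (mu : S -> set_system A) (one : S -> bidual A).
Hypothesis muP : unit_system alpha mu one.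
Implicit Types (s t e : S) (a b : A).
Local Notation Dom := (dom alpha).

Lemma mu_limit_exists (pi : A -> B) t : representation pi ->
  exists l : B, pcvg pi (mu t) l.
Proof.
move=> piR; apply: (@bidual_predual_cvg _ _ _ (bidual_push pi (one t))) => f.
rewrite (bidual_pushE piR) /=; have [_ /(_ (dual_pull pi f))] := muP t.
by rewrite /= (dual_pullE piR).
Qed.

Section normalized_to_description.
Variables (pi : A -> B) (v : S -> B).
Hypothesis piR : representation pi.
Hypothesis cr1 : forall t a, Dom (star t) a -> v t *b pi a = pi (act alpha t a) *b v t.
Hypothesis cr2 : forall s t a, Dom (s * t)%g a ->
  pi a *b v s *b v t = pi a *b v (s * t)%g.
Hypothesis cr3 : forall e a, idem e -> Dom e a -> pi a *b v e = pi a.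
Hypothesis nv : dual_normalized j mu pi v.

Lemma normalized_idem e l : idem e -> pcvg pi (mu e) l -> v e = l.
Proof.
move=> ee el; have me := mu_filter muP e.
apply: (predual_cvg_unique me) el; apply: predual_cvg_eq (@nv e).
by apply: filterS (mu_dom muP e) => a ea /=; rewrite cr3.
Qed.

(** Let l be the unit for I_st. Then l v_s v_t = v_st by [cr2] and
    normalization. Both factors being normalized, v_s v_t is an iterated weak-*
    limit of elements of pi(I_st) B, on which l acts as the identity. *)
Lemma normalized_hom s t : v (s * t)%g = v s *b v t.
Proof.
have ms := mu_filter muP s; have mt := mu_filter muP t.
have mst := mu_filter muP (s * t)%g.
have [l lP] := mu_limit_exists (s * t)%g piR.
have lI c : Dom (s * t)%g c -> l *b pi c = pi c.
  move=> stc; have [stI _] := muP (s * t)%g.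
  by have [] := approx_unit_limit piR stI lP stc.
have -> : v (s * t)%g = l *b (v s *b v t).
  apply: (predual_cvg_unique mst (@nv _)).
  have [+ _] := predual_cvg_mul (v s *b v t) mst lP.
  apply: predual_cvg_eq; apply: filterS (mu_dom muP (s * t)%g) => c stc /=.
  by rewrite bmulA cr2.
have fixes (T : Type) (F : set_system T) (x : T -> B) (b : B) : ProperFilter F ->
    F [set i | l *b x i = x i] -> pcvg x F b -> l *b b = b.
  move=> FF Fx xb; apply: (predual_cvg_unique FF _ xb).
  by have [_] := predual_cvg_mul l FF xb; exact: predual_cvg_eq.
have [+ _] := predual_cvg_mul (v t) ms (@nv s).
apply: (fixes _ _ _ _ ms); apply: filterS (mu_dom muP s) => n sn /=.
have sn' := act_star_dom sn; rewrite -{1 2}(act_starK sn) -cr1 //.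
have [_] := predual_cvg_mul (v s *b pi (act alpha (star s) n)) mt (@nv t).
apply: (fixes _ _ _ _ mt); apply: filterS (mu_dom muP t) => m tm /=.
have -> : v s *b pi (act alpha (star s) n) *b (pi m *b v t) =
    pi (twist alpha s n m) *b (v s *b v t).
  rewrite bmulA -[v s *b _ *b _]bmulA -(rep_mul _ _ piR) cr1 -?bmulA //.
  exact: domMr.
by rewrite bmulA lI //; exact: twist_dom.
Qed.

End normalized_to_description.

(** From left to right, v_e is the limit of pi(m) v_e = pi(m), that is, the unit
    for I_e, and the products v_t pi(a) v_(star t) are computed from
    multiplicativity of v. Conversely, v_e being the unit for I_e, the covariance
    condition follows by multiplying v_t pi(a) v_(star t) = pi(alpha_t(a)) by v_t
    on the right. *)
Lemma dual_description (pi : A -> B) (v : S -> B) :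
  (covariant_rep alpha pi (fun t => embed (v t)) /\ dual_normalized j mu pi v) <->
  dual_cov_description j alpha one pi v.
Proof.
split=> [[[[piR vn] cr1' cr2' cr3'] nv]|[piR [vn vM] cr vE]].
  have cr1 t a : Dom (star t) a -> v t *b pi a = pi (act alpha t a) *b v t.
    by move=> /cr1'[+ _]; rewrite !arens_embed => /(embed_inj hK).
  have cr2 s t a : Dom (s * t)%g a -> pi a *b v s *b v t = pi a *b v (s * t)%g.
    by move=> /cr2'; rewrite !arens_embed => /(embed_inj hK).
  have cr3 e a : idem e -> Dom e a -> pi a *b v e = pi a.
    by move=> ee /(cr3' _ _ ee); rewrite arens_embed => /(embed_inj hK).
  split=> //.
  - split=> [t|s t]; first exact: (embed_le hK).
    exact: (normalized_hom piR cr1 cr2 nv).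
  - move=> t a ta; rewrite cr1 // cr2; last by rewrite -dom_mul_star; exact: act_dom.
    rewrite cr3 //; first exact: idem_mul_star.
    by rewrite -dom_mul_star; exact: act_dom.
  - move=> e ee; have [l lP] := mu_limit_exists e piR; have [eI e1] := muP e.
    by rewrite (multiplier_extE piR eI e1 lP) (normalized_idem cr3 nv ee lP).
have vlim e : idem e -> pcvg pi (mu e) (v e).
  move=> ee; have [l lP] := mu_limit_exists e piR; have [eI e1] := muP e.
  by rewrite vE // (multiplier_extE piR eI e1 lP).
have piv e a : idem e -> Dom e a -> pi a *b v e = pi a.
  move=> ee ea; have [eI _] := muP e.
  by have [] := approx_unit_limit piR eI (vlim e ee) ea.
split.
  split.
  - by split=> // t; exact: bidual_le_embed.
  - move=> t a ta; rewrite !arens_embed; split; last by exists (v t *b pi a).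
    rewrite -cr // -!bmulA -vM piv //; first exact: idem_star_mul.
    by rewrite -dom_star.
  - by move=> s t a _; rewrite !arens_embed -bmulA vM.
  - by move=> e a ee ea; rewrite arens_embed piv.
move=> t; have mt := mu_filter muP t; have [tI _] := muP t.
have ett := idem_mul_star t; have [eI _] := muP (t * star t)%g.
rewrite -dom_mul_star in eI.
have := approx_unit_limit_all piR eI tI (vlim _ ett).
move=> /(predual_cvg_mul (v t) mt)[+ _]; congr (predual_cvg _ _ _ _).
by rewrite -vM mul_starK.
Qed.

Context {D : banachAlgType K} (q : (S -> A) -> D).
Hypothesis qP : is_crossed_product alpha q.
Local Notation gen := (gen q).
Variables (iota : A -> D) (u : S -> bidual D).
Hypothesis iotaR : representation iota.
Hypothesis iota_gen : forall e a, idem e -> Dom e a -> iota a = gen a e.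
Hypothesis u_cvg : forall t (f : dual D),
  (f (gen a t) : K^o) @[a --> mu t] --> (u t f : K^o).
Hypothesis cov_gen : forall t a, Dom t a -> cov_mul iota u a t = gen a t.
Hypothesis univ : universal_cov alpha iota u.

(** The element v_t attached to Psi is the weak-* limit of the images of the
    generators at t. *)
Lemma dual_correspondence : one_to_one
  (fun Psi : D -> B => representation Psi)
  (fun pv : (A -> B) * (S -> B) => dual_cov_description j alpha one pv.1 pv.2)
  (fun Psi pv => forall a t, Dom t a ->
     Psi (cov_mul iota u a t) = pv.1 a *b pv.2 t).
Proof.
split=> [Psi PsiR|[pi v] /= desc]; last first.
  have [cov' _] := (dual_description pi v).2 desc.
  have [Psi [[PsiR PsiE] Psiu]] := univ cov'.
  have E a t : cov_mul pi (fun t => embed (v t)) a t = pi a *b v t.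
    by rewrite /cov_mul arens_embed (embedK hK).
  exists Psi; split; first by split=> // a t ta; rewrite PsiE.
  move=> Psi' [Psi'R Psi'E]; apply: Psiu; split=> // a t ta.
  by rewrite Psi'E // E.
have vex t : exists b : B, pcvg (fun m => Psi (gen m t)) (mu t) b.
  apply: (@bidual_predual_cvg _ _ _ (bidual_push Psi (u t))) => f.
  rewrite (bidual_pushE PsiR) /=; have := @u_cvg t (dual_pull Psi f).
  by rewrite (dual_pullE PsiR).
have [v vP] := choice vex; pose pi := Psi \o iota.
have piR : representation pi := rep_comp iotaR PsiR.
have PsiC (T : Type) (F : set_system T) (x : T -> D) l : Filter F ->
    x i @[i --> F] --> l -> pcvg (fun i => Psi (x i)) F (Psi l).
  move=> FF xl; apply: predual_cvg_norm.
  exact: (cvg_bounded_linear _ (rep_linear PsiR) (rep_norm PsiR) xl).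
have Psi_lim t (d : D) l : (gen m t *b d @[m --> mu t] --> l -> v t *b Psi d = Psi l) /\
    (d *b gen m t @[m --> mu t] --> l -> Psi d *b v t = Psi l).
  have mt := mu_filter muP t; have [vl vr] := predual_cvg_mul (Psi d) mt (vP t).
  split=> /(PsiC _ _ _ _ _) cl; apply: (predual_cvg_unique mt) cl.
    by apply: predual_cvg_eq vl; apply: filterE => m /=; rewrite (rep_mul _ _ PsiR).
  by apply: predual_cvg_eq vr; apply: filterE => m /=; rewrite (rep_mul _ _ PsiR).
have piv t a : Dom t a -> pi a *b v t = Psi (gen a t).
  by move=> ta; apply: (Psi_lim t _ _).2; exact: (iota_gen_cvg hK qP muP iota_gen).
have vpi t a : Dom (star t) a -> v t *b pi a = Psi (gen (act alpha t a) t).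
  by move=> ta; apply: (Psi_lim t _ _).1; exact: (gen_iota_cvg hK qP muP iota_gen).
have vn : dual_normalized j mu pi v.
  move=> t; have mt := mu_filter muP t; apply: predual_cvg_eq (vP t).
  by apply: filterS (mu_dom muP t) => m tm /=; rewrite -piv.
have cov' : covariant_rep alpha pi (fun t => embed (v t)).
  split.
  - split=> // t; apply: bidual_le_embed.
    apply: (predual_cvg_le (mu_filter muP t) ler01 _ (vP t)).
    have mt := mu_filter muP t; apply: filterS (mu_ball muP t) => m [tm m1] /=.
    apply: le_trans m1; apply: le_trans (gen_norm hK qP tm); by case: PsiR.
  - move=> t a ta; rewrite !arens_embed vpi // piv; last exact: act_dom.
    by split=> //; exists (Psi (gen (act alpha t a) t)).
  - move=> s t a sta; have [sa _] := (domE alpha s t a).1 sta.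
    rewrite !arens_embed !piv //; congr embed; apply: (Psi_lim t _ _).2.
    exact: (gen_gen_cvg hK qP muP).
  - by move=> e a ee ea; rewrite arens_embed piv // -iota_gen.
exists (pi, v); split.
  split; first exact/dual_description.
  by move=> a t ta; rewrite cov_gen // piv.
move=> [pi' v'] /= [desc' E'].
have [[[pi'R _] _ _ cr3'] vn'] := (dual_description pi' v').2 desc'.
congr (_, _).
  apply: (rep_eq (dom_dense alpha)) => // a [e ee ea].
  have := cr3' e a ee ea; rewrite arens_embed => /(embed_inj hK) <-.
  by rewrite -E' // cov_gen // /pi /= (iota_gen ee).
apply/funext => t; have mt := mu_filter muP t.
apply: (predual_cvg_unique mt (vP t)); apply: predual_cvg_eq (vn' t).
by apply: filterS (mu_dom muP t) => m tm /=; rewrite -E' // cov_gen.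
Qed.

End dual_banach_algebras.

(** * Representations on reflexive Banach spaces *)

(** The bounded operators on E are the sections x |-> T x of the constant family
    E over E that are linear in x and bounded for the weight |x|. *)
Lemma operator_algebra_exists (K : numFieldType) (E : completeNormedModType K) :
  real_lubs K -> exists (B : banachAlgType K) (op : B -> E -> E),
  [/\ forall b, linear (op b),
      forall k a b x, op (k *: a + b) x = k *: op a x + op b x,
      forall a b x, op (a *b b) x = op a (op b x),
      forall b c, `|b| <= c <-> opnorm_le (op b) c
    & forall f c, linear f -> opnorm_le f c -> exists b, op b = f].
Proof.
move=> lubs; pose V (_ : E) := E; pose w (x : E) := `|x|.
pose mem (f : forall x, V x) := linear (f : E -> E) /\ exists c, section_bound w f c.
have [d [dM dmul dw]] : exists d : section_algebra V,
    [/\ sa_mem d = mem, sa_mul d = (fun f g x => f (g x)) & sa_weight d = w].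
  unshelve eexists (@SectionAlgebra K E V w mem (fun f g x => f (g x))
    lubs _ _ _ _ _ _ _ _ _ _) => //.
  - by move=> i; exact: normr_ge0.
  - split; first by move=> k x y; rewrite scaler0 addr0.
    by exists 0; split=> // x; rewrite normr0 mul0r.
  - move=> k f g [fl [c [c0 fc]]] [gl [c' [c'0 gc]]]; split.
      move=> l x y; rewrite fl gl !scalerDr !scalerA addrACA.
      by rewrite [k * l]mulrC.
    exists (`|k| * c + c'); split=> [|x]; first by rewrite addr_ge0 ?mulr_ge0.
    rewrite (le_trans (ler_normD _ _)) // mulrDl lerD //.
    by rewrite normrZ -mulrA ler_wpM2l //; exact: fc.
  - by move=> f [].
  - move=> f fP; split.
      move=> k x y; apply/eqP; rewrite -subr_eq0 -normr_le0.
      apply: le_add_eps => [||e e0]; rewrite ?normr_real ?real0 // add0r.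
      pose M := `|k *: x + y| + `|k| * `|x| + `|y| + 1.
      have M0 : 0 < M by rewrite ltr_wpDl // !addr_ge0 // mulr_ge0.
      have [g [gl _] [_ fg]] := fP _ (divr_gt0 e0 M0).
      have -> : f (k *: x + y) - (k *: f x + f y) =
          (f (k *: x + y) - g (k *: x + y)) - (k *: (f x - g x) + (f y - g y)).
        have -> : k *: (f x - g x) + (f y - g y) =
            (k *: f x + f y) - (k *: g x + g y).
          by rewrite scalerBr addrACA -opprD.
        by rewrite gl opprB addrA subrK.
      rewrite (le_trans (ler_normB _ _)) //.
      rewrite (le_trans (lerD (lexx _) (ler_normD _ _))) // normrZ.
      rewrite (le_trans (lerD (fg _) (lerD (ler_wpM2l (normr_ge0 k) (fg x)) (fg y)))) //.
      rewrite mulrCA -!mulrDr mulrAC ler_pdivrMr // ler_wpM2l // ?(ltW e0) //.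
      by rewrite /M /w addrA lerDl.
    have [g [_ [c [c0 gc]]] [_ fg]] := fP _ ltr01.
    exists (1 + c); split=> [|x]; first by rewrite addr_ge0.
    by rewrite -[f x](subrK (g x)) mulrDl (le_trans (ler_normD _ _)) // lerD.
  - move=> f g [fl [c [c0 fc]]] [gl [c' [c'0 gc]]]; split.
      by move=> k x y; rewrite gl fl.
    exists (c * c'); split=> [|x]; first exact: mulr_ge0.
    by rewrite (le_trans (fc _)) // -mulrA ler_wpM2l //; exact: gc.
  - move=> k f g h _ _ [hl _]; apply: functional_extensionality_dep => x.
    by rewrite hl.
  - move=> f g c c' _ _ [c0 fc] [c'0 gc]; split=> [|x]; first exact: mulr_ge0.
    by rewrite (le_trans (fc _)) // -mulrA ler_wpM2l //; exact: gc.
exists (bsection d : banachAlgType K), (fun b : bsection d => (b : forall x, V x)).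
split.
- by move=> b; have := bvalP b; rewrite dM => -[].
- by move=> k a b x; rewrite bsectionD bsectionZ.
- by move=> a b x; rewrite /= dmul.
- by move=> b c; have := bsection_normP b c; rewrite dw.
- move=> f c fl fc; have fM : sa_mem d f by rewrite dM; split=> //; exists c.
  by exists (BSection fM).
Qed.

Section reflexive_representations.
Context {R : realType} {K : numFieldType} (hK : real_or_complex R K).
Context {E : completeNormedModType K}.
Hypothesis Erefl : reflexive_space E.
Implicit Types x y z : E.

Definition weak_cvg (T : Type) (F : set_system T) (f : T -> E) (y : E) :=
  forall xi : dual E, (xi (f i) : K^o) @[i --> F] --> (xi y : K^o).

Lemma weak_cvg_unique (T : Type) (F : set_system T) (f : T -> E) y y' :
  ProperFilter F -> weak_cvg F f y -> weak_cvg F f y' -> y = y'.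
Proof.
move=> FF fy fy'; apply: (dual_separates hK) => xi.
exact: (normed_cvg_unique FF (@fy xi) (@fy' xi)).
Qed.

Lemma weak_cvg_eq (T : Type) (F : set_system T) (f g : T -> E) y : Filter F ->
  F [set i | f i = g i] -> weak_cvg F f y -> weak_cvg F g y.
Proof.
move=> FF fg fy xi; apply: cvg_trans (@fy xi); apply: near_eq_cvg.
by apply: filterS fg => i /= ->.
Qed.

Lemma cvg_weak_cvg (T : Type) (F : set_system T) (f : T -> E) y : Filter F ->
  f i @[i --> F] --> y -> weak_cvg F f y.
Proof. by move=> FF fy xi; exact: dual_cvg fy. Qed.

Lemma weak_cvg_map (T : Type) (F : set_system T) (f : T -> E) y (h : E -> E) c :
  linear h -> opnorm_le h c -> weak_cvg F f y -> weak_cvg F (h \o f) (h y).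
Proof.
move=> hl [c0 hc] fy xi; have [d [d0 xid]] := dual_bound xi.
have := fy (mk_dual (xi \o h)); rewrite (mk_dualE (c := d * c)) //.
  by move=> k x z /=; rewrite hl; exact: (dual_linear xi).
split=> [|x]; first exact: mulr_ge0.
by rewrite (le_trans (xid _)) // -mulrA ler_wpM2l.
Qed.

Lemma weak_cvg_lin (T : Type) (F : set_system T) (f g : T -> E) y z k : Filter F ->
  weak_cvg F f y -> weak_cvg F g z -> weak_cvg F (fun i => k *: f i + g i) (k *: y + z).
Proof.
move=> FF fy gz xi; rewrite (dual_linear xi).
rewrite (_ : (fun i => _) = (fun i => k *: (xi (f i) : K^o) + (xi (g i) : K^o))).
  by apply: cvgD; [apply: cvgZl_tmp; exact: fy|exact: gz].
by apply/funext => i; rewrite (dual_linear xi).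
Qed.

Lemma closed_subspace_preimage (h : E -> E) c (W : set E) : linear h ->
  opnorm_le h c -> closed W -> subspace W ->
  closed [set x | W (h x)] /\ subspace [set x | W (h x)].
Proof.
move=> hl [c0 hc] Wc [W0 WP]; split; last first.
  split=> /=; first by rewrite (linear_map0 hl).
  by move=> k x y /= Wx Wy; rewrite hl; exact: WP.
apply: closed_eps => x xP /=; rewrite (closure_id W).1 //.
apply/closureE => e e0; have c1 : 0 < c + 1 by rewrite ltr_wpDl.
have [y Wy xy] := xP _ (divr_gt0 e0 c1); exists (h y) => //.
rewrite -(linear_mapB hl) (le_trans (hc _)) //.
rewrite (@le_trans _ _ ((c + 1) * `|x - y|)) ?ler_wpM2r ?lerDl //.
by rewrite mulrC -ler_pdivlMr.
Qed.

Context {S : invSemigroupType} {A : banachAlgType K} (alpha : action S A).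
Context (mu : S -> set_system A) (one : S -> bidual A).
Hypothesis muP : unit_system alpha mu one.
Context {D : banachAlgType K} (q : (S -> A) -> D).
Hypothesis qP : is_crossed_product alpha q.
Implicit Types (s t e : S) (a b : A).
Local Notation Dom := (dom alpha).
Local Notation gen := (gen q).
Variables (iota : A -> D) (u : S -> bidual D).
Hypothesis iotaR : representation iota.
Hypothesis iota_gen : forall e a, idem e -> Dom e a -> iota a = gen a e.
Hypothesis u_le : forall t, bidual_le (u t) 1.
Hypothesis u_cvg : forall t (f : dual D),
  (f (gen a t) : K^o) @[a --> mu t] --> (u t f : K^o).
Hypothesis cov_gen : forall t a, Dom t a -> cov_mul iota u a t = gen a t.
Hypothesis univ : universal_cov alpha iota u.

Definition essential_space (pi : A -> E -> E) t : set E :=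
  closure (lspan [set pi p.1 p.2 | p in [set p : A * E | Dom t p.1]]).

Lemma essential_closed pi t : closed (essential_space pi t).
Proof. exact: closed_closure. Qed.

Lemma essential_subspace pi t : subspace (essential_space pi t).
Proof. exact/closure_subspace/lspan_subspace. Qed.

Lemma essential_mem (pi : A -> E -> E) t a x : Dom t a ->
  essential_space pi t (pi a x).
Proof. by move=> ta; apply: subset_closure; apply: lspan_sub; exists (a, x). Qed.

Lemma essential_dom pi s t : Dom s = Dom t ->
  essential_space pi s = essential_space pi t.
Proof. by rewrite /essential_space => ->. Qed.

Lemma rep_on_eval (C : banachAlgType K) (Psi : C -> E -> E) x :
  representation_on Psi ->
  linear (fun c => Psi c x) /\ opnorm_le (fun c => Psi c x) `|x|.
Proof.
move=> [_ Psil _ Psin]; split; first by move=> k a b; rewrite Psil.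
by split=> // c; rewrite mulrC; case: (Psin c) => _; exact.
Qed.

Lemma rep_on_eq (C : banachAlgType K) (X : set C) (Psi Psi' : C -> E -> E) :
  closure (lspan X) = setT -> representation_on Psi -> representation_on Psi' ->
  (forall c, X c -> Psi c = Psi' c) -> Psi = Psi'.
Proof.
move=> XT PsiR PsiR' PP; apply/funext => c; apply/funext => x.
have [l n] := rep_on_eval x PsiR; have [l' n'] := rep_on_eval x PsiR'.
apply: (congr1 (fun h => h c) (dense_linear_eq XT l l' n n' _)) => d Xd.
by rewrite PP.
Qed.

Section integrate.
Variables (pi : A -> E -> E) (v : S -> E -> E).
Hypothesis cov : covariant_rep_on alpha pi v.

(** The range of the idempotent v_e contains pi(a) E, so v_e pi(a) = pi(a), and
    alpha_e is the identity on I_e. *)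
Lemma covariant_on_idem e a : idem e -> Dom e a -> pi a \o v e = pi a.
Proof.
move=> ee ea; have [_ _ vM cr vr] := cov.
have ea' : Dom (star e) a by rewrite star_idem.
have := cr e a ea'; rewrite act_idem // => <-; apply/funext => x /=.
have : range (v e) (pi a x) by rewrite vr; exact: essential_mem.
by move=> [y _ <-]; have := congr1 (fun h => h y) (vM e e); rewrite ee /= => <-.
Qed.

(** A covariant representation on E is one in the Banach algebra of bounded
    operators on E. *)
Lemma covariant_on_integrates : exists Psi : D -> E -> E,
  representation_on Psi /\ forall a t, Dom t a -> Psi (gen a t) = pi a \o v t.
Proof.
have [[pil pilin piM pin] vP vM cr vr] := cov.
have [B [op [opl oplin opM opn opex]]] :=
  @operator_algebra_exists K E (real_or_complex_lubs hK).
have op_inj (b b' : B) : op b = op b' -> b = b'.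
  move=> bb'; apply/eqP; rewrite -subr_eq0 -normr_le0; apply/opn; split=> // x.
  by rewrite -scaleN1r addrC oplin bb' scaleN1r addNr normr0 mul0r.
have [pi' pi'E] := choice (fun a => opex _ _ (pil a) (pin a)).
have [v' v'E] := choice (fun t => opex _ _ (vP t).1 (vP t).2).
have cov' : covariant_rep alpha pi' (fun t => embed (v' t)).
  split.
  - split; last first.
      by move=> t; apply: bidual_le_embed; apply/opn; rewrite v'E; case: (vP t).
    split=> [k a b|a b|a].
    + by apply: op_inj; apply/funext => x; rewrite oplin !pi'E pilin.
    + by apply: op_inj; apply/funext => x; rewrite opM !pi'E piM.
    + by apply/opn; rewrite pi'E.
  - move=> t a ta; rewrite !arens_embed; split; last by exists (v' t *b pi' a).
    congr embed; apply: op_inj; apply/funext => x; rewrite !opM !pi'E !v'E.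
    exact: (congr1 (fun h => h x) (cr t a ta)).
  - move=> s t a _; rewrite !arens_embed -bmulA; congr (embed (_ *b _)).
    by apply: op_inj; apply/funext => x; rewrite opM !v'E vM.
  - move=> e a ee ea; rewrite arens_embed; congr embed; apply: op_inj.
    apply/funext => x; rewrite opM pi'E v'E.
    exact: (congr1 (fun h => h x) (covariant_on_idem ee ea)).
have [Psi [[[Psil PsiM Psin] PsiE] _]] := univ cov'.
exists (op \o Psi); split.
  split=> /=.
  - by move=> c; exact: opl.
  - by move=> k a b; apply/funext => x; rewrite Psil oplin.
  - by move=> a b; apply/funext => x; rewrite PsiM opM.
  - by move=> c; apply/opn.
move=> a t ta /=; rewrite -cov_gen // PsiE //.
rewrite /cov_mul arens_embed (embedK hK); apply/funext => x /=.
by rewrite opM pi'E v'E.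
Qed.

End integrate.

Section disintegrate.
Variable Psi : D -> E -> E.
Hypothesis PsiR : representation_on Psi.
Let pi a := Psi (iota a).

Let Psi_linear d : linear (Psi d). Proof. by case: PsiR. Qed.
Let Psi_bound d : opnorm_le (Psi d) `|d|. Proof. by case: PsiR. Qed.
Let Psi_mul d d' x : Psi (d *b d') x = Psi d (Psi d' x).
Proof. by case: PsiR => _ _ -> _. Qed.

(** The functionals d |-> xi (Psi d x) converge along u_t; by reflexivity their
    limit, as a function of xi, is a vector. *)
Lemma weak_limit_exists t x : exists y,
  weak_cvg (mu t) (fun m => Psi (gen m t) x) y /\ `|y| <= `|x|.
Proof.
have [el en] := rep_on_eval x PsiR.
have xP (xi : dual E) d : opnorm_le xi d ->
    opnorm_le (fun c => xi (Psi c x) : K^o) (d * `|x|).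
  move=> [d0 xid]; split=> [|c]; first exact: mulr_ge0.
  by rewrite (le_trans (xid _)) // -mulrA ler_wpM2l //; case: en => _; exact.
have xl (xi : dual E) : linear (fun c => xi (Psi c x) : K^o).
  by move=> k c c'; rewrite el; exact: (dual_linear xi).
have xE (xi : dual E) : mk_dual (fun c => xi (Psi c x) : K^o) =
    (fun c => xi (Psi c x) : K^o) :> (D -> K^o).
  by have [d xid] := dual_bound xi; exact: (mk_dualE (xl xi) (xP _ _ xid)).
pose phi (xi : dual E) : K^o := u t (mk_dual (fun c => xi (Psi c x) : K^o)).
have phil : linear phi.
  move=> k xi xi'; rewrite /phi -(bidual_linear (u t)); congr (u t _).
  by apply: dualE => c; rewrite xE /= !xE.
have phin : bidual_le phi `|x|.
  split=> // xi d xid; have [_ ut] := u_le t.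
  rewrite mulrC -[_ * _]mul1r; apply: ut; rewrite xE; exact: xP.
have [y yE] := Erefl (mk_bidual phi).
have yphi xi : phi xi = xi y.
  by have := congr1 (fun p : bidual E => p xi) yE; rewrite (mk_bidualE phil phin).
exists y; split.
  move=> xi; rewrite -yphi /phi.
  have := @u_cvg t (mk_dual (fun c => xi (Psi c x) : K^o)).
  by rewrite xE.
by apply: (embed_le hK); rewrite yE (mk_bidualE phil phin).
Qed.

Definition limit_operator t x := projT1 (cid (weak_limit_exists t x)).
Local Notation v := limit_operator.

Lemma limit_operator_cvg t x : weak_cvg (mu t) (fun m => Psi (gen m t) x) (v t x).
Proof. by rewrite /v; case: cid => y []. Qed.

Lemma limit_operator_norm t : opnorm_le (v t) 1.
Proof. by split=> // x; rewrite mul1r /v; case: cid => y []. Qed.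

Lemma limit_operator_linear t : linear (v t).
Proof.
move=> k x y; have mt := mu_filter muP t.
apply: (weak_cvg_unique mt (@limit_operator_cvg _ _)).
apply: weak_cvg_eq (@weak_cvg_lin _ _ _ _ _ _ k _ (@limit_operator_cvg t x)
  (@limit_operator_cvg t y)).
by apply: filterE => m /=; rewrite Psi_linear.
Qed.

Lemma limit_operator_mull t d l x : d *b gen m t @[m --> mu t] --> l ->
  Psi d (v t x) = Psi l x.
Proof.
move=> dl; have mt := mu_filter muP t; have [el en] := rep_on_eval x PsiR.
have := weak_cvg_map (Psi_linear d) (Psi_bound d) (@limit_operator_cvg t x).
move=> H; apply: (weak_cvg_unique mt H).
apply: weak_cvg_eq (cvg_weak_cvg _ (cvg_bounded_linear _ el en dl)).
by apply: filterE => m /=; rewrite Psi_mul.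
Qed.

Lemma limit_operator_mulr t d l x : gen m t *b d @[m --> mu t] --> l ->
  v t (Psi d x) = Psi l x.
Proof.
move=> dl; have mt := mu_filter muP t; have [el en] := rep_on_eval x PsiR.
apply: (weak_cvg_unique mt (@limit_operator_cvg t (Psi d x))).
apply: weak_cvg_eq (cvg_weak_cvg _ (cvg_bounded_linear _ el en dl)).
by apply: filterE => m /=; rewrite Psi_mul.
Qed.

Lemma pi_limit_operator t a x : Dom t a -> pi a (v t x) = Psi (gen a t) x.
Proof.
by move=> ta; apply: limit_operator_mull; exact: (iota_gen_cvg hK qP muP iota_gen).
Qed.

Lemma limit_operator_pi t a x : Dom (star t) a ->
  v t (pi a x) = Psi (gen (act alpha t a) t) x.
Proof.
by move=> ta; apply: limit_operator_mulr; exact: (gen_iota_cvg hK qP muP iota_gen).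
Qed.

Lemma limit_operator_essential t x : essential_space pi t (v t x).
Proof.
have mt := mu_filter muP t.
apply: (closed_subspace_weakly_closed hK (@essential_closed pi t)
  (@essential_subspace pi t) mt _ (@limit_operator_cvg t x)).
apply: filterS (mu_dom muP t) => m tm /=; rewrite -pi_limit_operator //.
exact: essential_mem.
Qed.

Lemma limit_operator_id e y : idem e -> essential_space pi e y -> v e y = y.
Proof.
move=> ee; have idn : opnorm_le (@id E) 1 by split=> // x; rewrite mul1r.
have idl : linear (@id E) by [].
have [cl sub] := bounded_linear_eq_closed (limit_operator_linear e) idl
  (limit_operator_norm e) idn.
apply: (closure_lspan_min cl sub) => _ [[a x] /= ea <-].
by rewrite limit_operator_pi ?star_idem // act_idem // -iota_gen.
Qed.

(** On the essential space of I_t, vectors are separated by pi(I_t): the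
    operator of t t^* is a weak limit of pi(m), m in I_t, and acts as the
    identity there. *)
Lemma essential_separated t z z' :
  essential_space pi t z -> essential_space pi t z' ->
  (forall a, Dom t a -> pi a z = pi a z') -> z = z'.
Proof.
set e := (t * star t)%g; have ee : idem e := idem_mul_star t.
have tE : Dom t = Dom e := dom_mul_star alpha t.
rewrite (essential_dom pi tE) => /(limit_operator_id ee) <- /(limit_operator_id ee) <-.
move=> zz'; have me := mu_filter muP e.
have zz a : Dom e a -> Psi (gen a e) (v e z) = Psi (gen a e) (v e z').
  by move=> ea; rewrite -!iota_gen //; apply: zz'; rewrite tE.
have vv y : v e (v e y) = v e y.
  by apply: limit_operator_id => //; exact: limit_operator_essential.
rewrite -(vv z) -(vv z').
apply: (weak_cvg_unique me (@limit_operator_cvg e (v e z))).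
apply: weak_cvg_eq (@limit_operator_cvg e (v e z')).
by apply: filterS (mu_dom muP e) => m em /=; rewrite zz.
Qed.

(** Both sides map into the essential space of I_st, and pi(a) takes both to
    Psi (gen a (st)) x for every a in I_st. *)
Lemma limit_operator_hom s t : v (s * t)%g = v s \o v t.
Proof.
apply/funext => x; apply: (@essential_separated (s * t)%g).
- exact: limit_operator_essential.
- have [cl sub] := closed_subspace_preimage (limit_operator_linear s)
    (limit_operator_norm s) (@essential_closed pi (s * t)%g)
    (@essential_subspace pi (s * t)%g).
  have sub_t : essential_space pi t `<=`
      [set x | essential_space pi (s * t)%g (v s x)]; last first.
    exact: (sub_t _ (@limit_operator_essential t x)).
  apply: (closure_lspan_min cl sub) => _ [[a y] /= ta <-]; have ms := mu_filter muP s.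
  apply: (closed_subspace_weakly_closed hK (@essential_closed pi (s * t)%g)
    (@essential_subspace pi (s * t)%g) ms _ (@limit_operator_cvg s (pi a y))).
  apply: filterS (mu_dom muP s) => m sm /=.
  have tta : Dom (t * star t)%g a by rewrite -dom_mul_star.
  rewrite /pi -Psi_mul (iota_gen (idem_mul_star t)) // (gen_mul qP) //.
  have st : Dom (s * (t * star t))%g = Dom (s * t)%g.
    by apply/seteqP; split=> c /domE[sc tc]; apply/domE; split=> //;
      rewrite -?dom_mul_star // dom_mul_star.
  rewrite -(essential_dom _ st) -pi_limit_operator; last exact: twist_dom.
  by apply: essential_mem; exact: twist_dom.
- move=> a sta /=; have [sa _] := (domE alpha s t a).1 sta.
  rewrite !pi_limit_operator //; apply/esym/limit_operator_mull.
  exact: (gen_gen_cvg hK qP muP).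
Qed.

Lemma limit_operator_covariant : covariant_rep_on alpha pi v.
Proof.
have [Psil Psilin PsiM Psin] := PsiR; split.
- split=> [a|k a b|a b|a].
  + exact: Psi_linear.
  + by rewrite /pi (rep_linear iotaR) Psilin.
  + by rewrite /pi (rep_mul _ _ iotaR) PsiM.
  + have [_ n] := Psin (iota a); split=> // x; rewrite (le_trans (n x)) //.
    by rewrite ler_wpM2r //; case: iotaR.
- by move=> t; split; [exact: limit_operator_linear|exact: limit_operator_norm].
- exact: limit_operator_hom.
- move=> t a ta; apply/funext => x /=; rewrite limit_operator_pi //.
  by rewrite pi_limit_operator //; exact: act_dom.
move=> t; apply/seteqP; split=> [_ [x _ <-]|y ty].
  exact: limit_operator_essential.
exists (v (star t) y) => //.
have := congr1 (fun h => h y) (limit_operator_hom t (star t)) => /= <-.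
apply: limit_operator_id; first exact: idem_mul_star.
by rewrite -(essential_dom pi (dom_mul_star alpha t)).
Qed.

End disintegrate.

Lemma reflexive_correspondence : one_to_one
  (fun Psi : D -> E -> E => representation_on Psi)
  (fun pv : (A -> E -> E) * (S -> E -> E) => covariant_rep_on alpha pv.1 pv.2)
  (fun Psi pv => forall a t, Dom t a ->
     Psi (cov_mul iota u a t) = pv.1 a \o pv.2 t).
Proof.
split=> [Psi PsiR|[pi v] /= cov]; last first.
  have [Psi [PsiR PsiE]] := covariant_on_integrates cov.
  exists Psi; split; first by split=> // a t ta; rewrite cov_gen // PsiE.
  move=> Psi' [PsiR' PsiE']; apply: (rep_on_eq (gens_dense hK qP)) => //.
  by move=> _ [[a t] /= ta <-]; rewrite PsiE // -PsiE' // cov_gen.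
have cov := limit_operator_covariant PsiR.
exists ((fun a => Psi (iota a)), limit_operator PsiR); split=> /=.
  split=> // a t ta; apply/funext => x /=; rewrite cov_gen //.
  by rewrite (pi_limit_operator PsiR).
move=> [pi' v'] /= [cov' E'].
have piE : (fun a => Psi (iota a)) = pi'.
  have [piR _ _ _ _] := cov; have [piR' _ _ _ _] := cov'.
  apply: (rep_on_eq (dom_dense alpha) piR piR') => a [e ee ea].
  by rewrite (iota_gen ee) // -cov_gen // E' // (covariant_on_idem cov').
congr (_, _) => //; apply/funext => t; apply/funext => x.
apply: (@essential_separated _ PsiR t).
- exact: limit_operator_essential.
- have [_ _ _ _ vr'] := cov'; rewrite piE.
  by have <- : range (v' t) = essential_space pi' t by exact: vr'; exists x.
- move=> a ta; rewrite pi_limit_operator // -cov_gen // E' //=.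
  by rewrite -piE.
Qed.

End reflexive_representations.

(** * The universal property and the correspondences *)

Theorem theorem28 (R : realType) (K : numFieldType)
    (hK : real_or_complex R K) (S : invSemigroupType) (A : banachAlgType K)
    (alpha : action S A) :
  (exists (D : banachAlgType K) (q : (S -> A) -> D),
     is_crossed_product alpha q) /\
  forall (D : banachAlgType K) (q : (S -> A) -> D),
    is_crossed_product alpha q ->
  forall (mu : S -> set_system A) (one : S -> bidual A),
    unit_system alpha mu one ->
  exists (iota : A -> D) (u : S -> bidual D),
    [/\ covariant_rep alpha iota u, normalized mu iota u
      & cov_range alpha iota u = setT] /\
    (* universal property *)
    universal_cov alpha iota u /\
    (* uniqueness of the crossed product *)
    (forall (C : banachAlgType K) (iota' : A -> C) (u' : S -> bidual C),
       covariant_rep alpha iota' u' ->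
       cov_range alpha iota' u' = setT ->
       universal_cov alpha iota' u' ->
       exists Phi : C -> D,
         isometric_isomorphism Phi /\
         forall a t, dom alpha t a ->
           Phi (cov_mul iota' u' a t) = cov_mul iota u a t) /\
    (* representations in a Banach algebra *)
    (forall B : banachAlgType K,
       one_to_one
         (fun Psi : D -> B => representation Psi)
         (fun pv : (A -> B) * (S -> bidual B) =>
            covariant_rep alpha pv.1 pv.2 /\ normalized mu pv.1 pv.2)
         (fun Psi pv => forall a t, dom alpha t a ->
            Psi (cov_mul iota u a t) = cov_mul pv.1 pv.2 a t)) /\
    (* representations in a dual Banach algebra *)
    (forall (B : banachAlgType K) (P : completeNormedModType K)
         (j : B -> dual P),
       dual_banach_algebra j ->
       (forall (pi : A -> B) (v : S -> B),
          (covariant_rep alpha pi (fun t => embed (v t)) /\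
           dual_normalized j mu pi v) <->
          dual_cov_description j alpha one pi v) /\
       one_to_one
         (fun Psi : D -> B => representation Psi)
         (fun pv : (A -> B) * (S -> B) =>
            dual_cov_description j alpha one pv.1 pv.2)
         (fun Psi pv => forall a t, dom alpha t a ->
            Psi (cov_mul iota u a t) = pv.1 a *b pv.2 t)) /\
    (* representations on a reflexive Banach space *)
    (forall E : completeNormedModType K,
       reflexive_space E ->
       one_to_one
         (fun Psi : D -> E -> E => representation_on Psi)
         (fun pv : (A -> E -> E) * (S -> E -> E) =>
            covariant_rep_on alpha pv.1 pv.2)
         (fun Psi pv => forall a t, dom alpha t a ->
            Psi (cov_mul iota u a t) = pv.1 a \o pv.2 t)).
Proof.
split; first exact: (crossed_product_exists hK alpha).
move=> D q qP mu one muP.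
have [iota [iotaR iota_gen]] := iota_exists hK qP.
have [u uP] := limit_multiplier_exists hK qP muP.
have u_le t := (uP t).1; have u_cvg t := (uP t).2.
have cov := canonical_covariant hK qP muP iotaR iota_gen u_le u_cvg.
have cov_gen := canonical_cov_mul hK qP muP iotaR iota_gen u_le u_cvg.
have range := canonical_range hK qP muP iotaR iota_gen u_le u_cvg.
have univ := canonical_universal hK qP muP iotaR iota_gen u_le u_cvg.
exists iota, u; split; last split=> //; last split; last split; last split.
- split=> //; exact: (canonical_normalized hK qP muP iota_gen u_cvg).
- move=> C iota' u'.
  exact: (canonical_unique hK qP muP iotaR iota_gen u_le u_cvg).
- exact: (normalized_correspondence hK qP muP iotaR iota_gen u_le u_cvg).
- move=> B P j jP; split; first exact: (dual_description hK jP muP).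
  exact: (dual_correspondence hK jP muP qP iotaR iota_gen u_cvg cov_gen univ).
- move=> E Erefl.
  exact: (reflexive_correspondence hK Erefl muP qP iotaR iota_gen u_le u_cvg
    cov_gen univ).
Qed.
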